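(* Suppose that there exist a continuous function $w\ge 1$ on $S$, constants $\rho, b\ge 0$, and a nondecreasing sequence $\{S_k\}$ of subsets of $S$ such that: $\int_S w(y)\,q(dy|x,a)\le \rho w(x)+b$ for all $(x,a)\in K$; $\inf_{x\notin S_k} w(x)\uparrow +\infty$ as $k\to\infty$ (with $\inf\varnothing:=\infty$); $S_k\uparrow S$ and $\sup_{a\in A(x),\,x\in S_k}|q(\{x\}|x,a)|<\infty$ for all $k\ge 1$. Then: (a) For each $\pi\in\Pi$, the occupation measure $\eta^\pi$ satisfies $$\alpha\hat\eta^\pi(D)=\alpha\gamma(D)+\int_{S\times A}q(D|x,a)\,\eta^\pi(dx,da)\qquad\forall D\in\mathcal B(S)\text{ with }\sup_{x\in D}q^*(x)<\infty.$$ (b) Conversely, if a probability measure $\eta$ on $S\times A$, concentrated on $K$, satisfies $$\alpha\hat\eta(D)=\alpha\gamma(D)+\int_{S\times A}q(D|x,a)\,\eta(dx,da)\qquad\forall D\in\mathcal B(S)\text{ with }\sup_{x\in D}q^*(x)<\infty$$ and $\int_S|q(\{x\}|x,\phi^\eta)|\,\hat\eta(dx)<\infty$, then $\eta^{\phi^\eta}=\eta$. (c) If, in addition, $\alpha>\rho$, $\int_S w(x)\gamma(dx)<\infty$, and $q^*(x)\le Lw(x)$ for all $x\in S$ with some constant $L>0$, then $\phi^{\eta^\phi}=\phi$ for all $\phi\in\Pi_s$ (equality holding $\hat\eta^\phi$-almost everywhere).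
   Context: Model. $S$ (states) and $A$ (actions) are Polish spaces with Borel $\sigma$-algebras $\mathcal B(S),\mathcal B(A)$; for each $x\in S$, $A(x)\subseteq A$ is a Borel set of admissible actions; $K:=\{(x,a): x\in S, a\in A(x)\}$ is a Borel subset of $S\times A$. The transition rates $q(\cdot|x,a)$, $(x,a)\in K$, satisfy: for fixed $(x,a)$, $q(\cdot|x,a)$ is a signed measure on $\mathcal B(S)$, and for fixed $D\in\mathcal B(S)$, $q(D|\cdot)$ is real-valued and Borel measurable on $K$; $0\le q(D|x,a)<\infty$ whenever $x\notin D\in\mathcal B(S)$; $q(S|x,a)=0$; and $q^*(x):=\sup_{a\in A(x)}|q(\{x\}|x,a)|<\infty$ for all $x\in S$. A discount factor $\alpha>0$ and a probability measure $\gamma$ on $S$ (initial distribution) are fixed. State process. Adjoin isolated points: $S_\infty:=S\cup\{x_\infty\}$, $A_\infty:=A\cup\{a_\infty\}$, $A(x_\infty):=\{a_\infty\}$, $q(\cdot|x_\infty,a_\infty)\equiv 0$. $\mathbb R_+:=(0,\infty)$, $\mathbb R_+^0:=[0,\infty)$. $\Omega$ consists of all sequences $e=(x_0,\theta_1,x_1,\theta_2,x_2,\ldots)$ in $(S\times\mathbb R_+)^\infty$ together with all sequences $(x_0,\theta_1,x_1,\ldots,\theta_{k-1},x_{k-1},\infty,x_\infty,\infty,x_\infty,\ldots)$, $k\ge1$, $x_l\in S$, $\theta_l\in\mathbb R_+$; $\mathcal F$ is the natural (product) $\sigma$-algebra. Put $T_0:=0$, $T_k:=\theta_1+\cdots+\theta_k$,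 $T_\infty:=\lim_k T_k$, $X_k:=x_k$, $\Theta_k:=\theta_k$, $h_k:=(x_0,\theta_1,x_1,\ldots,\theta_k,x_k)$; $\xi_t:=x_k$ if $T_k\le t<T_{k+1}$ and $\xi_t:=x_\infty$ if $t\ge T_\infty$; $\xi_{t-}$ is the left limit ($\xi_{t-}=x_k$ for $T_k<t\le T_{k+1}$, $\xi_{0-}:=x_0$, $\xi_{t-}=x_\infty$ after absorption). Let $\mu^*(dt,dx):=\sum_{k\ge0}I_{\{T_k<\infty\}}\delta_{(T_k,X_k)}(dt,dx)$, $\mathcal F_t:=\sigma\{\mu^*([0,s]\times D): s\in[0,t], D\in\mathcal B(S)\}$, $\mathcal F_{s-}:=\bigvee_{t<s}\mathcal F_t$; the predictable $\sigma$-algebra on $\Omega\times\mathbb R_+^0$ is generated by the sets $B\times\{0\}$ ($B\in\mathcal F_0$) and $C\times(s,\infty)$ ($C\in\mathcal F_{s-}$, $s>0$). Policies. A policy is a transition probability $\pi(da|e,t)$ from $\Omega\times\mathbb R_+^0$ with the predictable $\sigma$-algebra to $(A_\infty,\mathcal B(A_\infty))$ such that $\pi(A(\xi_{t-}(e))|e,t)\equiv1$. $\Pi$ is the set of all policies. $\Pi_s$ (randomized stationary policies) is the set of stochastic kernels $\phi$ on $A$ given $S$ with $\phi(A(x)|x)=1$ for all $x\in S$, identified with the policies $\pi(da|e,t)=I_{\{t<T_\infty\}}(e)\phi(da|\xi_{t-}(e))+I_{\{t\ge T_\infty\}}(e)\delta_{a_\infty}(da)$. For $\phi\in\Pi_s$,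 $q(D|x,\phi):=\int_A q(D|x,a)\phi(da|x)$. Probability measure. For $\pi\in\Pi$ and a probability measure $\gamma$ on $S$, the predictable intensity $m(D|e,t):=\int_A\pi(da|e,t)\,q(D\setminus\{\xi_{t-}(e)\}|\xi_{t-}(e),a)$ has a representation $m(D|e,t)=m_k(D|h_k(e),t-T_k)$ on $\{T_k<t\le T_{k+1}\}$. $P^\pi_\gamma$ is the unique probability measure on $(\Omega,\mathcal F)$ such that $x_0$ has law $\gamma$ and, given $h_k$ with $x_k\in S$, $P^\pi_\gamma(\Theta_{k+1}\in dt,X_{k+1}\in dx|h_k)=m_k(dx|h_k,t)e^{-\int_0^t m_k(S|h_k,v)dv}dt$ and $P^\pi_\gamma(\Theta_{k+1}=\infty,X_{k+1}=x_\infty|h_k)=e^{-\int_0^\infty m_k(S|h_k,v)dv}$. $E^\pi_\gamma$ is its expectation. Occupation measures. For $\pi\in\Pi$, $\eta^\pi$ is the probability measure on $S\times A$, concentrated on $K$, given by $\eta^\pi(D\times\Gamma):=\alpha\int_0^\infty e^{-\alpha t}E^\pi_\gamma[I_{\{\xi_t\in D\}}\pi(\Gamma|e,t)]dt$, $D\in\mathcal B(S),\Gamma\in\mathcal B(A)$. For a probability measure $\eta$ on $S\times A$ concentrated on $K$, $\hat\eta$ is its marginal on $S$ and $\phi^\eta\in\Pi_s$ is a randomized stationary policy determined by the disintegration $\eta(dx,da)=\hat\eta(dx)\phi^\eta(da|x)$ (unique up to $\hat\eta$-null sets). *)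

(* Defs.v *)
From HB Require Import structures.
From mathcomp Require Import all_boot all_order all_algebra.
From mathcomp Require Import all_classical all_reals all_analysis.
From mathcomp Require Import measurable_realfun.
Set Implicit Arguments.
Unset Strict Implicit.
Unset Printing Implicit Defensive.
Import Order.TTheory GRing.Theory Num.Theory.
Import numFieldNormedType.Exports.

Local Open Scope classical_set_scope.
Local Open Scope ring_scope.
Local Open Scope ereal_scope.

(* Separable and completely metrizable. *)
Definition polish (R : realType) (T : topologicalType) : Prop :=
  (exists2 D : set T, countable D & dense D) /\
  exists d : T -> T -> R,
    [/\ forall x y, (0 <= d x y)%R /\ ((d x y = 0)%R <-> x = y),
        forall x y, d x y = d y x,
        forall x y z, (d x z <= d x y + d y z)%R,
        forall x (U : set T),
          nbhs x U <-> exists2 r : R, (0 < r)%R & [set y | (d x y < r)%R] `<=` U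
      & forall u : nat -> T,
          (forall r : R, (0 < r)%R -> exists N, forall m n, (N <= m)%N ->
             (N <= n)%N -> (d (u m) (u n) < r)%R) ->
          exists l : T, u @ \oo --> l].

Notation borel T := (g_sigma_algebraType (@open T)).

(* [option T] is [T] with one isolated point [None] adjoined: a set is
   measurable iff its trace on [T] is. *)
Definition option_display : measure_display -> measure_display.
Proof. exact. Qed.

Section option_measurable.
Context d (T : measurableType d).

Definition option_measurable : set (set (option T)) :=
  [set B | measurable (Some @^-1` B)].

Lemma option_measurable0 : option_measurable set0.
Proof. by rewrite /option_measurable/= preimage_set0. Qed.

Lemma option_measurableC B : option_measurable B -> option_measurable (~` B).
Proof. by rewrite /option_measurable/= preimage_setC; exact: measurableC. Qed.

Lemma option_measurable_bigcup (F : (set (option T))^nat) :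
  (forall i, option_measurable (F i)) -> option_measurable (\bigcup_i F i).
Proof.
move=> mF; rewrite /option_measurable/= preimage_bigcup.
by apply: bigcup_measurable => i _; exact: mF.
Qed.

HB.instance Definition _ := @isMeasurable.Build (option_display d) (option T)
  option_measurable option_measurable0 option_measurableC
  option_measurable_bigcup.

End option_measurable.

(* Integral against a signed measure, via the Jordan decomposition; the value
   does not depend on the Hahn decomposition that is chosen. *)
Definition charge_integral d (T : measurableType d) (R : realType)
    (nu : {charge set T -> \bar R}) (f : T -> \bar R) : \bar R :=
  let: exist _ hP := cid (Hahn_decomposition nu) in
  let: exist _ hN := cid hP in
  \int[jordan_pos hN]_y f y - \int[jordan_neg hN]_y f y.

Section model.
Context {R : realType} {S A : ptopologicalType}.
Variables (adm : S -> set A).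
Variable q : S -> A -> {charge set (borel S) -> \bar R}.

Definition graph : set (borel S * borel A) := [set z | adm z.1 z.2].

(* An empty [adm x] yields [-oo], which is harmless in the upper bounds where
   [qstar] occurs. *)
Definition qstar (x : S) : \bar R :=
  ereal_sup [set `|q x a [set x]| | a in adm x].

(* [q x a] is only meaningful for [a] in [adm x]; its values elsewhere are
   never used. *)
Record ctmdp : Prop := Ctmdp {
  adm_measurable : forall x, measurable (adm x : set (borel A)) ;
  graph_measurable : measurable graph ;
  rate_measurable : forall D : set (borel S), measurable D ->
    measurable_fun graph (fun z => q z.1 z.2 D : \bar R) ;
  rate_ge0 : forall x a (D : set (borel S)), adm x a -> measurable D ->
    ~ D x -> 0 <= q x a D ;
  rate_conservative : forall x a, adm x a -> q x a setT = 0 ;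
  rate_stable : forall x, qstar x < +oo }.

End model.

Section paths.
Context {R : realType} {S : ptopologicalType}.

(* [None] is the point at infinity. The sojourn time in [x k] is [theta k]: the
   index is one less than in the usual enumeration, where it is theta_(k+1). *)
Definition is_path (x : nat -> option S) (theta : nat -> \bar R) : Prop :=
  (forall k, x k <> None /\ 0 < theta k < +oo) \/
  (exists n, [/\ forall k, (k <= n)%N -> x k <> None,
                 forall k, (k < n)%N -> 0 < theta k < +oo,
                 forall k, (n <= k)%N -> theta k = +oo
               & forall k, (n < k)%N -> x k = None]).

Record path := Path {
  state : nat -> option S ;
  sojourn : nat -> \bar R ;
  pathP : is_path state sojourn }.

Lemma is_path_const :
  is_path (fun k => if k is 0%N then Some point else None) (fun=> +oo).
Proof.
by right; exists 0%N; split=> // -[|k]//.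
Qed.

HB.instance Definition _ := gen_eqMixin path.
HB.instance Definition _ := gen_choiceMixin path.
HB.instance Definition _ := isPointed.Build path (Path is_path_const).

Definition cylinder : set (set path) :=
  [set E | exists k (B : set (option (borel S))),
     measurable B /\ E = [set e | B (state e k)]] `|`
  [set E | exists k (C : set (\bar R)),
     measurable C /\ E = [set e | C (sojourn e k)]].

Definition jump_time (e : path) (k : nat) : \bar R :=
  \sum_(i < k) sojourn e i.

Definition explosion (e : path) : \bar R := limn (jump_time e).

Definition xi (e : path) (t : R) : option S :=
  if explosion e <= t%:E then None
  else state e (get [set k | jump_time e k <= t%:E < jump_time e k.+1]).

Definition xi_left (e : path) (t : R) : option S :=
  if t == 0%R then state e 0%N
  else if explosion e <= t%:E then None
  else state e (get [set k | jump_time e k < t%:E <= jump_time e k.+1]).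

Definition mu_star (e : path) (B : set (measurableTypeR R * borel S)) : \bar R :=
  \sum_(0 <= k <oo)
    match jump_time e k, state e k with
    | r%:E, Some x => \d_((r, x) : measurableTypeR R * borel S) B
    | _, _ => 0
    end.

Definition filtration (t : R) : set (set path) :=
  <<s [set E | exists s (D : set (borel S)) (B : set (\bar R)),
        [/\ (0 <= s <= t)%R, measurable D, measurable B
          & E = [set e | B (mu_star e (`[0%R, s] `*` D))]]] >>.

Definition filtration_left (s : R) : set (set path) :=
  <<s \bigcup_(t in [set t : R | (0 <= t < s)%R]) filtration t >>.

(* Times range over [R] rather than over the nonnegative half-line. All the
   generators lie in nonnegative times, so that the negative times form one
   atom and the trace on nonnegative times is the predictable sigma-algebra. *)
Definition predictable_gen : set (set (path * R)) :=
  [set B `*` [set 0%R] | B in filtration 0%R] `|`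
  [set E | exists s C, [/\ (0 < s)%R, filtration_left s C
                         & E = C `*` [set` `]s, +oo[%R]]].

Definition hist (k : nat) (e : path) :
    option (borel S) * k.-tuple (\bar R * option (borel S)) :=
  (state e 0%N, [tuple (sojourn e i, state e i.+1) | i < k]).

End paths.
Arguments path : clear implicits.
Arguments cylinder : clear implicits.
Arguments predictable_gen : clear implicits.

Notation Omega R S := (g_sigma_algebraType (cylinder R S)).
Notation predictable R S := (g_sigma_algebraType (predictable_gen R S)).
Notation history R S k :=
  (option (borel S) * k.-tuple (\bar R * option (borel S)))%type.

Section process.
Context {R : realType} {S A : ptopologicalType}.
Variables (adm : S -> set A).
Variable q : S -> A -> {charge set (borel S) -> \bar R}.

Definition adm_infty (y : option S) : set (option A) :=
  if y is Some x then Some @` adm x else [set None].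

Definition is_policy (pi : R.-pker (predictable R S) ~> option (borel A)) :
    Prop :=
  forall (e : path R S) (t : R), (0 <= t)%R ->
    pi (e, t) (adm_infty (xi_left e t)) = 1.

Definition is_stationary (phi : R.-pker (borel S) ~> (borel A)) : Prop :=
  forall x : S, phi x (adm x) = 1.

(* For nonnegative [t], [xi_left e t] is [None] exactly when [t] is at least
   the explosion time of [e]. *)
Definition stationary_policy (phi : R.-pker (borel S) ~> (borel A))
    (et : path R S * R) (G : set (option (borel A))) : \bar R :=
  if xi_left et.1 et.2 is Some x then phi x (Some @^-1` G) else \d_None G.

(* Policies enter the definitions below only through their values, so that
   these apply both to kernels and to [stationary_policy]. *)
Variable pi : path R S * R -> set (option (borel A)) -> \bar R.

Definition intensity (e : path R S) (t : R) (D : set S) : \bar R :=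
  if xi_left e t is Some x then
    \int[pi (e, t)]_(b in Some @` adm x)
      (if b is Some a then q x a (D `\ x) else 0)
  else 0.

Definition intensity_representation
    (m : forall k, R.-ker (history R S k * measurableTypeR R)%type ~> borel S) :
    Prop :=
  forall k (e : path R S) (t : R) (D : set (borel S)), measurable D ->
    jump_time e k < t%:E <= jump_time e k.+1 ->
    intensity e t D = m k (hist k e, (t - fine (jump_time e k))%R) D.

Local Notation lambda := (@lebesgue_measure R).

(* The conditional laws given the history are stated in integrated form, over
   all events [B] of the history on which the current state is not [None]. *)
Definition path_law (gamma : probability (borel S) R)
    (P : probability (Omega R S) R) : Prop :=
  (forall D : set (borel S), measurable D ->
    P [set e | (Some @` D) (state e 0%N)] = gamma D) /\
  exists2 m, intensity_representation m &
  forall k (B : set (history R S k)), measurable B ->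
    let past := [set e : path R S | B (hist k e) /\ state e k <> None] in
    (forall (C : set (measurableTypeR R)) (D : set (borel S)),
      measurable C -> C `<=` [set` `]0%R, +oo[%R] -> measurable D ->
      P (past `&` [set e | (EFin @` C) (sojourn e k) /\
                           (Some @` D) (state e k.+1)]) =
      \int[P]_(e in past) \int[lambda]_(t in C)
        (m k (hist k e, t) D *
         expeR (- \int[lambda]_(v in `]0%R, t[) m k (hist k e, v) setT))) /\
    P (past `&` [set e | sojourn e k = +oo /\ state e k.+1 = None]) =
    \int[P]_(e in past)
      expeR (- \int[lambda]_(v in `]0%R, +oo[) m k (hist k e, v) setT).

Definition is_occupation_measure (alpha : R) (P : probability (Omega R S) R)
    (eta : probability (borel S * borel A)%type R) : Prop :=
  eta (~` graph adm) = 0 /\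
  forall (D : set (borel S)) (G : set (borel A)), measurable D -> measurable G ->
    eta (D `*` G) =
    alpha%:E * \int[lambda]_(t in `[0%R, +oo[)
      ((expR (- (alpha * t)))%:E *
       \int[P]_e ((\1_(Some @` D) (xi e t))%:E * pi (e, t) (Some @` G))).

End process.

(* So [is_occupation_measure ... eta] amounts to [eta] being eta^pi. *)
Lemma occupation_measure_unique (R : realType) (S A : ptopologicalType)
    (adm : S -> set A) pi (alpha : R) (P : probability (Omega R S) R)
    (eta1 eta2 : probability (borel S * borel A)%type R) :
  is_occupation_measure adm pi alpha P eta1 ->
  is_occupation_measure adm pi alpha P eta2 ->
  forall E, measurable E -> eta1 E = eta2 E.
Proof.
move=> [_ h1] [_ h2] E mE.
apply: (measure_unique
  [set D `*` G | D in @measurable _ (borel S) & G in @measurable _ (borel A)]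
  (fun=> setT)) => //.
- exact: measurable_prod_measurableType.
- move=> _ _ [D1 mD1 [G1 mG1 <-]] [D2 mD2 [G2 mG2 <-]]; rewrite -setXI.
  exists (D1 `&` D2); first exact: measurableI.
  by exists (G1 `&` G2) => //; exact: measurableI.
- by move=> _; exists setT => //; exists setT => //; rewrite setXTT.
- by rewrite bigcup_const.
- move=> _ [D mD [G mG <-]].
  exact: etrans (h1 _ _ mD mG) (esym (h2 _ _ mD mG)).
- by move=> _; exact: (le_lt_trans (probability_le1 eta1 measurableT) (ltry _)).
Qed.

Section occupation.
Context {R : realType} {S A : ptopologicalType}.
Implicit Types eta : probability (borel S * borel A)%type R.

Definition marginal eta : set (borel S) -> \bar R := pushforward eta fst.

Definition balance_equation (adm : S -> set A)
    (q : S -> A -> {charge set (borel S) -> \bar R}) (alpha : R)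
    (gamma : probability (borel S) R) eta : Prop :=
  forall D : set (borel S), measurable D ->
    ereal_sup [set qstar adm q x | x in D] < +oo ->
    alpha%:E * marginal eta D =
    alpha%:E * gamma D + \int[eta]_(z in graph adm) q z.1 z.2 D.

(* The randomized stationary policies that may serve as phi^eta. *)
Definition disintegrates (adm : S -> set A) eta
    (phi : R.-pker (borel S) ~> (borel A)) : Prop :=
  is_stationary adm phi /\
  forall (D : set (borel S)) (G : set (borel A)), measurable D -> measurable G ->
    eta (D `*` G) = \int[marginal eta]_(x in D) phi x G.

End occupation.

(* Main.v *)
From HB Require Import structures.
Require Import Defs.
From mathcomp Require Import all_boot all_order all_algebra.
From mathcomp Require Import all_classical all_reals all_analysis.
From mathcomp Require Import measurable_realfun.
From mathcomp Require Import lra ring.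
Set Implicit Arguments.
Unset Strict Implicit.
Unset Printing Implicit Defensive.
Import Order.TTheory GRing.Theory Num.Theory.
Import numFieldNormedType.Exports.
Local Open Scope classical_set_scope.
Local Open Scope ring_scope.
Local Open Scope ereal_scope.
Import HBNNSimple.

(** The signed rates [q x a] are split into a jump measure [Q (x, a)], which is
    [q x a] with the current state removed, and the exit rate [Q (x, a) setT];
    then [q x a D] is [Q (x, a) D] minus [\1_D x * Q (x, a) setT]. Only
    nonnegative quantities remain, so that everything below is a computation
    with integrals in [0, +oo].

    Fix a policy, a discount rate beta > 0 and a set B0 of initial states. Let
    N_k be the law of the k-th state X_k, restricted to X_0 in B0 and weighted
    by e^(- beta T_k), and let M_k be the law of state and action integrated
    with the density e^(- beta t) over the sojourn between T_k and T_(k+1). The law of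
    the next sojourn time and state gives two linear relations
    ([occupation_recursion]): a jump out of the k-th sojourn leads to the next
    visit, N_(k+1)(D) = int Q z D dM_k(z), and a visit ends by discounting or by
    a jump, N_k(D) = beta M_k(D x A) + int_(z.1 in D) Q z setT dM_k(z). The proof
    of these only uses that exp(- int l) has derivative - l exp(- int l), in an
    integrated form that makes sense for a measurable intensity l
    ([survival_identity]). Everything else follows from the two relations.

    Nonexplosion. If beta is at least rho + b, the drift condition and the
    relations make the integrals of w against N_k nonincreasing in k. If they
    are finite, most of the mass of N_k lies in a set where w, and hence the
    rates, are bounded. There the mass of beta M_k is comparable to that of N_k;
    as the masses of the beta M_k sum to at most that of N_0, the mass of N_k
    tends to 0 ([weighted_visits_vanish]). The integrals are finite if B0 is a
    sublevel set of w, and since y <= eps + eps^(- p) y^p the discount rate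
    p alpha controls the discount rate alpha ([visits_vanish]). From here on
    beta = alpha and B0 = S.

    (a) The measure alpha sum_k M_k is the occupation measure
    ([occupation_series]). Adding up the relations telescopes, the boundary term
    N_n vanishes in the limit ([total_flow]), and on a set of states with bounded
    rates one may go back from Q to q ([balance_jump_rate]).

    (b) Let eta satisfy the balance equation and let the policy be stationary,
    with kernel phi. Both eta and all M_k have the conditional law phi of the
    action given the state, so that only their marginals matter. By induction on
    n, the sum of alpha M_k over k < n is at most eta: weighted with alpha plus
    the exit rate, its marginal for n + 1 is alpha times gamma plus the jumps out
    of the sum for n, which is at most the same expression for eta, and that is
    the weighted marginal of eta by the balance equation ([partial_stays_le]). In
    the limit the occupation measure is at most eta; both are probabilities, so
    they coincide ([flow_solution_unique]).

    (c) The occupation measure of a stationary policy has the conditional law phi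
    since every M_k does, and on a Polish space conditional laws are unique up to
    null sets ([kernels_ae_equal]). *)

(** * Measures built from other measures *)

(** The workhorse for building measures: integration against a mixture of
    measures is iterated integration, first for simple functions and then by
    monotone convergence. *)
Lemma mixture_exists d d' (Y : measurableType d) (Z : measurableType d')
    (R : realType) (mu : {measure set Y -> \bar R}) (g : Y -> R)
    (k : Y -> {measure set Z -> \bar R}) :
  (forall y, (0 <= g y)%R) -> measurable_fun setT g ->
  (forall U, measurable U -> measurable_fun setT (k ^~ U)) ->
  exists M : {measure set Z -> \bar R},
    (forall U, M U = \int[mu]_y ((g y)%:E * k y U)) /\
    (forall f, (forall z, 0 <= f z) -> measurable_fun setT f ->
      \int[M]_z f z = \int[mu]_y ((g y)%:E * \int[k y]_z f z)).
Proof.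
move=> g0 mg mk.
have mgE : measurable_fun setT (EFin \o g) by exact/measurable_EFinP.
have g0E y : 0 <= (g y)%:E by rewrite lee_fin.
pose m U := \int[mu]_y ((g y)%:E * k y U).
have m0 : m set0 = 0.
  by rewrite /m integral0_eq// => y _; rewrite measure0 mule0.
have mge0 U : 0 <= m U by apply: integral_ge0 => y _; exact: mule_ge0.
have madd : semi_sigma_additive m.
  move=> F mF tF mUF.
  rewrite [X in _ --> X](_ : _ = \int[mu]_y (\sum_(n <oo) ((g y)%:E * k y (F n)))).
    apply/cvg_closeP; split.
      by apply: is_cvg_nneseries => n _ _; exact: mge0.
    rewrite closeE// integral_nneseries// => n.
    - by apply: emeasurable_funM => //; exact: mk.
    - by move=> y _; exact: mule_ge0.
  apply: eq_integral => y _; rewrite nneseriesZl//; congr (_ * _).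
  by apply/esym/cvg_lim => //; exact/measure_semi_sigma_additive.
pose M : {measure set Z -> \bar R} :=
  HB.pack m (isMeasure.Build _ _ _ m m0 mge0 madd).
exists M; split=> // f f0 mf.
have mkf h : (forall z, 0 <= h z) -> measurable_fun setT h ->
    measurable_fun setT (fun y => (g y)%:E * \int[k y]_z h z).
  move=> h0 mh; apply: emeasurable_funM => //.
  exact: measurable_fun_integral_kernel.
have simple (h : {nnsfun Z >-> R}) :
    \int[M]_z (h z)%:E = \int[mu]_y ((g y)%:E * \int[k y]_z (h z)%:E).
  rewrite integralT_nnsfun sintegralE.
  under [RHS]eq_integral do rewrite integralT_nnsfun sintegralE.
  under [RHS]eq_integral => y _.
    rewrite ge0_mule_fsumr; last by move=> r; exact: nnsfun_mulemu_ge0.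
    over.
  rewrite ge0_integral_fsum//=; last 2 first.
  - move=> r; apply: emeasurable_funM => //; apply: measurable_funeM.
    exact: mk.
  - by move=> r y _; rewrite mule_ge0//; exact: nnsfun_mulemu_ge0.
  apply: eq_fsbigr => r _.
  have [r0|r0] := leP 0%R r; last first.
    rewrite (_ : h @^-1` [set r] = set0); last exact: preimage_nnfun0.
    rewrite m0 mule0 integral0_eq// => y _.
    by rewrite measure0 mule0 mule0.
  rewrite /= /m -ge0_integralZl//=; last 2 first.
  - by apply: emeasurable_funM => //; exact: mk.
  - by move=> y _; exact: mule_ge0.
  by apply: eq_integral => y _; rewrite muleCA.
pose h := nnsfun_approx measurableT mf.
have hf n z : 0 <= (h n z)%:E by rewrite lee_fin.
have hnd z : nondecreasing_seq (fun n => (h n z)%:E).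
  by move=> a c ac; rewrite lee_fin; exact/lefP/nd_nnsfun_approx.
have mh n : measurable_fun setT (fun z => (h n z)%:E) by exact/measurable_EFinP.
have hlim z : f z = limn (fun n => (h n z)%:E).
  by apply/esym/cvg_lim => //; exact: cvg_nnsfun_approx.
rewrite (eq_integral (fun z => limn (fun n => (h n z)%:E))); last first.
  by move=> z _; exact: hlim.
rewrite monotone_convergence//.
under eq_fun do rewrite simple.
rewrite -monotone_convergence//; last 3 first.
- by move=> n; exact: mkf.
- by move=> n y _; rewrite mule_ge0// integral_ge0.
- move=> y _ a c ac; rewrite lee_wpmul2l// ge0_le_integral//.
  by move=> z _; exact: hnd.
apply: eq_integral => y _; rewrite (eq_integral _ _ (fun z _ => hlim z)).
rewrite monotone_convergence//.
rewrite limeMl//.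
  apply: ereal_nondecreasing_is_cvgn => a c ac; rewrite ge0_le_integral//.
  by move=> z _; exact: hnd.
Qed.

Section measurable_order.
Context d (T : measurableType d) (R : realType).

Lemma measurable_set_lt (f g : T -> R) :
  measurable_fun setT f -> measurable_fun setT g ->
  measurable [set x | (f x < g x)%R].
Proof.
move=> mf mg; rewrite -[X in measurable X]setTI.
exact: (measurable_fun_ltr mf mg measurableT (Y := [set true])).
Qed.

Lemma emeasurable_set_lt (f g : T -> \bar R) :
  measurable_fun setT f -> measurable_fun setT g ->
  measurable [set x | f x < g x].
Proof.
by move=> mf mg; have := emeasurable_fun_lt measurableT mf mg; rewrite setTI.
Qed.

Lemma emeasurable_set_le (f g : T -> \bar R) :
  measurable_fun setT f -> measurable_fun setT g ->
  measurable [set x | f x <= g x].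
Proof.
by move=> mf mg; have := emeasurable_fun_le measurableT mf mg; rewrite setTI.
Qed.

Lemma emeasurable_indic (D : set T) : measurable D ->
  measurable_fun setT (fun x => (\1_D x)%:E : \bar R).
Proof. by move=> mD; apply/measurable_EFinP; exact: measurable_indic. Qed.

Lemma measure_integral_indic (mu : {measure set T -> \bar R}) (D : set T) :
  measurable D -> mu D = \int[mu]_x (\1_D x)%:E.
Proof. by move=> mD; rewrite integral_indic// setIT. Qed.

End measurable_order.

Lemma weighted_law_exists d1 d2 (T1 : measurableType d1)
    (T2 : measurableType d2) (R : realType) (mu : {measure set T1 -> \bar R})
    (g : T1 -> R) (X : T1 -> T2) :
  (forall x, (0 <= g x)%R) -> measurable_fun setT g -> measurable_fun setT X ->
  exists nu : {measure set T2 -> \bar R},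
    forall f, (forall x, 0 <= f x) -> measurable_fun setT f ->
       \int[nu]_x f x = \int[mu]_x ((g x)%:E * f (X x)).
Proof.
move=> g0 mg mX.
have md (U : set T2) : measurable U -> measurable_fun setT (fun y => \d_(X y) U : \bar R).
  move=> mU; rewrite (_ : (fun y => _) = EFin \o (\1_U \o X)); last first.
    by apply/funext => y; rewrite diracE.
  by apply/measurable_EFinP; apply: measurableT_comp.
have [nu [_ nuint]] := @mixture_exists _ _ _ _ _ mu g (fun x => \d_(X x)) g0 mg md.
exists nu => f f0 mf; rewrite nuint//; apply: eq_integral => x _.
by rewrite integral_dirac// diracT mul1e.
Qed.

Section bundled_kernel.
Context d1 d2 (X : measurableType d1) (Y : measurableType d2) (R : realType).

(** The proofs are arguments so that the kernel structure can be attached to a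
    bare family of measures. *)
Definition bundled_kernel (pi : X -> {measure set Y -> \bar R})
  & (forall U, measurable U -> measurable_fun setT (pi ^~ U))
  & (forall x, pi x setT = 1) := pi.

Variable pi : X -> {measure set Y -> \bar R}.
Hypothesis mpi : forall U, measurable U -> measurable_fun setT (pi ^~ U).
Hypothesis pi1 : forall x, pi x setT = 1.

HB.instance Definition _ := isKernel.Build _ _ _ _ R (bundled_kernel mpi pi1) mpi.

HB.instance Definition _ :=
  Kernel_isProbability.Build _ _ _ _ R (bundled_kernel mpi pi1) pi1.

Lemma measurable_fun_integral_probability (f : X * Y -> \bar R) :
  measurable_fun setT f -> (forall z, 0 <= f z) ->
  measurable_fun setT (fun x => \int[pi x]_y f (x, y)).
Proof.
move=> mf f0.
exact: (@measurable_fun_integral_finite_kernel _ _ _ _ _ f (bundled_kernel mpi pi1)).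
Qed.

End bundled_kernel.

Lemma mixed_law_exists d0 d1 d2 (T0 : measurableType d0)
    (T1 : measurableType d1) (T2 : measurableType d2) (R : realType)
    (mu : {measure set T0 -> \bar R}) (g : T0 -> R)
    (pi : T0 -> {measure set T1 -> \bar R}) (h : T0 * T1 -> T2) :
  (forall x, (0 <= g x)%R) -> measurable_fun setT g ->
  (forall U, measurable U -> measurable_fun setT (pi ^~ U)) ->
  (forall x, pi x setT = 1) -> measurable_fun setT h ->
  exists nu : {measure set T2 -> \bar R},
    forall f, (forall z, 0 <= f z) -> measurable_fun setT f ->
      \int[nu]_z f z = \int[mu]_x ((g x)%:E * \int[pi x]_y f (h (x, y))).
Proof.
move=> g0 mg mpi pi1 mh.
have mhx x : measurable_fun setT (fun y => h (x, y)).
  exact: measurable_fun_pair2.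
have /choice[K KE] x := weighted_law_exists (pi x) (fun _ => ler01)
  (measurable_cst (1%R : R)) (mhx x).
have {}KE x f : (forall z, 0 <= f z) -> measurable_fun setT f ->
    \int[K x]_z f z = \int[pi x]_y f (h (x, y)).
  by move=> f0 mf; rewrite KE//; apply: eq_integral => y _; rewrite mul1e.
have mK U : measurable U -> measurable_fun setT (K ^~ U).
  move=> mU; rewrite (_ : (fun x => _) = fun x => \int[pi x]_y (\1_U (h (x, y)))%:E).
    apply: (measurable_fun_integral_probability mpi pi1 (f := fun z => (\1_U (h z))%:E)) => //.
    have mI : measurable_fun setT (fun z : T2 => (\1_U z)%:E : \bar R).
      exact: emeasurable_indic.
    exact: (measurableT_comp mI mh).
  apply/funext => x; rewrite -(KE x (fun z => (\1_U z)%:E))//.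
    exact: measure_integral_indic.
  exact: emeasurable_indic.
have [nu [_ nuint]] := mixture_exists mu g0 mg mK.
by exists nu => f f0 mf; rewrite nuint//; apply: eq_integral => x _; rewrite KE.
Qed.

(** Rectangles are stable under intersection and generate the product. *)
Lemma measure_eq_rectangles d1 d2 (T1 : measurableType d1)
    (T2 : measurableType d2) (R : realType)
    (m1 m2 : {measure set (T1 * T2) -> \bar R}) :
  (forall A B, measurable A -> measurable B -> m1 (A `*` B) = m2 (A `*` B)) ->
  m1 setT < +oo -> forall E, measurable E -> m1 E = m2 E.
Proof.
move=> h m1T E mE.
apply: (measure_unique
  [set A `*` B | A in @measurable _ T1 & B in @measurable _ T2]
  (fun=> setT)) => //.
- exact: measurable_prod_measurableType.
- move=> _ _ [D1 mD1 [G1 mG1 <-]] [D2 mD2 [G2 mG2 <-]]; rewrite -setXI.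
  exists (D1 `&` D2); first exact: measurableI.
  by exists (G1 `&` G2) => //; exact: measurableI.
- by move=> _; exists setT => //; exists setT => //; rewrite setXTT.
- by rewrite bigcup_const.
- by move=> _ [D mD [G mG <-]]; exact: h.
Qed.

Lemma measurable_expeR (R : realType) : measurable_fun setT (@expeR R).
Proof.
rewrite (_ : @expeR R = fun x => if x == +oo then +oo else
  if x == -oo then 0 else (expR (fine x))%:E); last by apply/funext; case.
have mb (y : \bar R) : measurable_fun setT (fun x : \bar R => x == y).
  apply: (@measurable_fun_bool _ _ _ _ true); rewrite setTI.
  rewrite (_ : _ @^-1` _ = [set y]); first exact: emeasurable_set1.
  by apply/seteqP; split=> x /= /eqP.
apply: measurable_fun_ifT => //; apply: measurable_fun_ifT => //.
by apply/measurable_EFinP; apply: measurableT_comp.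
Qed.

Lemma integral_density d (T : measurableType d) (R : realType)
    (mu nu : {measure set T -> \bar R}) (g : T -> R) :
  measurable_fun setT g -> (forall x, (0 <= g x)%R) ->
  (forall E, measurable E -> nu E = \int[mu]_(x in E) (g x)%:E) ->
  forall f, (forall x, 0 <= f x) -> measurable_fun setT f ->
    \int[nu]_x f x = \int[mu]_x ((g x)%:E * f x).
Proof.
move=> mg g0 nuE f f0 mf.
have [M ME] := weighted_law_exists mu g0 mg (@measurable_id _ T setT).
rewrite -ME//; apply: eq_measure_integral => E mE _.
rewrite (measure_integral_indic M mE).
rewrite nuE// ME//; last exact: emeasurable_indic.
rewrite integral_mkcond; apply: eq_integral => x _; rewrite patchE indicE.
by case: ifPn => _; rewrite ?mule1 ?mule0.
Qed.

Lemma restricted_law_exists d1 d2 (T1 : measurableType d1)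
    (T2 : measurableType d2) (R : realType) (mu : {measure set T1 -> \bar R})
    (E : set T1) (X : T1 -> T2) : measurable E -> measurable_fun setT X ->
  exists nu : {measure set T2 -> \bar R},
    (forall B, measurable B -> nu B = mu (E `&` X @^-1` B)) /\
    (forall f, (forall x, 0 <= f x) -> measurable_fun setT f ->
       \int[nu]_x f x = \int[mu]_x ((\1_E x)%:E * f (X x))).
Proof.
move=> mE mX.
have m1E : measurable_fun setT (\1_E : T1 -> R) by exact: measurable_indic.
have [nu nuint] := weighted_law_exists mu (fun y => ler0n _ _) m1E mX.
exists nu; split=> // B mB.
have mXB : measurable (X @^-1` B) by rewrite -[X in measurable X]setTI; exact: mX.
rewrite (measure_integral_indic nu mB).
rewrite nuint//; last exact: emeasurable_indic.
rewrite -[E `&` _]setIT -integral_indic//; last exact: measurableI.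
by apply: eq_integral => x _; rewrite -EFinM indicI.
Qed.

(** The law of [(X, t)] when [t] has the conditional density [g (X, t)] with
    respect to [la] on the event [E]. *)
Lemma iterated_density_exists d0 d1 d2 (T0 : measurableType d0)
    (T1 : measurableType d1) (T2 : measurableType d2) (R : realType)
    (mu : {measure set T0 -> \bar R}) (la : {sigma_finite_measure set T2 -> \bar R})
    (E : set T0) (X : T0 -> T1) (g : T1 * T2 -> R) :
  measurable E -> measurable_fun setT X ->
  measurable_fun setT g -> (forall z, (0 <= g z)%R) ->
  exists nu : {measure set (T1 * T2) -> \bar R},
    forall f, (forall z, 0 <= f z) -> measurable_fun setT f ->
      \int[nu]_z f z =
      \int[mu]_e ((\1_E e)%:E * \int[la]_t ((g (X e, t))%:E * f (X e, t))).
Proof.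
move=> mE mX mg g0.
have mXt : measurable_fun setT (fun z : T0 * T2 => (X z.1, z.2)).
  apply: measurable_fun_pair => //; exact: (measurableT_comp mX measurable_fst).
have mXe e : measurable_fun setT (fun t : T2 => (X e, t)) by exact: measurable_fun_pair.
have /choice[k kE] e := weighted_law_exists la (fun t => g0 (X e, t))
  (measurableT_comp mg (mXe e)) (mXe e).
have mk U : measurable U -> measurable_fun setT (k ^~ U).
  move=> mU; have m1U : measurable_fun setT (fun z => (\1_U z)%:E : \bar R).
    exact: emeasurable_indic.
  rewrite (_ : (fun e => _) = fun e =>
      \int[la]_t ((g (X e, t))%:E * (\1_U (X e, t))%:E)); last first.
    apply/funext => e; rewrite -(kE e (fun z => (\1_U z)%:E))//.
    by rewrite integral_indic// setIT.
  apply: (@measurable_fun_fubini_tonelli_F _ _ _ _ _ la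
    (fun z => (g (X z.1, z.2))%:E * (\1_U (X z.1, z.2))%:E)) => [|z].
    apply: emeasurable_funM; last exact: measurableT_comp m1U mXt.
    by apply/measurable_EFinP; exact: measurableT_comp mg mXt.
  by rewrite mule_ge0// lee_fin.
have m1E : measurable_fun setT (\1_E : T0 -> R) by exact: measurable_indic.
have [nu [_ nuint]] := @mixture_exists _ _ _ _ _ mu \1_E k (fun y => ler0n _ _) m1E mk.
exists nu => f f0 mf; rewrite nuint//; apply: eq_integral => e _.
by rewrite kE.
Qed.

(** The time elapsed since a jump is turned into absolute time. *)
Lemma lebesgue_shift (R : realType) (c : R) (f : R -> \bar R) :
  measurable_fun setT f -> (forall x, 0 <= f x) ->
  \int[@lebesgue_measure R]_x f (x + c)%R = \int[@lebesgue_measure R]_x f x.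
Proof.
move=> mf f0.
have mshift : measurable_fun setT (fun x : measurableTypeR R => (x + c)%R : measurableTypeR R).
  exact: measurable_funD.
have := @ge0_integral_pushforward _ _ _ _ R _ mshift (@lebesgue_measure R)
  setT f measurableT mf (fun x _ => f0 x).
rewrite preimage_setT => <-; apply: eq_measure_integral => E mE _.
apply/esym; apply: lebesgue_measure_unique => // _ [[a b] _ <-] /=.
rewrite /pushforward (_ : _ @^-1` _ = `](a - c)%R, (b - c)%R]%classic).
  rewrite !lebesgue_measure_itv/= !lte_fin ltrD2r.
  by case: ifP => // _; rewrite -!EFinB; congr EFin; ring.
by apply/seteqP; split=> x /=; rewrite !in_itv/= ltrBlDr lerBrDr.
Qed.

(** * Visits and sojourns of a jump mechanism *)

Section recursion.
Context d1 d2 (X : measurableType d1) (Y : measurableType d2) (R : realType).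
Variables (K : set (X * Y)) (Q : X * Y -> {measure set X -> \bar R}) (beta : R).
Variables (N : nat -> {measure set X -> \bar R})
          (M : nat -> {measure set (X * Y) -> \bar R}).
Hypotheses (mK : measurable K) (beta_gt0 : (0 < beta)%R).
Hypothesis mQ : forall D, measurable D -> measurable_fun setT (Q ^~ D).
Hypothesis Q_fin : forall z, Q z setT \is a fin_num.
Hypothesis M_K : forall k, M k (~` K) = 0.
Hypothesis next : forall k D, measurable D -> N k.+1 D = \int[M k]_z Q z D.
Hypothesis split : forall k D, measurable D -> N k D =
  beta%:E * M k (D `*` setT) + \int[M k]_z ((\1_D z.1)%:E * Q z setT).

Let m1 : measurable_fun setT (fst : X * Y -> X). Proof. exact: measurable_fst. Qed.

Let mind (D : set X) : measurable D ->
  measurable_fun setT (fun z : X * Y => (\1_D z.1)%:E : \bar R).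
Proof.
by move=> mD; apply/measurable_EFinP; apply: measurableT_comp => //; exact: measurable_indic.
Qed.

Lemma integral_strip (nu : {measure set (X * Y) -> \bar R}) D : measurable D ->
  \int[nu]_z (\1_D z.1)%:E = nu (D `*` setT).
Proof.
move=> mD; transitivity (\int[nu]_z (\1_(D `*` setT) z)%:E).
  apply: eq_integral => z _; rewrite !indicE; congr (_%:R%:E).
  by congr nat_of_bool; apply/idP/idP; rewrite !inE /= => //-[].
by rewrite integral_indic ?setIT//; exact: measurableX.
Qed.

Lemma integral_on_graph k f : measurable_fun setT f -> (forall z, 0 <= f z) ->
  \int[M k]_z f z = \int[M k]_(z in K) f z.
Proof.
move=> mf f0; rewrite (@ge0_negligible_integral _ _ _ (M k) setT (~` K))//.
  by rewrite setTD setCK.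
exact: measurableC.
Qed.

Lemma integral_next k f : (forall x, 0 <= f x) -> measurable_fun setT f ->
  \int[N k.+1]_x f x = \int[M k]_z \int[Q z]_x f x.
Proof.
move=> f0 mf.
have [nu [nuE nuint]] := @mixture_exists _ _ _ _ _ (M k) (cst 1%R) Q
  (fun _ => ler01) (measurable_cst _) mQ.
rewrite (_ : \int[N k.+1]_x f x = \int[nu]_x f x); last first.
  apply: eq_measure_integral => D mD _; rewrite nuE next//.
  by apply: eq_integral => z _; rewrite mul1e.
by rewrite nuint//; apply: eq_integral => z _; rewrite mul1e.
Qed.

(** A visit ends by discounting at rate [beta] or by a jump at rate
    [Q z setT]; again for functions instead of sets. *)
Lemma integral_split k f : (forall x, 0 <= f x) -> measurable_fun setT f ->
  \int[N k]_x f x = \int[M k]_z ((beta%:E + Q z setT) * f z.1).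
Proof.
move=> f0 mf.
pose g z := (beta + fine (Q z setT))%R.
have gE z : (g z)%:E = beta%:E + Q z setT by rewrite /g EFinD fineK.
have g0 z : (0 <= g z)%R by rewrite addr_ge0 ?fine_ge0// ltW.
have mg : measurable_fun setT g.
  by apply: measurable_funD => //; apply: measurableT_comp => //; exact: mQ.
have [nu nuint] := weighted_law_exists (M k) g0 mg m1.
rewrite (_ : \int[N k]_x f x = \int[nu]_x f x); last first.
  apply: eq_measure_integral => D mD _.
  rewrite (measure_integral_indic nu mD).
  rewrite split// nuint//; last exact: emeasurable_indic.
  rewrite -integral_strip//.
  rewrite -ge0_integralZl_EFin//; [|exact: mind|exact: ltW].
  rewrite -ge0_integralD//; last 3 first.
  - by move=> z _; rewrite mule_ge0// lee_fin ltW.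
  - by apply: measurable_funeM; exact: mind.
  - by apply: emeasurable_funM; [exact: mind|exact: mQ].
  apply: eq_integral => z _; rewrite gE indicE.
  by case: (_ \in _); rewrite ?mul1e ?mul0e ?mule1 ?mule0 ?adde0.
by rewrite nuint//; apply: eq_integral => z _; rewrite gE.
Qed.

Lemma visits_step k : N k setT = beta%:E * M k setT + N k.+1 setT.
Proof.
rewrite next// split// setXTT; congr (_ + _); apply: eq_integral => z _.
by rewrite indicT mul1e.
Qed.

Lemma visits_telescope n :
  N 0 setT = \sum_(k < n) (beta%:E * M k setT) + N n setT.
Proof.
elim: n => [|n ->]; first by rewrite big_ord0 add0e.
by rewrite big_ord_recr /= -addeA -visits_step.
Qed.

Lemma visits_nonincreasing k : N k.+1 setT <= N k setT.
Proof. by rewrite (visits_step k) leeDr// mule_ge0// lee_fin ltW. Qed.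

Section nonexplosion.
Variables (w : X -> R) (c : R).
Hypotheses (mw : measurable_fun setT w) (w_ge1 : forall x, (1 <= w x)%R).
Hypothesis c_le : (c <= beta)%R.
Hypothesis drift : forall z, K z ->
  \int[Q z]_x (w x)%:E <= (c * w z.1)%:E + Q z setT * (w z.1)%:E.
Hypothesis bounded : forall r : R, exists C : R, forall z, K z ->
  (w z.1 <= r)%R -> Q z setT <= C%:E.
Hypothesis w_N0 : \int[N 0]_x (w x)%:E < +oo.

Let w0 x : 0 <= (w x)%:E.
Proof. by rewrite lee_fin (le_trans _ (w_ge1 x)). Qed.

Let mwE : measurable_fun setT (fun x => (w x)%:E).
Proof. exact/measurable_EFinP. Qed.

(** By the drift inequality jumps increase the integral of [w] at a rate of
    at most [c], and discounting decreases it at rate [beta >= c]. *)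
Let w_N k : \int[N k]_x (w x)%:E <= \int[N 0]_x (w x)%:E.
Proof.
elim: k => // k IH; apply: le_trans IH.
rewrite integral_next// integral_split//.
have mQw : measurable_fun setT (fun z => \int[Q z]_x (w x)%:E).
  exact: measurable_fun_integral_kernel.
have mR : measurable_fun setT (fun z : X * Y => (beta%:E + Q z setT) * (w z.1)%:E).
  apply: emeasurable_funM; last exact: measurableT_comp mwE m1.
  by apply: emeasurable_funD => //; exact: mQ.
have R0 z : 0 <= (beta%:E + Q z setT) * (w z.1)%:E.
  by rewrite mule_ge0// adde_ge0// lee_fin ltW.
rewrite (@integral_on_graph k _ mQw); last by move=> z; exact: integral_ge0.
rewrite (@integral_on_graph k _ mR R0).
apply: ge0_le_integral => //.
- by move=> z _; exact: integral_ge0.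
- exact: measurable_funTS.
- exact: measurable_funTS.
- move=> z Kz; apply: le_trans (drift Kz) _.
  rewrite ge0_muleDl ?lee_fin//; last exact: ltW.
  by rewrite leeD2r// EFinM lee_wpmul2r// lee_fin.
Qed.

(** If the visits kept a mass of [delta], at least half of it would stay, by
    Markov's inequality, where the rates are bounded. Each sojourn would then
    last long enough for a fixed amount of discounting, of which there is only a
    finite supply. *)
Lemma weighted_visits_vanish (delta : R) : (0 < delta)%R -> exists k, N k setT < delta%:E.
Proof.
move=> delta0; apply: contrapT => /forallNP H.
have {}H k : delta%:E <= N k setT by rewrite leNgt; exact/negP/H.
have W0fin : \int[N 0]_x (w x)%:E \is a fin_num.
  by rewrite ge0_fin_numE// integral_ge0.
pose I := fine (\int[N 0]_x (w x)%:E).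
have I0 : (0 <= I)%R by rewrite fine_ge0// integral_ge0.
pose r := (2 * I / delta + 1)%R.
have r0 : (0 < r)%R by rewrite /r; have := divr_ge0 (mulr_ge0 (ler0n R 2) I0) (ltW delta0); lra.
(* Outside [W] the mass is at most the integral of [w] divided by [r], hence
   less than [delta / 2]. *)
have [C HC] := bounded r.
pose W := [set x : X | (w x <= r)%R].
have mW : measurable W.
  exact: emeasurable_set_le mwE (measurable_cst r%:E).
have NW k : (delta / 2)%:E <= N k W.
  have hC : N k (~` W) <= (delta / 2)%:E.
    have : r%:E * N k (~` W) <= I%:E.
      rewrite /I fineK//; apply: le_trans (w_N k).
      rewrite -integral_cst; last exact: measurableC.
      apply: (@le_trans _ _ (\int[N k]_(x in ~` W) (w x)%:E)).
        apply: ge0_le_integral => //.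
        - exact: measurableC.
        - by move=> x _; rewrite lee_fin ltW.
        - exact: measurable_funTS.
        - by move=> x /negP; rewrite -ltNge lee_fin => /ltW.
      by apply: ge0_subset_integral => //; exact: measurableC.
    rewrite -lee_pdivlMl// => /le_trans; apply.
    rewrite -EFinM lee_fin ler_pdivrMl// /r.
    have -> : ((2 * I / delta + 1) * (delta / 2) = I + delta / 2)%R.
      by field; rewrite gt_eqF.
    by rewrite lerDl divr_ge0// ltW.
  have hs : N k setT = N k W + N k (~` W).
    by rewrite -measureU ?setUv ?setICr//; exact: measurableC.
  have : delta%:E <= N k W + (delta / 2)%:E.
    by apply: le_trans (H k) _; rewrite hs leeD2l.
  rewrite -leeBlDr//; apply: le_trans.
  by rewrite -EFinB lee_fin; lra.
pose C' := Num.max C 0%R.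
have C'0 : (0 <= C')%R by rewrite le_max lexx orbT.
have CC' : (C <= C')%R by rewrite le_max lexx.
have NM k : N k W <= (beta + C')%:E * M k setT.
  rewrite split// EFinD ge0_muleDl; last 2 first.
  - by rewrite lee_fin ltW.
  - by rewrite lee_fin.
  apply: leeD.
    apply: lee_wpmul2l; first by rewrite lee_fin ltW.
    apply: le_measure => //; rewrite inE//.
    exact: measurableX.
  have mWQ : measurable_fun setT (fun z : X * Y => (\1_W z.1)%:E * Q z setT).
    by apply: emeasurable_funM; [exact: mind|exact: mQ].
  rewrite (@integral_on_graph k _ mWQ); last by move=> z; rewrite mule_ge0// lee_fin.
  apply: (@le_trans _ _ (\int[M k]_(z in K) cst C'%:E z)).
    apply: ge0_le_integral => //.
    - exact: measurable_funTS.
    - move=> z Kz; rewrite /cst indicE; have [zW|zW] := boolP (z.1 \in W).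
        rewrite mul1e (le_trans (HC z Kz _)) ?lee_fin//.
        by move: zW; rewrite inE.
      by rewrite mul0e lee_fin.
  rewrite integral_cst//; apply: lee_wpmul2l; first by rewrite lee_fin.
  by apply: le_measure => //; rewrite inE.
have N0fin : N 0 setT < +oo.
  apply: le_lt_trans w_N0.
  rewrite -[N 0 setT]mul1e -integral_cst//.
  by apply: ge0_le_integral => // x _; rewrite lee_fin.
(* The least amount by which each step decreases the mass. *)
have BC0 : (0 < beta + C')%R by rewrite ltr_pwDl.
pose eps := (beta * (delta / 2 / (beta + C')))%R.
have eps0 : (0 < eps)%R by rewrite mulr_gt0// divr_gt0// divr_gt0.
have Meps k : eps%:E <= beta%:E * M k setT.
  rewrite /eps EFinM; apply: lee_wpmul2l; first by rewrite lee_fin ltW.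
  have := le_trans (NW k) (NM k); rewrite -lee_pdivrMl//.
  by rewrite -EFinM mulrC.
have Hn n : (n%:R * eps)%:E <= N 0 setT.
  rewrite (visits_telescope n); apply: (@le_trans _ _ (\sum_(k < n) (beta%:E * M k setT))).
    elim: n => [|n IH]; first by rewrite mul0r big_ord0.
    by rewrite big_ord_recr /= -natr1 mulrDl mul1r EFinD leeD.
  by rewrite leeDl.
have N0f : N 0 setT \is a fin_num by rewrite ge0_fin_numE.
pose n := (Num.truncn (fine (N 0 setT) / eps)).+1.
have := Hn n; rewrite -(fineK N0f) lee_fin -ler_pdivlMr//.
by rewrite leNgt truncnS_gt.
Qed.

End nonexplosion.

(** Induction on [n]: the mass still in [D] is split into discounting and
    departures, and the next jump brings new arrivals. *)
Lemma partial_flow n D : measurable D ->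
  \sum_(k < n) (beta%:E * M k (D `*` setT)) +
    \sum_(k < n) \int[M k]_z ((\1_D z.1)%:E * Q z setT) + N n D =
  N 0 D + \sum_(k < n) \int[M k]_z Q z D.
Proof.
move=> mD; elim: n => [|n IH]; first by rewrite !big_ord0 !adde0 add0e.
rewrite !big_ord_recr /= [RHS]addeA -IH -next//; congr (_ + _).
by rewrite addeACA -split.
Qed.

Let mT : measurable_fun setT (fun z => Q z setT). Proof. exact: mQ. Qed.

Let m1Q D : measurable D ->
  measurable_fun setT (fun z : X * Y => (\1_D z.1)%:E * Q z setT).
Proof. by move=> mD; apply: emeasurable_funM; [exact: mind|exact: mQ]. Qed.

Section total_occupation.
Hypothesis N_cvg0 : N ^~ setT @ \oo --> 0.

Let cvg_partial (u : nat -> \bar R) : (forall k, 0 <= u k) ->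
  (fun n => \sum_(k < n) u k) @ \oo --> \sum_(0 <= k <oo) u k.
Proof.
move=> u0; rewrite (_ : (fun n => _) = fun n => \sum_(0 <= k < n) u k).
  by apply: is_cvg_nneseries => k _ _.
by apply/funext => n; rewrite big_mkord.
Qed.

Let cvg_add (u v : nat -> \bar R) (a b : \bar R) : 0 <= a -> 0 <= b ->
  u @ \oo --> a -> v @ \oo --> b -> (fun n => u n + v n) @ \oo --> a + b.
Proof. by move=> a0 b0 ua vb; apply: cvgeD => //; apply: ge0_adde_def; rewrite inE. Qed.

Let s0 (u : nat -> \bar R) : (forall k, 0 <= u k) -> 0 <= \sum_(0 <= k <oo) u k.
Proof. by move=> u0; apply: nneseries_ge0 => k _ _. Qed.

Lemma total_stay_mass : beta%:E * mseries M 0 setT = N 0 setT.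
Proof.
rewrite /mseries -nneseriesZl; last by move=> k _; exact: measure_ge0.
have b0 k : 0 <= beta%:E * M k setT by rewrite mule_ge0// lee_fin ltW.
have h := cvg_add (s0 b0) (lexx 0) (cvg_partial b0) N_cvg0.
rewrite adde0 in h; rewrite -(cvg_lim (@ereal_hausdorff R) h).
apply: (cvg_lim (@ereal_hausdorff R)).
by under eq_fun do rewrite /= -visits_telescope; exact: cvg_cst.
Qed.

Lemma total_flow D : measurable D ->
  beta%:E * mseries M 0 (D `*` setT) + \int[mseries M 0]_z ((\1_D z.1)%:E * Q z setT) =
  N 0 D + \int[mseries M 0]_z Q z D.
Proof.
move=> mD.
have b0 k : 0 <= beta%:E * M k (D `*` setT) by rewrite mule_ge0// lee_fin ltW.
have c0 k : 0 <= \int[M k]_z ((\1_D z.1)%:E * Q z setT).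
  by apply: integral_ge0 => z _; rewrite mule_ge0// lee_fin.
have d0 k : 0 <= \int[M k]_z Q z D by apply: integral_ge0.
have mQD : measurable_fun setT (fun z => Q z D) by exact: mQ.
have pos z : 0 <= (\1_D z.1)%:E * Q z setT by rewrite mule_ge0// lee_fin.
rewrite (ge0_integral_measure_series _ measurableT (fun z _ => pos z) (m1Q mD)).
rewrite (ge0_integral_measure_series _ measurableT (fun z _ => measure_ge0 (Q z) D) mQD).
rewrite /mseries -nneseriesZl; last by move=> k _; exact: measure_ge0.
have ND0 : N ^~ D @ \oo --> 0.
  apply: (squeeze_cvge _ (cvg_cst 0) N_cvg0); near=> n.
  by rewrite measure_ge0/= le_measure// inE.
have h1 := cvg_add (s0 b0) (s0 c0) (cvg_partial b0) (cvg_partial c0).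
have h2 := cvg_add (adde_ge0 (s0 b0) (s0 c0)) (lexx 0) h1 ND0.
rewrite adde0 in h2.
have h3 := cvg_add (measure_ge0 (N 0) D) (s0 d0) (cvg_cst (N 0 D)) (cvg_partial d0).
rewrite -(cvg_lim (@ereal_hausdorff R) h2); apply: (cvg_lim (@ereal_hausdorff R)).
rewrite (_ : (fun n => _) = fun n => N 0 D + \sum_(k < n) \int[M k]_z Q z D); first exact: h3.
by apply/funext => n; rewrite partial_flow.
Unshelve. all: end_near. Qed.

End total_occupation.

Section comparison.
Variables (phi : X -> {measure set Y -> \bar R}) (w : X -> R).
Hypothesis mphi : forall G, measurable G -> measurable_fun setT (phi ^~ G).
Hypothesis phi_T : forall x, phi x setT = 1.
Hypothesis mw : measurable_fun setT w.

(** The conditional law of the second coordinate given the first is [phi]. *)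
Definition disintegrated_by (nu : {measure set (X * Y) -> \bar R}) : Prop :=
  forall f, (forall z, 0 <= f z) -> measurable_fun setT f ->
    \int[nu]_z f z = \int[nu]_z \int[phi z.1]_y f (z.1, y).

Let mcond f : measurable_fun setT f -> (forall z, 0 <= f z) ->
  measurable_fun setT (fun x => \int[phi x]_y f (x, y)).
Proof. exact: measurable_fun_integral_probability. Qed.

Lemma integral_le_marginal (nu1 nu2 : {measure set (X * Y) -> \bar R}) :
  (forall D, measurable D -> nu1 (D `*` setT) <= nu2 (D `*` setT)) ->
  forall g, (forall x, 0 <= g x) -> measurable_fun setT g ->
  \int[nu1]_z g z.1 <= \int[nu2]_z g z.1.
Proof.
move=> h g g0 mg.
have pf (nu : {measure set (X * Y) -> \bar R}) :
    \int[nu]_z g z.1 = \int[pushforward nu fst]_x g x.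
  apply/esym; apply: (etrans (ge0_integral_pushforward m1 nu measurableT mg _)) => //.
rewrite !pf; apply: ge0_le_measure_integral => // D mD; rewrite /pushforward.
by have := h _ mD; rewrite (_ : D `*` setT = fst @^-1` D)//; apply/seteqP; split=> z //= [].
Qed.

(** Both integrals reduce to integrals of the same function of the first
    coordinate. *)
Lemma disintegrated_le (nu1 nu2 : {measure set (X * Y) -> \bar R}) :
  disintegrated_by nu1 -> disintegrated_by nu2 ->
  (forall D, measurable D -> nu1 (D `*` setT) <= nu2 (D `*` setT)) ->
  forall f, (forall z, 0 <= f z) -> measurable_fun setT f ->
  \int[nu1]_z f z <= \int[nu2]_z f z.
Proof.
move=> c1 c2 h f f0 mf; rewrite c1// c2//.
apply: (integral_le_marginal h (g := fun x => \int[phi x]_y f (x, y))) => //.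
  by move=> x; exact: integral_ge0.
exact: mcond.
Qed.

Let lam x := \int[phi x]_y Q (x, y) setT.
Hypothesis lam_fin : forall x, lam x < +oo.
Variable theta : {measure set (X * Y) -> \bar R}.
Hypothesis M_disintegrated : forall k, disintegrated_by (M k).
Hypothesis theta_disintegrated : disintegrated_by theta.
Hypothesis theta_flow : forall (r : R) (D : set X), measurable D ->
  D `<=` [set x | (w x <= r)%R] ->
  beta%:E * theta (D `*` setT) + \int[theta]_z ((\1_D z.1)%:E * Q z setT) =
  N 0 D + \int[theta]_z Q z D.

Let lam_ge0 x : 0 <= lam x.
Proof. by apply: integral_ge0. Qed.

Let mlam : measurable_fun setT lam.
Proof. by apply: (@mcond (fun z => Q z setT)). Qed.

Let integral_weight (nu : {measure set (X * Y) -> \bar R}) D : measurable D ->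
  \int[nu]_z ((\1_D z.1)%:E * (beta%:E + Q z setT)) =
  beta%:E * nu (D `*` setT) + \int[nu]_z ((\1_D z.1)%:E * Q z setT).
Proof.
move=> mD.
transitivity (\int[nu]_z (beta%:E * (\1_D z.1)%:E + (\1_D z.1)%:E * Q z setT)).
  apply: eq_integral => z _; rewrite ge0_muleDr//; first by rewrite muleC.
  by rewrite lee_fin ltW.
rewrite ge0_integralD//; last 3 first.
- by move=> z _; rewrite mule_ge0// lee_fin ltW.
- by apply: measurable_funeM; exact: mind.
- exact: m1Q.
rewrite ge0_integralZl_EFin//; [|exact: mind|exact: ltW].
by rewrite integral_strip.
Qed.

Let minv : measurable_fun setT (fun x => ((beta + fine (lam x))^-1)%:E).
Proof.
apply/measurable_EFinP; rewrite (_ : (fun x => _) =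
    fun x => powR (beta + fine (lam x)) (-1)).
  apply: (measurableT_comp (measurable_powR (-1)%R)).
  by apply: measurable_funD => //; exact: measurableT_comp mlam.
by apply/funext => x; rewrite powR_inv1// addr_ge0 ?fine_ge0// ltW.
Qed.

(** Under [nu] the mean exit rate given the state is [lam]; dividing by
    [beta + lam] therefore undoes the weight [beta + Q z setT]. *)
Let divide_rate (nu : {measure set (X * Y) -> \bar R}) (g : X -> \bar R) :
  disintegrated_by nu -> (forall x, 0 <= g x) -> measurable_fun setT g ->
  \int[nu]_z ((beta%:E + Q z setT) * (g z.1 * ((beta + fine (lam z.1))^-1)%:E)) =
  \int[nu]_z g z.1.
Proof.
move=> cnu g0 mg.
have lamE x : (fine (lam x))%:E = lam x by rewrite fineK// ge0_fin_numE.
have bl x : (0 < beta + fine (lam x))%R by rewrite ltr_pwDl// fine_ge0.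
have c0 x : 0 <= g x * ((beta + fine (lam x))^-1)%:E.
  by rewrite mule_ge0// lee_fin invr_ge0 ltW.
rewrite cnu; last 2 first.
- by move=> z; apply: mule_ge0 => //; rewrite adde_ge0// lee_fin ltW.
- apply: emeasurable_funM; first by apply: emeasurable_funD.
  exact: (measurableT_comp (emeasurable_funM mg minv) m1).
apply: eq_integral => z _ /=.
have mQz : measurable_fun setT (fun y => Q (z.1, y) setT).
  by apply: (measurableT_comp mT); exact: measurable_pair1.
have mbQ : measurable_fun setT (fun y => beta%:E + Q (z.1, y) setT).
  exact: emeasurable_funD.
rewrite (@ge0_integralZr _ _ _ (phi z.1) _ measurableT _ mbQ _ _ (c0 z.1)); last first.
  by move=> y _; rewrite adde_ge0// lee_fin ltW.
rewrite ge0_integralD//; last by move=> y _; rewrite lee_fin ltW.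
rewrite integral_cst// phi_T mule1 -/(lam z.1) -lamE -EFinD muleC -muleA -EFinM.
by rewrite /= mulVf ?mule1// gt_eqF.
Qed.

Let W r := [set x | (w x <= r)%R].

Let mW r : measurable (W r).
Proof.
have mwE : measurable_fun setT (fun x => (w x)%:E) by exact/measurable_EFinP.
exact: emeasurable_set_le mwE (measurable_cst r%:E).
Qed.

(** The marginal of [nu] on [W r], weighted with [beta] plus the exit rate.
    The two conclusions say how the flow equation evaluates it, and how [nu] is
    recovered from it. *)
Let weight r (nu : {measure set (X * Y) -> \bar R}) : exists2 kappa : {measure set X -> \bar R},
  forall D, measurable D -> kappa D =
    beta%:E * nu ((D `&` W r) `*` setT) +
    \int[nu]_z ((\1_(D `&` W r) z.1)%:E * Q z setT)
  & forall D, measurable D -> disintegrated_by nu ->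
    \int[kappa]_x ((\1_D x)%:E * ((beta + fine (lam x))^-1)%:E) =
    nu ((D `&` W r) `*` setT).
Proof.
have bl x : (0 < beta + fine (lam x))%R by rewrite ltr_pwDl// fine_ge0.
pose g z := (\1_(W r) z.1 * (beta + fine (Q z setT)))%R.
have g0 z : (0 <= g z)%R by rewrite mulr_ge0// addr_ge0 ?fine_ge0// ltW.
have mg : measurable_fun setT g.
  apply: measurable_funM; first by apply: measurableT_comp => //; exact: measurable_indic.
  by apply: measurable_funD => //; apply: measurableT_comp => //; exact: mQ.
have gE D z : (g z)%:E * (\1_D z.1)%:E =
    (\1_(D `&` W r) z.1)%:E * (beta%:E + Q z setT).
  rewrite /g EFinM EFinD fineK// muleAC -EFinM indicI; congr (_%:E * _).
  by rewrite mulrC.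
have [kappa kappaE] := weighted_law_exists nu g0 mg m1.
exists kappa => [D mD|D mD cnu].
  rewrite (measure_integral_indic kappa mD).
  rewrite kappaE//; last exact: emeasurable_indic.
  rewrite -integral_weight; last exact: measurableI.
  by apply: eq_integral => z _; rewrite gE.
rewrite kappaE; last 2 first.
- by move=> x; rewrite mule_ge0// lee_fin// invr_ge0 ltW.
- apply: emeasurable_funM; first exact: emeasurable_indic.
  exact: minv.
rewrite -integral_strip; last exact: measurableI.
rewrite -(divide_rate (g := fun x => (\1_(D `&` W r) x)%:E) cnu)//; last first.
  by apply: emeasurable_indic; exact: measurableI.
by apply: eq_integral => z _; rewrite !muleA gE; congr (_ * _); exact: muleC.
Qed.

Let msum_disintegrated n : disintegrated_by (msum M n).
Proof.
move=> f f0 mf; rewrite !ge0_integral_measure_sum//; last 2 first.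
- by move=> z _; exact: integral_ge0.
- by have := measurableT_comp (@mcond f mf f0) m1.
by apply: eq_bigr => k _; exact: M_disintegrated.
Qed.

(** Weighted as in [weight], the sojourns up to [n] amount to the initial law
    plus the jumps out of the sojourns before [n]. By the induction hypothesis
    this is at most the initial law plus the jumps under [theta], which is the
    weighted [theta]. *)
Lemma partial_stays_le n D : measurable D ->
  msum M n (D `*` setT) <= theta (D `*` setT).
Proof.
elim: n D => [|n IH] D mD; first by rewrite /msum big_ord0.
have IHf := disintegrated_le (@msum_disintegrated n) theta_disintegrated IH.
have le_W r : msum M n.+1 ((D `&` W r) `*` setT) <= theta ((D `&` W r) `*` setT).
  have [k1 k1E k1f] := weight r (msum M n.+1).
  have [k2 k2E k2f] := weight r theta.
  rewrite -(k1f _ mD (@msum_disintegrated n.+1)) -(k2f _ mD theta_disintegrated).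
  apply: ge0_le_measure_integral => //; last 2 first.
  - by move=> x; rewrite mule_ge0// lee_fin invr_ge0 addr_ge0 ?fine_ge0// ltW.
  - apply: emeasurable_funM => //.
    exact: emeasurable_indic.
  move=> U mU; have mUW := measurableI _ _ mU (mW r).
  (* By [theta_flow] the right hand side is an inflow, and by [partial_flow] so
     is the left hand side, one step earlier. *)
  rewrite k1E// k2E// (theta_flow mUW (@subIsetr _ _ _)).
  rewrite ge0_integral_measure_sum//; last exact: m1Q.
  rewrite /msum ge0_sume_distrr; last by move=> k _; exact: measure_ge0.
  rewrite !big_ord_recr /= addeACA -(split n mUW) partial_flow//.
  rewrite leeD2l//.
  rewrite -(@ge0_integral_measure_sum _ _ _ _ _ measurableT (fun z => Q z (U `&` W r)))//.
    by apply: IHf => //; exact: mQ.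
  exact: mQ.
(* The sublevel sets [W j] increase to the whole space. *)
pose F j := (D `&` W j%:R) `*` [set: Y].
have mF j : measurable (F j) by apply: measurableX => //; exact: measurableI.
have UF : \bigcup_j F j = D `*` setT.
  apply/seteqP; split=> [z [j _ [[]]]//|[x y] [/= Dx _]].
  exists (Num.truncn (w x)).+1 => //; split=> //; split=> //=.
  by rewrite /W/= ltW// truncnS_gt.
have ndF : nondecreasing_seq F.
  move=> i j ij; apply/subsetPset => z [[Dz Wz] _]; split=> //; split=> //.
  by rewrite /W/= (le_trans Wz)// ler_nat.
have mU : measurable (\bigcup_j F j) by rewrite UF; exact: measurableX.
have h1 := nondecreasing_cvg_mu (mu := msum M n.+1) mF mU ndF.
have h2 := nondecreasing_cvg_mu (mu := theta) mF mU ndF.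
rewrite UF in h1 h2; rewrite -(cvg_lim (@ereal_hausdorff R) h1) -(cvg_lim (@ereal_hausdorff R) h2).
apply: lee_lim; [by apply/cvg_ex; eexists; exact: h1|by apply/cvg_ex; eexists; exact: h2|].
by apply: nearW => j; exact: le_W.
Qed.

(** The total mass leaves no room between the sum of the sojourns and a
    solution [theta] above it. *)
Lemma flow_solution_unique : N ^~ setT @ \oo --> 0 -> N 0 setT < +oo ->
  beta%:E * theta setT = N 0 setT ->
  forall E, measurable E -> theta E = mseries M 0 E.
Proof.
move=> N0 Nfin thetaT.
have le E : measurable E -> mseries M 0 E <= theta E.
  move=> mE; rewrite /mseries; apply: lime_le.
    by apply: is_cvg_nneseries => k _ _.
  apply: nearW => n; rewrite big_mkord -/(msum M n E).
  have := disintegrated_le (@msum_disintegrated n) theta_disintegrated (@partial_stays_le n)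
    (f := fun z => (\1_E z)%:E).
  rewrite !integral_indic// !setIT; apply => //.
  exact: emeasurable_indic.
have eqT : mseries M 0 setT = theta setT.
  have := total_stay_mass N0; rewrite -thetaT => /(congr1 (fun t => (beta^-1)%:E * t)).
  by rewrite !muleA -EFinM mulVf ?gt_eqF// !mul1e.
have thetafin : theta setT < +oo.
  rewrite ltNge; apply/negP; rewrite leye_eq => /eqP h.
  by move: Nfin; rewrite -thetaT h gt0_muley ?lte_fin// ltxx.
move=> E mE; apply/eqP; rewrite eq_le le// andbT.
have mEc := measurableC mE.
have dec (nu : {measure set (X * Y) -> \bar R}) : nu setT = nu E + nu (~` E).
  by rewrite -measureU ?setUv ?setICr.
have fin (nu : {measure set (X * Y) -> \bar R}) U :
    measurable U -> nu setT < +oo -> nu U \is a fin_num.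
  by move=> mU h; rewrite ge0_fin_numE// (le_lt_trans _ h)// le_measure// inE.
have := dec theta; rewrite -eqT (dec (mseries M 0)) => h.
rewrite leNgt; apply/negP => lt.
have : mseries M 0 E + mseries M 0 (~` E) < theta E + theta (~` E).
  apply: lte_leD => //; last exact: le.
  by apply: fin => //; move: thetafin; rewrite -eqT.
by rewrite h ltxx.
Qed.

End comparison.

End recursion.

(** * Exponential functionals of an intensity *)

Section integral_up_to.
Context {R : realType} d (T : measurableType d).
Local Notation mu := (@lebesgue_measure R).

Lemma measurable_fun_integral_oo (f : T * measurableTypeR R -> \bar R) :
  measurable_fun setT f -> (forall z, 0 <= f z) ->
  measurable_fun setT
    (fun z : T * measurableTypeR R => \int[mu]_(v in `]0%R, z.2[) f (z.1, v)).
Proof.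
move=> mf f0.
pose A : set ((T * measurableTypeR R) * measurableTypeR R) :=
  [set zv | (0 < zv.2)%R /\ (zv.2 < zv.1.2)%R].
have mA : measurable A.
  have m2 : measurable_fun setT
    (snd : (T * measurableTypeR R) * measurableTypeR R -> R) by [].
  have m12 : measurable_fun setT
    (fun zv : (T * measurableTypeR R) * measurableTypeR R => zv.1.2).
    exact: (@measurableT_comp _ _ _ _ _ _ snd _ fst).
  rewrite (_ : A = [set zv | (0 < zv.2)%R] `&` [set zv | (zv.2 < zv.1.2)%R])//.
  by apply: measurableI; exact: measurable_set_lt.
rewrite (_ : (fun z => _) = (fun z : T * measurableTypeR R =>
    \int[mu]_v (f (z.1, v) * (\1_A (z, v))%:E))).
  apply: (@measurable_fun_fubini_tonelli_F _ _ _ _ _ mu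
    (fun zv => f (zv.1.1, zv.2) * (\1_A zv)%:E)) => //; last first.
    by move=> zv; rewrite mule_ge0.
  apply: emeasurable_funM; last exact: emeasurable_indic.
  apply: measurableT_comp => //; apply/measurable_fun_pairP; split => /=.
    exact: (@measurableT_comp _ _ _ _ _ _ fst _ fst).
  by rewrite [X in measurable_fun _ X](_ : _ = snd).
apply/funext => z; rewrite integral_mkcond; apply: eq_integral => v _.
rewrite patchE indicE; case: ifPn => [|] vz.
  rewrite mem_set ?mule1//; move: vz; rewrite inE/= in_itv/= => /andP[? ?].
  by split.
rewrite memNset ?mule0// => -[? ?]; move/negP: vz; apply.
by rewrite inE/= in_itv/=; apply/andP.
Qed.

Lemma measurable_fun_integral_oy (f : T * measurableTypeR R -> \bar R) :
  measurable_fun setT f -> (forall z, 0 <= f z) ->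
  measurable_fun setT (fun h : T => \int[mu]_(v in `]0%R, +oo[) f (h, v)).
Proof.
move=> mf f0; under eq_fun do rewrite integral_mkcond.
apply: (@measurable_fun_fubini_tonelli_F _ _ _ _ _ mu
  (fun z => ((fun v => f (z.1, v)) \_ `]0%R, +oo[%classic) z.2)) => /=.
  rewrite (_ : (fun z => _) = (fun z : T * measurableTypeR R =>
      f z * (\1_(`]0%R, +oo[%classic : set R) z.2)%:E)); last first.
    apply/funext => -[h v]; rewrite patchE indicE /=.
    by case: ifPn => _; rewrite ?mule1 ?mule0.
  apply: emeasurable_funM => //.
  apply/measurable_EFinP; apply: measurableT_comp => //.
by move=> z; rewrite patchE; case: ifPn.
Qed.

End integral_up_to.

Section survival.
Context {R : realType}.
Local Notation mu := (@lebesgue_measure R).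
Local Notation J f s t := (\int[mu]_(v in `]s, t]) f v).

Lemma integral_oc_cat (f : R -> \bar R) (s r t : R) :
  measurable_fun setT f -> (forall v, 0 <= f v) -> (s <= r)%R -> (r <= t)%R ->
  J f s t = J f s r + J f r t.
Proof.
move=> mf f0 sr rt.
have <- : `]s, r]%classic `|` `]r, t] = `]s, t]%classic.
  apply/seteqP; split=> v /=; rewrite !in_itv/=.
    by move=> [|] /andP[? ?]; apply/andP; split; lra.
  by move=> /andP[? ?]; have [vr|vr] := leP v r; [left|right]; apply/andP; split; lra.
rewrite ge0_integral_setU//.
- exact: measurable_funTS.
- rewrite disj_set2E; apply/eqP/seteqP; split=> v //=; rewrite !in_itv/=.
  by move=> [/andP[? ?] /andP[? ?]]; lra.
Qed.

Lemma le_integral_oc (f g : R -> \bar R) (s t : R) :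
  measurable_fun setT f -> measurable_fun setT g ->
  (forall v, 0 <= f v) -> (forall v, 0 <= g v) ->
  (forall v, (s < v <= t)%R -> f v <= g v) -> J f s t <= J g s t.
Proof.
move=> mf mg f0 g0 fg; apply: ge0_le_integral => //.
- exact: measurable_funTS.
- exact: measurable_funTS.
Qed.

Lemma integralZl_oc (f : R -> \bar R) (c s t : R) : (0 <= c)%R ->
  measurable_fun setT f -> (forall v, 0 <= f v) ->
  J (fun v => c%:E * f v) s t = c%:E * J f s t.
Proof.
by move=> c0 mf f0; rewrite ge0_integralZl_EFin//; exact: measurable_funTS.
Qed.

Lemma integral_oc_le (f : R -> \bar R) (s t c : R) :
  measurable_fun setT f -> (forall v, 0 <= f v) -> (s <= t)%R ->
  (forall v, (s < v <= t)%R -> f v <= c%:E) -> J f s t <= (c * (t - s))%:E.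
Proof.
move=> mf f0 st fc.
have -> : (c * (t - s))%:E = J (cst c%:E) s t.
  by rewrite integral_cst//= lebesgue_measure_itv/= lte_fin; case: ltP => [//|ts];
     rewrite (_ : t = s) ?subrr ?mulr0 ?mule0//; lra.
apply: ge0_le_integral => //.
exact: measurable_funTS.
Qed.

Lemma integral_oc_ge (f : R -> \bar R) (s t c : R) : (0 <= c)%R ->
  measurable_fun setT f -> (forall v, 0 <= f v) -> (s <= t)%R ->
  (forall v, (s < v <= t)%R -> c%:E <= f v) -> (c * (t - s))%:E <= J f s t.
Proof.
move=> c0 mf f0 st fc.
have -> : (c * (t - s))%:E = J (cst c%:E) s t.
  by rewrite integral_cst//= lebesgue_measure_itv/= lte_fin; case: ltP => [//|ts];
     rewrite (_ : t = s) ?subrr ?mulr0 ?mule0//; lra.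
apply: ge0_le_integral => //.
exact: measurable_funTS.
Qed.

(** This replaces differentiation for functions whose derivative is only known
    to vanish through quadratic bounds on increments. *)
Lemma quadratic_cst (h : R -> R) (K s t : R) : (s <= t)%R ->
  (forall u v, (s <= u)%R -> (u <= v)%R -> (v <= t)%R ->
     (`|h v - h u| <= K * (v - u) ^+ 2)%R) -> h t = h s.
Proof.
move=> st hK; apply/eqP; rewrite -subr_eq0 -normr_le0; apply/ler_addgt0Pr => eps e0.
(* Over n equal steps the increments add up to at most K (t - s)^2 / n. *)
rewrite add0r; pose n := (Num.truncn (K * (t - s) ^+ 2 / eps)).+1.
have n0 : (0 < n%:R :> R)%R by rewrite ltr0n.
pose u (i : nat) := (s + i%:R * ((t - s) / n%:R))%R.
have step : (0 <= (t - s) / n%:R)%R by apply: divr_ge0; [lra|exact: ltW].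
have step1 i : (u i.+1 - u i = (t - s) / n%:R)%R.
  by rewrite /u -natr1; ring.
have H i : (i <= n)%N -> (`|h (u i) - h s| <= i%:R * (K * ((t - s) / n%:R) ^+ 2))%R.
  elim: i => [_|i IH il]; first by rewrite /u mul0r addr0 subrr normr0 mul0r.
  have -> : (h (u i.+1) - h s = (h (u i.+1) - h (u i)) + (h (u i) - h s))%R by ring.
  apply: le_trans (ler_normD _ _) _; rewrite -natr1 mulrDl mul1r addrC lerD//.
    exact/IH/ltnW.
  rewrite -(step1 i); apply: hK.
  - by rewrite /u lerDl mulr_ge0.
  - by rewrite -subr_ge0 step1.
  - rewrite /u -lerBrDl mulrA ler_pdivrMr// mulrC ler_wpM2l ?ler_nat//; lra.
have un : u n = t by rewrite /u mulrCA divff ?gt_eqF// mulr1; ring.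
rewrite -un; apply: le_trans (H n (leqnn _)) _.
rewrite (_ : _ * _ = K * (t - s) ^+ 2 / n%:R)%R; last by field; rewrite gt_eqF.
rewrite ler_pdivrMr// -ler_pdivrMl// [leLHS]mulrC.
exact/ltW/truncnS_gt.
Qed.

Lemma expR_diff_bounds (a c : R) :
  (expR (- c) * (c - a) <= expR (- a) - expR (- c) <= expR (- a) * (c - a))%R.
Proof.
have -> : (expR (- a) = expR (- c) * expR (c - a))%R.
  by rewrite -expRD; congr expR; ring.
have h1 := expR_ge1Dx (c - a); have h2 := expR_ge1Dx (- (c - a)).
have e0 := expR_gt0 (- c); have e1 := expR_gt0 (c - a).
have -> : (expR (- c) * expR (c - a) - expR (- c) =
  expR (- c) * (expR (c - a) - 1))%R by rewrite mulrBr mulr1.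
apply/andP; split; first by rewrite ler_wpM2l ?(ltW e0)//; lra.
rewrite -mulrA ler_wpM2l ?(ltW e0)//.
have : (expR (c - a) * (1 + - (c - a)) <= 1)%R.
  rewrite [leRHS](_ : _ = expR (c - a) * expR (- (c - a)))%R; last by rewrite -expRD addrN expR0.
  by rewrite ler_wpM2l//; exact: ltW.
by rewrite mulrDr mulr1 mulrN; lra.
Qed.

Section compensator.
Variables (l : R -> \bar R) (L : R -> R) (C : R).
Hypotheses (ml : measurable_fun setT l) (l0 : forall v, 0 <= l v).
Hypotheses (mL : measurable_fun setT L) (L0 : L 0%R = 0%R).
Hypothesis JL : forall s t, (0 <= s)%R -> (s <= t)%R ->
  J l s t = (L t - L s)%:E.
Hypothesis L_nd : forall s t, (0 <= s)%R -> (s <= t)%R -> (L s <= L t)%R.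
Hypothesis L_lip : forall s t, (0 <= s)%R -> (s <= t)%R ->
  (L t - L s <= C * (t - s))%R.

Let f (t : R) := l t * (expR (- L t))%:E.

Let f0 t : 0 <= f t.
Proof. by apply: mule_ge0 => //; rewrite lee_fin expR_ge0. Qed.

Let mf : measurable_fun setT f.
Proof.
apply: emeasurable_funM => //; apply/measurable_EFinP.
by apply: measurableT_comp => //; exact: measurableT_comp.
Qed.

Let expL_nd (s t : R) : (0 <= s)%R -> (s <= t)%R ->
  (expR (- L t) <= expR (- L s))%R.
Proof. by move=> s0 st; rewrite ler_expR lerN2 L_nd. Qed.

Let expL_le1 (s : R) : (0 <= s)%R -> (expR (- L s) <= 1)%R.
Proof. by move=> s0; rewrite expR_le1 oppr_le0 -L0; exact: L_nd. Qed.

Let Jf_le (s t : R) : (0 <= s)%R -> (s <= t)%R ->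
  J f s t <= (expR (- L s) * (L t - L s))%:E.
Proof.
move=> s0 st; rewrite EFinM -(JL s0 st) -(integralZl_oc _ _ (expR_ge0 _) ml l0).
apply: (le_integral_oc mf _ f0) => [|v|v /andP[sv vt]].
- exact: measurable_funeM.
- by apply: mule_ge0 => //; rewrite lee_fin expR_ge0.
- rewrite /f muleC; apply: lee_wpmul2r => //; rewrite lee_fin.
  exact/expL_nd/ltW.
Qed.

Let Jf_ge (s t : R) : (0 <= s)%R -> (s <= t)%R ->
  (expR (- L t) * (L t - L s))%:E <= J f s t.
Proof.
move=> s0 st; rewrite EFinM -(JL s0 st) -(integralZl_oc _ _ (expR_ge0 _) ml l0).
apply: (le_integral_oc _ mf _ f0) => [|v|v /andP[sv vt]].
- exact: measurable_funeM.
- by apply: mule_ge0 => //; rewrite lee_fin expR_ge0.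
- rewrite /f [leRHS]muleC; apply: lee_wpmul2r => //; rewrite lee_fin.
  by apply: expL_nd => //; exact: le_trans s0 (ltW sv).
Qed.

Let Jf_fin (s t : R) : (0 <= s)%R -> (s <= t)%R -> J f s t \is a fin_num.
Proof.
move=> s0 st; rewrite ge0_fin_numE; last exact: integral_ge0.
exact: le_lt_trans (Jf_le s0 st) (ltry _).
Qed.

(** The intensity [l] is only measurable, so that [L] need not be
    differentiable everywhere. Monotonicity and the Lipschitz bound on [L] still
    give increments of [J f 0 t + expR (- L t)] that are quadratic in the time
    step. *)
Lemma integral_compensator (t : R) : (0 <= t)%R ->
  J f 0%R t = (1 - expR (- L t))%:E.
Proof.
move=> t0; pose h u := (fine (J f 0%R u) + expR (- L u))%R.
have h0 : h 0%R = 1%R.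
  by rewrite /h L0 oppr0 expR0 set_itv_ge ?bnd_simp ?ltxx// integral_set0 add0r.
suff : h t = h 0%R.
  by rewrite h0 /h => /esym ->; rewrite addrK fineK//; exact: Jf_fin.
apply: (@quadratic_cst h (C ^+ 2) 0 t) => // u v u0 uv vt.
have v0 := le_trans u0 uv.
have /(congr1 fine) := integral_oc_cat mf f0 u0 uv.
rewrite (fineD (Jf_fin (lexx _) u0) (Jf_fin u0 uv)) /h => ->.
have := Jf_le u0 uv; have := Jf_ge u0 uv.
rewrite -(fineK (Jf_fin u0 uv)) !lee_fin.
have /andP[] := expR_diff_bounds (L u) (L v).
have dL := L_lip u0 uv; have d0 := L_nd u0 uv.
have e1 := expL_le1 u0; have e2 := expL_nd u0 uv; have e3 := expR_ge0 (- L v).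
move: dL d0 e1 e2 e3.
set a := fine (J f u v); set c := fine (J f _ u).
set E1 := expR (- L u); set E2 := expR (- L v); set D := (L v - L u)%R.
move=> dL d0 e1 e2 e3 k1 k2 k3 k4.
have -> : (c + a + E2 - (c + E1) = a - (E1 - E2))%R by ring.
have D0 : (0 <= D)%R by rewrite subr_ge0.
have DE : ((E1 - E2) * D <= D ^+ 2)%R.
  rewrite expr2 ler_wpM2r//; apply: le_trans k2 _.
  by rewrite -[leRHS]mul1r ler_wpM2r.
have DC : (D ^+ 2 <= C ^+ 2 * (v - u) ^+ 2)%R.
  by rewrite -exprMn lerXn2r// nnegrE//; exact: le_trans D0 dL.
apply: le_trans DC; rewrite ler_norml; rewrite mulrBl in DE.
by apply/andP; split; lra.
Qed.

End compensator.

Lemma cvg_expRN (u : nat -> R) (x : \bar R) : 0 <= x ->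
  (u n)%:E @[n --> \oo] --> x ->
  (expR (- u n))%:E @[n --> \oo] --> expeR (- x).
Proof.
case: x => [x| |]//= _ ux.
  apply: cvg_EFin; first by near=> n.
  apply: (cvg_comp u (fun y => expR (- y))); first exact: (fine_cvg ux).
  by apply: continuous_comp; [exact: opp_continuous|exact: continuous_expR].
apply: cvg_EFin; first by near=> n.
apply: (cvg_comp u (fun y => expR (- y)) _ (@cvgr_expR R)).
exact/cvgeryP.
Unshelve. all: by end_near. Qed.

Lemma cvg_integral_up_to (f : R -> \bar R) (s : R) : measurable_fun setT f ->
  (forall v, 0 <= f v) ->
  J f s (s + n%:R)%R @[n --> \oo] --> \int[mu]_(v in `]s, +oo[) f v.
Proof.
move=> mf f0; rewrite (_ : `]s, +oo[%classic =
    \bigcup_n `]s, (s + n%:R)%R]%classic); last first.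
  apply/seteqP; split=> v /=; rewrite in_itv/= ?andbT.
    move=> sv; exists (Num.truncn (v - s)).+1 => //=.
    by rewrite in_itv/= sv/= -lerBlDl; exact/ltW/truncnS_gt.
  by move=> [n _] /=; rewrite in_itv/= => /andP[].
apply: ge0_nondecreasing_set_cvg_integral => //.
- move=> m n mn; apply/subsetPset => v /=; rewrite !in_itv/= => /andP[-> vm]/=.
  by rewrite (le_trans vm)// lerD2l ler_nat.
- by move=> i; exact: measurable_funTS.
Qed.

(** With [l] as the hazard rate: to survive up to [s] means to die after [s] or
    never. On bounded intervals this is [integral_compensator]. *)
Lemma survival_identity (l : R -> \bar R) (C s : R) :
  measurable_fun setT l -> (forall v, 0 <= l v) ->
  (forall v, (0 < v)%R -> l v <= C%:E) -> (0 <= s)%R ->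
  \int[mu]_(t in `]s, +oo[) (l t * expeR (- \int[mu]_(v in `]0%R, t[) l v)) +
    expeR (- \int[mu]_(v in `]0%R, +oo[) l v) =
  expeR (- \int[mu]_(v in `]0%R, s[) l v).
Proof.
move=> ml l0 lC s0.
have LoE t : \int[mu]_(v in `]0%R, t[) l v = J l 0%R t.
  by rewrite integral_itv_bndo_bndc//; exact: measurable_funTS.
pose L t := fine (J l 0%R t).
have C0 : (0 <= C)%R.
  by rewrite -lee_fin; apply: le_trans (l0 1%R) (lC _ ltr01).
have l_lip a c : (0 <= a)%R -> (a <= c)%R -> J l a c <= (C * (c - a))%:E.
  move=> a0 ac; apply: integral_oc_le => // v /andP[av _].
  by apply: lC; exact: le_lt_trans av.
have l_fin a c : (0 <= a)%R -> (a <= c)%R -> J l a c \is a fin_num.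
  move=> a0 ac; rewrite ge0_fin_numE; last exact: integral_ge0.
  exact: le_lt_trans (l_lip _ _ a0 ac) (ltry _).
have LE t : (0 <= t)%R -> J l 0%R t = (L t)%:E.
  by move=> t0; rewrite /L fineK// l_fin.
have JL a c : (0 <= a)%R -> (a <= c)%R -> J l a c = (L c - L a)%:E.
  move=> a0 ac; have := integral_oc_cat ml l0 a0 ac.
  rewrite (LE _ a0) (LE _ (le_trans a0 ac)) EFinB => ->.
  by rewrite [(L a)%:E + _]addeC addeK.
have L_nd a c : (0 <= a)%R -> (a <= c)%R -> (L a <= L c)%R.
  move=> a0 ac; rewrite -subr_ge0 -lee_fin -(JL _ _ a0 ac).
  exact: integral_ge0.
have L_lip a c : (0 <= a)%R -> (a <= c)%R -> (L c - L a <= C * (c - a))%R.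
  by move=> a0 ac; rewrite -lee_fin -(JL _ _ a0 ac); exact: l_lip.
have mLo : measurable_fun setT (fun t : R => \int[mu]_(v in `]0%R, t[) l v).
  have := @measurable_fun_integral_oo R _ unit (l \o snd).
  move=> /(_ _ _)/(measurable_fun_pair2 tt); apply => //; last by move=> z /=.
  exact: measurableT_comp.
have mL : measurable_fun setT L.
  apply: measurableT_comp => //.
  by under eq_fun do rewrite -LoE; exact: mLo.
have L00 : L 0%R = 0%R.
  by rewrite /L set_itv_ge ?bnd_simp ?ltxx// integral_set0.
clearbody L.
have comp := integral_compensator ml l0 mL L00 JL L_nd L_lip.
have expLE t : (0 <= t)%R ->
    expeR (- \int[mu]_(v in `]0%R, t[) l v) = (expR (- L t))%:E.
  by move=> t0; rewrite LoE (LE _ t0).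
pose f t := l t * (expR (- L t))%:E.
have mf : measurable_fun setT f.
  apply: emeasurable_funM => //; apply/measurable_EFinP.
  by apply: measurableT_comp => //; exact: measurableT_comp.
have f0 v : 0 <= f v by apply: mule_ge0 => //; rewrite lee_fin expR_ge0.
have Jf t : (s <= t)%R -> J f s t = (expR (- L s) - expR (- L t))%:E.
  move=> st; have := integral_oc_cat mf f0 s0 st.
  rewrite (comp _ s0) (comp _ (le_trans s0 st)) => h.
  have -> : (expR (- L s) - expR (- L t))%:E =
      (1 - expR (- L t))%:E - (1 - expR (- L s))%:E.
    by rewrite -EFinB; congr EFin; move: (expR _) (expR _) => x y; ring.
  rewrite h; apply/esym.
  exact: etrans (congr1 (fun z => z - (1 - expR (- L s))%:E) (addeC _ _)) (addeK _ _).
rewrite (expLE _ s0) [X in X + _](_ : _ = \int[mu]_(t in `]s, +oo[) f t); last first.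
  apply: eq_integral => t; rewrite inE/= in_itv/= andbT => st.
  by rewrite expLE// ltW// (le_lt_trans s0).
have h1 := cvg_integral_up_to (s := s) mf f0.
have h2 : (expR (- L (s + n%:R)))%:E @[n --> \oo] -->
    expeR (- \int[mu]_(v in `]0%R, +oo[) l v).
  apply: cvg_expRN; first exact: integral_ge0.
  rewrite (_ : (fun n : nat => _) = (fun n : nat => (L s)%:E + J l s (s + n%:R)%R)); last first.
    apply/funext => n; rewrite JL ?lerDl// -EFinD; congr EFin; ring.
  rewrite [X in _ --> X](_ : _ = (L s)%:E + \int[mu]_(v in `]s, +oo[) l v); last first.
    rewrite -(LE _ s0) -ge0_integral_setU//; last 2 first.
    - exact: measurable_funTS.
    - rewrite disj_set2E; apply/eqP/seteqP; split=> v //=; rewrite !in_itv/= andbT.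
      by move=> [/andP[_ ?] ?]; lra.
    congr (integral mu _ _); apply/seteqP; split=> v /=; rewrite !in_itv/= ?andbT.
      by move=> v0; have [vs|vs] := leP v s; [left; rewrite v0|right].
    by move=> [/andP[]//|]; exact: le_lt_trans.
  apply: cvgeD => //; first exact: cvg_cst.
  exact: cvg_integral_up_to.
have h3 : J f s (s + n%:R)%R + (expR (- L (s + n%:R)))%:E @[n --> \oo] -->
    \int[mu]_(t in `]s, +oo[) f t + expeR (- \int[mu]_(v in `]0%R, +oo[) l v).
  apply: cvgeD => //; apply: ge0_adde_def; rewrite inE.
    exact: integral_ge0.
  exact: expeR_ge0.
rewrite -(cvg_lim (@ereal_hausdorff R) h3); apply: lim_near_cst => //.
near=> n; rewrite Jf ?lerDl// -EFinD; congr EFin; ring.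
Unshelve. all: by end_near. Qed.

End survival.

Section survival_parts.
Context {R : realType}.
Local Notation mu := (@lebesgue_measure R).

(** Exchange of the order of integration: the expectation of the integral of
    [F] up to the time of death is the integral of [F] times the survival
    function. *)
Lemma integral_survival (l F : R -> \bar R) (C : R) :
  measurable_fun setT l -> (forall v, 0 <= l v) ->
  (forall v, (0 < v)%R -> l v <= C%:E) ->
  measurable_fun setT F -> (forall v, 0 <= F v) ->
  \int[mu]_(t in `]0%R, +oo[) ((\int[mu]_(v in `]0%R, t[) F v) *
     (l t * expeR (- \int[mu]_(v in `]0%R, t[) l v))) +
   expeR (- \int[mu]_(v in `]0%R, +oo[) l v) * \int[mu]_(v in `]0%R, +oo[) F v =
  \int[mu]_(t in `]0%R, +oo[) (F t * expeR (- \int[mu]_(v in `]0%R, t[) l v)).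
Proof.
move=> ml l0 lC mF F0.
pose s t := expeR (- \int[mu]_(v in `]0%R, t[) l v).
pose soo := expeR (- \int[mu]_(v in `]0%R, +oo[) l v).
have s0 t : 0 <= s t by exact: expeR_ge0.
have soo0 : 0 <= soo by exact: expeR_ge0.
have soo_fin : soo \is a fin_num.
  rewrite ge0_fin_numE// (@le_lt_trans _ _ 1) ?ltry//.
  by rewrite -expeR0 lee_expeR oppe_le0 integral_ge0.
have ms : measurable_fun setT s.
  apply: (measurableT_comp (@measurable_expeR R)).
  apply: (measurableT_comp (@oppe_measurable R setT)).
  have := @measurable_fun_integral_oo R _ unit (l \o snd).
  move=> /(_ _ _)/(measurable_fun_pair2 tt); apply => //; last by move=> z /=.
  exact: measurableT_comp.
pose d t := l t * s t.
have d0 t : 0 <= d t by rewrite mule_ge0.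
have md : measurable_fun setT d by exact: emeasurable_funM.
pose K (z : measurableTypeR R * measurableTypeR R) : \bar R :=
  (\1_([set z : measurableTypeR R * measurableTypeR R | (0 < z.2)%R] `&`
       [set z | (z.2 < z.1)%R]) z)%:E * (F z.2 * d z.1).
have mK : measurable_fun setT K.
  apply: emeasurable_funM; last first.
    apply: emeasurable_funM; first exact: (measurableT_comp mF measurable_snd).
    exact: (measurableT_comp md measurable_fst).
  apply: emeasurable_indic.
  by apply: measurableI; exact: measurable_set_lt.
have K0 z : 0 <= K z by rewrite mule_ge0// mule_ge0.
have KE t v : K (t, v) = ((F \_ `]0%R, t[%classic) v) * d t.
  rewrite /K indicE patchE; have [vt|vt] := boolP (v \in `]0%R, t[%classic).
    rewrite mem_set ?mul1e//; move: vt; rewrite inE /= in_itv/= => /andP[? ?].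
    by split.
  rewrite memNset ?mul0e ?mul0e//= => -[? ?]; move/negP: vt; apply.
  by rewrite inE /= in_itv/=; apply/andP.
have -> : \int[mu]_(t in `]0%R, +oo[) ((\int[mu]_(v in `]0%R, t[) F v) * d t) =
    \int[mu]_t \int[mu]_v K (t, v).
  rewrite integral_mkcond; apply: eq_integral => t _; rewrite patchE.
  have [t0|t0] := boolP (t \in `]0%R, +oo[%classic).
    under [RHS]eq_integral do rewrite KE.
    rewrite [in LHS]integral_mkcond muleC -ge0_integralZl//.
    - by apply: eq_integral => v _; rewrite muleC.
    - by apply/(measurable_restrictT _ _).1 => //; exact: measurable_funTS.
    - by move=> v _; rewrite patchE; case: ifPn.
  rewrite integral0_eq// => v _; rewrite KE patchE memNset ?mul0e//=.
  rewrite in_itv/= => /andP[v0 vt]; move/negP: t0; apply.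
  by rewrite inE /= in_itv/= andbT (lt_trans v0).
rewrite (fubini_tonelli _ mK K0).
have -> : soo * \int[mu]_(v in `]0%R, +oo[) F v =
    \int[mu]_(v in `]0%R, +oo[) (F v * soo).
  by rewrite muleC ge0_integralZr//; exact: measurable_funTS.
have -> : \int[mu]_v \int[mu]_t K (t, v) =
    \int[mu]_(v in `]0%R, +oo[) (F v * \int[mu]_(t in `]v, +oo[) d t).
  rewrite [RHS]integral_mkcond; apply: eq_integral => v _; rewrite patchE.
  have [v0|v0] := boolP (v \in `]0%R, +oo[%classic).
    rewrite [in RHS]integral_mkcond -ge0_integralZl//; last 2 first.
    - by apply/(measurable_restrictT _ _).1 => //; exact: measurable_funTS.
    - by move=> t _; rewrite patchE; case: ifPn.
    apply: eq_integral => t _; rewrite KE !patchE.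
    move: v0; rewrite inE/= in_itv/= andbT => v0.
    have -> : (v \in `]0%R, t[%classic) = (t \in `]v, +oo[%classic).
      by apply/idP/idP; rewrite !inE/= !in_itv/= v0 andbT.
    by case: ifPn; rewrite ?mul0e ?mule0.
  rewrite integral0_eq// => t _; rewrite KE patchE memNset ?mul0e//=.
  rewrite in_itv/= => /andP[v1 _]; move/negP: v0; apply.
  by rewrite inE /= in_itv/= andbT.
rewrite -ge0_integralD//=; last 4 first.
- by move=> v _; rewrite mule_ge0// integral_ge0.
- apply: emeasurable_funM; first exact: measurable_funTS.
  apply: (eq_measurable_fun (fun v => s v - soo)) => [v|].
    rewrite inE/= in_itv/= andbT => v0.
    by rewrite /s -(survival_identity ml l0 lC (ltW v0)) addeK.
  by apply: measurable_funTS; apply: emeasurable_funB.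
- by move=> v _; rewrite mule_ge0.
- by apply: measurable_funTS; apply: emeasurable_funM.
apply: eq_integral => v; rewrite inE/= in_itv/= andbT => v0.
rewrite -ge0_muleDr ?integral_ge0//; congr (_ * _).
exact: survival_identity lC (ltW v0).
Qed.

End survival_parts.

Section exponential.
Context {R : realType}.
Local Notation mu := (@lebesgue_measure R).
Variable beta : R.
Hypothesis beta_gt0 : (0 < beta)%R.

Let L (t : R) : R := (beta * t)%R.

Let mexp : measurable_fun setT (fun t : R => (beta * expR (- (beta * t)))%:E).
Proof.
apply/measurable_EFinP; apply: measurable_funM => //.
by apply: measurableT_comp => //; apply: measurableT_comp.
Qed.

Lemma integral_exp_oc (a b : R) : (0 <= a)%R -> (a <= b)%R ->
  \int[mu]_(t in `]a, b]) (beta * expR (- (beta * t)))%:E =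
  (expR (- (beta * a)) - expR (- (beta * b)))%:E.
Proof.
move=> a0 ab; have b0 := le_trans a0 ab.
have e0 v : 0 <= (beta * expR (- (beta * v)))%:E :> \bar R.
  by rewrite lee_fin mulr_ge0// ?expR_ge0// ltW.
have J s t : (0 <= s)%R -> (s <= t)%R ->
    \int[mu]_(v in `]s, t]) (cst beta%:E v) = (L t - L s)%:E.
  move=> s0 st; apply/eqP; rewrite eq_le /L -mulrBr; apply/andP; split.
    by apply: integral_oc_le => // v; rewrite lee_fin ltW.
  by apply: integral_oc_ge => //; [exact: ltW|move=> v; rewrite lee_fin ltW].
have mL : measurable_fun setT L by exact: measurable_funM.
have comp := @integral_compensator R (cst beta%:E) L beta
  (measurable_cst _) (fun v => ltW beta_gt0) mL (mulr0 _) J.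
have {}comp t : (0 <= t)%R ->
    \int[mu]_(v in `]0%R, t]) (beta * expR (- (beta * v)))%:E = (1 - expR (- L t))%:E.
  move=> t0; rewrite -comp//.
  - by move=> s u s0 su; rewrite /L ler_wpM2l// ltW.
  - by move=> s u s0 su; rewrite /L mulrBr.
have := integral_oc_cat mexp e0 a0 ab; rewrite (comp a a0) (comp b b0) => h.
have -> : (expR (- (beta * a)) - expR (- (beta * b)))%:E =
    (1 - expR (- L b))%:E - (1 - expR (- L a))%:E.
  by rewrite -EFinB; congr EFin; rewrite /L; ring.
by rewrite h [X in X - _]addeC addeK.
Qed.

Lemma integral_exp_oo (a b : R) : (0 <= a)%R -> (a <= b)%R ->
  \int[mu]_(t in `]a, b[) (beta * expR (- (beta * t)))%:E =
  (expR (- (beta * a)) - expR (- (beta * b)))%:E.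
Proof.
move=> a0 ab; rewrite -integral_exp_oc// integral_itv_bndo_bndc//.
exact: measurable_funTS.
Qed.

Lemma integral_exp_oy (a : R) : (0 <= a)%R ->
  \int[mu]_(t in `]a, +oo[) (beta * expR (- (beta * t)))%:E =
  (expR (- (beta * a)))%:E.
Proof.
move=> a0.
have e0 v : 0 <= (beta * expR (- (beta * v)))%:E :> \bar R.
  by rewrite lee_fin mulr_ge0// ?expR_ge0// ltW.
have h := cvg_integral_up_to (s := a) mexp e0.
rewrite -(cvg_lim (@ereal_hausdorff R) h).
under eq_fun do rewrite integral_exp_oc ?lerDl//.
rewrite [RHS](_ : _ = (expR (- (beta * a)) - 0)%:E); last by rewrite subr0.
apply/cvg_lim => //; apply: cvg_EFin; first by near=> n.
apply: cvgB; first exact: cvg_cst.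
apply: (cvg_comp (fun n : nat => (beta * (a + n%:R))%R) (fun y => expR (- y)) _ (@cvgr_expR R)).
apply/cvgryPge => x; exists (Num.truncn (x / beta)).+1 => // n /= xn.
rewrite mulrC -ler_pdivrMr// (le_trans (ltW (truncnS_gt _)))//.
by apply: (@le_trans _ _ n%:R); rewrite ?ler_nat ?lerDr.
Unshelve. all: by end_near. Qed.

End exponential.

(** * Paths *)

Section path_facts.
Context {R : realType} {S : ptopologicalType}.
Implicit Types (e : Defs.path R S) (k n : nat) (t : R).

Lemma sojourn_gt0 e k : 0 < sojourn e k.
Proof.
case: (Defs.pathP e) => [/(_ k)[_ /andP[]]//|[n [_ h1 h2 _]]].
have [kn|nk] := ltnP k n; first by case/andP: (h1 _ kn).
by rewrite h2// ltry.
Qed.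

Lemma jump_timeS e k : jump_time e k.+1 = jump_time e k + sojourn e k.
Proof. by rewrite /jump_time big_ord_recr. Qed.

Lemma jump_time0 e : jump_time e 0%N = 0.
Proof. by rewrite /jump_time big_ord0. Qed.

Lemma jump_time_ge0 e k : 0 <= jump_time e k.
Proof. by apply: sume_ge0 => i _; exact/ltW/sojourn_gt0. Qed.

Lemma nd_jump_time e : nondecreasing_seq (jump_time e).
Proof.
apply/nondecreasing_seqP => k; rewrite jump_timeS leeDl//.
exact/ltW/sojourn_gt0.
Qed.

Lemma state_None e k : (state e k == None) = (jump_time e k == +oo).
Proof.
case: (Defs.pathP e) => [h|[n [h0 h1 h2 h3]]].
  have [/eqP/negbTE -> _] := h k; apply/esym/negbTE.
  rewrite -ltey /jump_time; apply: lte_sum_pinfty => i _.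
  by have [_ /andP[]] := h i.
have [kn|nk] := leqP k n.
  have /eqP/negbTE -> := h0 _ kn; apply/esym/negbTE.
  rewrite -ltey /jump_time; apply: lte_sum_pinfty => i _.
  by have /andP[] := h1 i (leq_trans (ltn_ord i) kn).
rewrite h3// eqxx; apply/esym/eqP.
have : jump_time e n.+1 <= jump_time e k by exact: nd_jump_time.
rewrite jump_timeS h2// addey; first by rewrite leye_eq => /eqP.
by rewrite gt_eqF// (lt_le_trans _ (jump_time_ge0 e n)).
Qed.

Lemma jump_time_lty e k : (jump_time e k < +oo) = (state e k != None).
Proof. by rewrite ltey state_None. Qed.

Lemma state0_neq_None e : state e 0%N != None.
Proof. by rewrite -jump_time_lty jump_time0 ltry. Qed.

Lemma jump_time_fineK e k : state e k != None ->
  (fine (jump_time e k))%:E = jump_time e k.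
Proof.
by move=> h; rewrite fineK// ge0_fin_numE ?jump_time_ge0// jump_time_lty.
Qed.

Lemma state_sojourn_next e k : state e k != None ->
  (state e k.+1 == None) = (sojourn e k == +oo).
Proof.
move=> h; rewrite state_None jump_timeS -(jump_time_fineK h).
by case: (sojourn e k) (sojourn_gt0 e k).
Qed.

Lemma jump_time_le_explosion e k : (jump_time e k <= explosion e).
Proof.
apply: lime_ge; first exact: ereal_nondecreasing_is_cvgn (@nd_jump_time e).
by exists k => // n /= kn; exact: nd_jump_time.
Qed.

Lemma lt_explosion e k t :
  t%:E <= jump_time e k -> t%:E < explosion e.
Proof.
have [Hk|Hk] := eqVneq (jump_time e k) +oo.
  move=> _; apply: lt_le_trans (jump_time_le_explosion e k).
  by rewrite Hk ltry.
move=> /le_lt_trans; apply; apply: lt_le_trans (jump_time_le_explosion e k.+1).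
rewrite jump_timeS -jump_time_fineK; last by rewrite state_None.
by rewrite lteDl// sojourn_gt0.
Qed.

Lemma jump_interval_uniq e (t : R) k n :
  jump_time e k < t%:E <= jump_time e k.+1 ->
  jump_time e n < t%:E <= jump_time e n.+1 -> k = n.
Proof.
move=> /andP[k1 k2] /andP[n1 n2]; apply/eqP; rewrite eqn_leq; apply/andP; split.
  rewrite leqNgt; apply/negP => nk.
  by have := lt_le_trans (le_lt_trans (nd_jump_time e nk) k1) n2; rewrite ltxx.
rewrite leqNgt; apply/negP => nk.
by have := lt_le_trans (le_lt_trans (nd_jump_time e nk) n1) k2; rewrite ltxx.
Qed.

Lemma jump_interval_uniq_co e (t : R) k n :
  jump_time e k <= t%:E < jump_time e k.+1 ->
  jump_time e n <= t%:E < jump_time e n.+1 -> k = n.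
Proof.
move=> /andP[k1 k2] /andP[n1 n2]; apply/eqP; rewrite eqn_leq; apply/andP; split.
  rewrite leqNgt; apply/negP => nk.
  by have := lt_le_trans n2 (le_trans (nd_jump_time e nk) k1); rewrite ltxx.
rewrite leqNgt; apply/negP => nk.
by have := lt_le_trans k2 (le_trans (nd_jump_time e nk) n1); rewrite ltxx.
Qed.

Lemma xi_leftE e k t : jump_time e k < t%:E <= jump_time e k.+1 ->
  xi_left e t = state e k.
Proof.
move=> tk; have /andP[k1 k2] := tk; rewrite /xi_left.
have t0 : (0 < t)%R by rewrite -lte_fin (le_lt_trans (jump_time_ge0 e k) k1).
rewrite gt_eqF// leNgt (lt_explosion k2)/=.
set n := get _; have tn : jump_time e n < t%:E <= jump_time e n.+1.
  by apply: (@getPex _ [set n | jump_time e n < t%:E <= jump_time e n.+1]); exists k.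
by rewrite (jump_interval_uniq tk tn).
Qed.

Lemma xiE e k t : jump_time e k <= t%:E < jump_time e k.+1 ->
  xi e t = state e k.
Proof.
move=> tk; have /andP[k1 k2] := tk; rewrite /xi.
rewrite leNgt (lt_explosion (ltW k2))/=.
set n := get _; have tn : jump_time e n <= t%:E < jump_time e n.+1.
  by apply: (@getPex _ [set n | jump_time e n <= t%:E < jump_time e n.+1]); exists k.
by rewrite (jump_interval_uniq_co tk tn).
Qed.

Lemma xi_None e t : (0 <= t)%R ->
  (forall k, ~~ (jump_time e k <= t%:E < jump_time e k.+1)) -> xi e t = None.
Proof.
move=> t0 h; rewrite /xi ifT//.
have {}h k : jump_time e k <= t%:E.
  elim: k => [|k IH]; first by rewrite jump_time0 lee_fin.
  by have := h k; rewrite IH/= -leNgt.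
by apply: lime_le; [exact: ereal_nondecreasing_is_cvgn (@nd_jump_time e)|near=> n].
Unshelve. all: by end_near. Qed.

Lemma is_path_stop e k : state e k != None ->
  is_path (fun i => if (i <= k)%N then state e i else None)
          (fun i => if (i < k)%N then sojourn e i else +oo).
Proof.
move=> ek; right; exists k; split => [i ik|i ik|i ki|i ki].
- rewrite ik; apply/eqP; rewrite -jump_time_lty.
  by rewrite (le_lt_trans (nd_jump_time e ik))// jump_time_lty.
- rewrite ik sojourn_gt0/= ltey; apply/negP => /eqP si.
  have : jump_time e i.+1 < +oo.
    by rewrite (le_lt_trans (nd_jump_time e ik))// jump_time_lty.
  rewrite jump_timeS si addey//.
  by rewrite gt_eqF// (lt_le_trans _ (jump_time_ge0 e i)).
- by rewrite ltnNge ki.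
- by rewrite leqNgt ki.
Qed.

(** A path that never jumps again after its k-th jump has the same history as
    [e]. Along it the intensity is observed at all later times, whereas [e]
    itself shows it until the next jump only. *)
Lemma stopped_path e k : state e k != None -> exists e',
  [/\ hist k e' = hist k e, state e' k = state e k,
      jump_time e' k = jump_time e k & jump_time e' k.+1 = +oo].
Proof.
move=> ek; exists (Path (is_path_stop ek)).
have Tk : jump_time (Path (is_path_stop ek)) k = jump_time e k.
  by rewrite /jump_time; apply: eq_bigr => i _ /=; rewrite ltn_ord.
split=> //.
- rewrite /hist/=; congr (_, _); apply: eq_from_tnth => i.
  by rewrite !tnth_mktuple ltn_ord.
- by rewrite /= leqnn.
- rewrite jump_timeS Tk /= ltnn addey//.
  by rewrite gt_eqF// (lt_le_trans _ (jump_time_ge0 e k)).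
Qed.

End path_facts.

(** * Measurability of functions of the path *)

Section option_measurability.
Context d (T : measurableType d).

Lemma measurable_image_Some (D : set T) :
  measurable D -> measurable (Some @` D).
Proof.
move=> mD; rewrite /measurable/= /option_measurable/=.
rewrite [X in measurable X](_ : _ = D)//.
by apply/seteqP; split=> [x [y Dy [<-]]//|x Dx]; exists x.
Qed.

Lemma measurable_option (B : set (option T)) :
  measurable (Some @^-1` B) -> measurable B.
Proof. by []. Qed.

Lemma measurable_set_None : measurable [set None : option T].
Proof.
apply: measurable_option; rewrite [X in measurable X](_ : _ = set0)//.
by apply/seteqP; split.
Qed.

Lemma measurable_odflt (x0 : T) : measurable_fun setT (odflt x0).
Proof.
move=> _ B mB; rewrite setTI; apply: measurable_option.
by rewrite [X in measurable X](_ : _ = B).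
Qed.

End option_measurability.

Section path_measurability.
Context {R : realType} {S : ptopologicalType}.
Implicit Types (k n : nat).
Notation Om := (Omega R S).

Lemma measurable_state k :
  measurable_fun setT (fun e : Om => state e k : option (borel S)).
Proof.
move=> _ B mB; rewrite setTI; apply: sub_sigma_algebra; left.
by exists k, B; split.
Qed.

Lemma measurable_sojourn k :
  measurable_fun setT (fun e : Om => sojourn e k).
Proof.
move=> _ B mB; rewrite setTI; apply: sub_sigma_algebra; right.
by exists k, B; split.
Qed.

Lemma measurable_jump_time k :
  measurable_fun setT (fun e : Om => jump_time e k).
Proof.
apply: (@emeasurable_sum _ _ _ _ _ _ (fun (i : 'I_k) (e : Om) => sojourn e i)).
by move=> i; exact: measurable_sojourn.
Qed.

Lemma measurable_jump_time2 k :
  measurable_fun setT (fun z : Om * measurableTypeR R => jump_time z.1 k).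
Proof. exact: (measurableT_comp (@measurable_jump_time k) measurable_fst). Qed.

Lemma measurable_time2 :
  measurable_fun setT (fun z : Om * measurableTypeR R => z.2%:E : \bar R).
Proof. by apply/measurable_EFinP; exact: measurable_snd. Qed.

Lemma measurable_hist k : measurable_fun setT (@hist R S k : Om -> history R S k).
Proof.
apply/measurable_fun_pairP; split; first exact: measurable_state.
apply/measurable_fun_tnthP => i.
rewrite [X in measurable_fun _ X](_ : _ =
    fun e : Om => (sojourn e i, state e i.+1 : option (borel S))); last first.
  by apply/funext => e /=; rewrite tnth_mktuple.
by apply/measurable_fun_pairP; split; [exact: measurable_sojourn|exact: measurable_state].
Qed.

Lemma measurable_state_in k (B : set (option (borel S))) : measurable B ->
  measurable ([set e | B (state e k)] : set Om).
Proof. by move=> mB; have := measurable_state k measurableT mB; rewrite setTI. Qed.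

Lemma measurable_state_neq_None k :
  measurable ([set e | state e k != None] : set Om).
Proof.
have := measurable_state_in k (measurableC (@measurable_set_None _ (borel S))).
by congr measurable; apply/seteqP; split => e /= /eqP.
Qed.

Lemma measurable_mu_star (s : R) (D : set (borel S)) : measurable D ->
  measurable_fun setT (fun e : Om => mu_star e (`[0%R, s] `*` D)).
Proof.
move=> mD; apply: ge0_emeasurable_sum => [k e _ _|k _].
  by case: (jump_time e k) => [r| |]//; case: (state e k).
rewrite [X in measurable_fun _ X](_ : _ = (fun e : Om =>
  (\1_([set e : Om | (EFin @` `[0%R, s]) (jump_time e k)] `&`
     [set e : Om | (Some @` D) (state e k)]) e)%:E)); last first.
  apply/funext => e; rewrite indicE.
  case Tk: (jump_time e k) => [r| |]; last 2 first.
  - by rewrite memNset//= Tk => -[[]].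
  - by rewrite memNset//= Tk => -[[]].
  case Xk: (state e k) => [x|]; last by rewrite memNset//= Xk => -[_ []].
  rewrite diracE; congr (_%:R%:E); congr nat_of_bool.
  apply/idP/idP; rewrite !inE /= Tk Xk.
    by move=> [rs Dx]; split; [exists r|exists x].
  by move=> [[r' rs [<-]] [x' Dx [<-]]].
apply: emeasurable_indic; apply: measurableI.
  rewrite -[X in measurable X]setTI; apply: measurable_jump_time => //.
  by apply: measurable_image_EFin; exact: measurable_itv.
by apply: measurable_state_in; exact: measurable_image_Some.
Qed.

Lemma sub_filtration (t : R) : filtration t `<=` (measurable : set (set Om)).
Proof.
apply: smallest_sub; first exact: sigma_algebra_measurable.
move=> _ [s [D [B [_ mD mB ->]]]].
by have := @measurable_mu_star s D mD measurableT B mB; rewrite setTI.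
Qed.

Lemma sub_filtration_left (t : R) :
  filtration_left t `<=` (measurable : set (set Om)).
Proof.
apply: smallest_sub; first exact: sigma_algebra_measurable.
by move=> A [s _]; exact: sub_filtration.
Qed.

(** Predictable policies are jointly measurable, which is what the exchanges of
    expectation and time integral need. *)
Lemma sub_predictable : (measurable : set (set (predictable R S))) `<=`
  (measurable : set (set (Om * measurableTypeR R))).
Proof.
apply: smallest_sub; first exact: sigma_algebra_measurable.
move=> E [[B mB <-]|[s [C [s0 mC ->]]]].
  by apply: measurableX => //; exact: sub_filtration mB.
by apply: measurableX => //; exact: sub_filtration_left mC.
Qed.

End path_measurability.

Section predictable_state.
Context {R : realType} {S : ptopologicalType}.
Local Notation Om := (Omega R S).
Implicit Types (e : Defs.path R S) (t : R).

(** At negative times the interval containing the time does not exist, and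
    [xi_left] falls back to the default value of [get]. *)
Let n0 : nat := get (@set0 nat).

Lemma xi_left_lt0 e t : (t < 0)%R -> xi_left e t = state e n0.
Proof.
move=> t0; rewrite /xi_left lt_eqF// leNgt (lt_explosion (k := 0))/=; last first.
  by rewrite jump_time0 lee_fin ltW.
congr (state e _); congr get; apply/seteqP; split=> // k /= /andP[+ _].
by rewrite ltNge (le_trans _ (jump_time_ge0 e k))// lee_fin ltW.
Qed.

Lemma xi_left_None e t : (0 < t)%R -> (forall k, jump_time e k < t%:E) ->
  xi_left e t = None.
Proof.
move=> t0 h; rewrite /xi_left gt_eqF// ifT//; apply: lime_le.
  exact: ereal_nondecreasing_is_cvgn (@nd_jump_time _ _ e).
by apply: nearW => k; exact/ltW/h.
Qed.

Lemma measurable_xi_left :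
  measurable_fun setT (fun z : Om * measurableTypeR R => xi_left z.1 z.2 : option (borel S)).
Proof.
move=> _ B mB; rewrite setTI.
have mJ j := @measurable_jump_time2 R S j.
have m2 := @measurable_time2 R S.
have mst j : measurable [set z : Om * measurableTypeR R | B (state z.1 j)].
  have := measurableT_comp (@measurable_state R S j) (@measurable_fst _ _ Om (measurableTypeR R)).
  by move=> /(_ measurableT _ mB); rewrite setTI.
have mc := measurable_cst (0 : \bar R).
pose E0 := [set z : Om * measurableTypeR R | z.2%:E <= 0] `&` [set z | 0 <= z.2%:E].
pose En := [set z : Om * measurableTypeR R | z.2%:E < 0].
pose Ep := [set z : Om * measurableTypeR R | 0 < z.2%:E].
rewrite (_ : _ @^-1` B =
  E0 `&` [set z | B (state z.1 0)] `|` En `&` [set z | B (state z.1 n0)] `|`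
  \bigcup_k (([set z | jump_time z.1 k < z.2%:E] `&` [set z | z.2%:E <= jump_time z.1 k.+1])
     `&` [set z | B (state z.1 k)]) `|`
  Ep `&` \bigcap_k [set z | jump_time z.1 k < z.2%:E] `&` [set _ | B None]).
  apply: measurableU; [apply: measurableU; [apply: measurableU|]|].
  - apply: measurableI => //; apply: measurableI; exact: emeasurable_set_le.
  - by apply: measurableI => //; exact: emeasurable_set_lt.
  - apply: bigcup_measurable => k _; apply: measurableI => //.
    by apply: measurableI; [exact: emeasurable_set_lt|exact: emeasurable_set_le].
  - apply: measurableI.
      apply: measurableI; first exact: emeasurable_set_lt.
      by apply: bigcap_measurable => // k _; exact: emeasurable_set_lt.
    have [b|b] := pselect (B None).
      by rewrite (_ : mkset _ = setT)//; apply/seteqP; split.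
    by rewrite (_ : mkset _ = set0)//; apply/seteqP; split.
apply/seteqP; split=> -[e t] /=.
  move=> Bx; have [t0|t0|t0] := ltgtP t 0%R.
  - by left; left; right; split; [rewrite /En/= lte_fin|move: Bx; rewrite (xi_left_lt0 _ t0)].
  - have [h|h] := pselect (forall k, jump_time e k < t%:E).
      right; split; last by move: Bx; rewrite (xi_left_None t0 h).
      by split; [rewrite /Ep/= lte_fin|move=> k _; exact: h].
    left; right.
    have [k kt] : exists k, jump_time e k < t%:E <= jump_time e k.+1.
      apply: contrapT => /forallNP none; apply: h; elim=> [|k IH].
        by rewrite jump_time0 lte_fin.
      by rewrite ltNge; apply/negP => ?; apply: (none k); rewrite IH.
    exists k => //; have /andP[k1 k2] := kt; split; first by split.
    by move: Bx; rewrite (xi_leftE kt).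
  - by left; left; left; split; [split; rewrite t0/=|move: Bx; rewrite /xi_left t0 eqxx].
move=> [[[[[t0 t0'] Bx]|[t0 Bx]]|[k _ [[k1 k2] Bx]]]|[[t0 h] Bx]].
- have -> : t = 0%R by apply/eqP; rewrite eq_le -!lee_fin; apply/andP.
  by rewrite /xi_left eqxx.
- by rewrite xi_left_lt0// -lte_fin.
- by rewrite (@xi_leftE _ _ e k)// k1.
- have t1 : (0 < t)%R by rewrite -lte_fin.
  by rewrite xi_left_None// => k; exact: h.
Qed.

End predictable_state.

(** * Jump rates *)

Section polish_topology.
Context {R : realType} {T : ptopologicalType}.
Hypothesis polishT : polish R T.

(** Balls of radius 1/n around the points of a dense sequence. *)
Lemma polish_countable_base : exists U : nat -> set T,
  (forall i, open (U i)) /\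
  (forall (O : set T) x, open O -> O x -> exists i, U i x /\ U i `<=` O).
Proof.
have [[D0 cD0 dD0] [d [d_ge0 d_sym d_tri d_nbhs _]]] := polishT.
have dxx x : d x x = 0%R by apply/(d_ge0 x x).2.
have d0 x y : (0 <= d x y)%R by have [] := d_ge0 x y.
have open_ball x (r : R) : open [set y | (d x y < r)%R].
  rewrite openE => y /= xy; apply/d_nbhs; exists (r - d x y)%R; first lra.
  by move=> z /= yz; apply: le_lt_trans (d_tri x y z) _; lra.
have [u hu] : exists u : nat -> T, forall x, D0 x -> exists n, u n = x.
  move: cD0 => /pfcard_geP[D00|[f]].
    by exists (fun=> point) => x; rewrite D00.
  by exists f => x /(@surj _ _ _ _ f)[n _ <-]; exists n.
pose V (p : nat * nat) : set T := [set y | (d (u p.1) y < p.2.+1%:R^-1)%R].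
have [g [h hg]] : exists g : nat -> nat * nat, exists h, cancel h g.
  by exists (fun n => odflt (0, 0)%N (unpickle n)), pickle => p; rewrite pickleK.
exists (V \o g); split=> [i|O x oO Ox]; first exact: open_ball.
have /d_nbhs[r r0 xrO] : nbhs x O by exact: open_nbhs_nbhs.
pose n := Num.truncn (2 / r).
have nr : (2 * n.+1%:R^-1 < r :> R)%R.
  by rewrite ltr_pdivrMr ?ltr0n// mulrC -ltr_pdivrMr// truncnS_gt.
have n0 : (0 < n.+1%:R^-1 :> R)%R by rewrite invr_gt0 ltr0n.
have [y [/= xy /hu[i iy]]] : [set y | (d x y < n.+1%:R^-1)%R] `&` D0 !=set0.
  by apply: dD0; [exists x; rewrite /= dxx|exact: open_ball].
exists (h (i, n)); split; rewrite /= hg /V/= iy; first by rewrite d_sym.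
move=> z /= yz; apply: xrO => /=; apply: le_lt_trans (d_tri x y z) _.
by move: nr xy yz; move: (n.+1%:R^-1)%R => c; lra.
Qed.

Lemma polish_open_setC1 (x : T) : open (~` [set x]).
Proof.
have [_ [d [d_ge0 d_sym d_tri d_nbhs _]]] := polishT.
rewrite openE => y yx; apply/d_nbhs; exists (d x y).
  rewrite lt_neqAle (d_ge0 x y).1 andbT eq_sym; apply/eqP => /(d_ge0 x y).2.
  by move=> xy; apply: yx.
by move=> z /= yz zx; move: yz; rewrite zx d_sym ltxx.
Qed.

Lemma borel_open (U : set T) : open U -> measurable (U : set (borel T)).
Proof. by move=> oU; exact: sub_sigma_algebra. Qed.

Lemma borel_set1 (x : T) : measurable ([set x] : set (borel T)).
Proof.
rewrite -[[set x]]setCK; apply: (@measurableC _ (borel T)).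
exact: (borel_open (@polish_open_setC1 x)).
Qed.

End polish_topology.

Section jump_rates.
Context {R : realType} {S A : ptopologicalType}.
Variables (adm : S -> set A) (q : S -> A -> {charge set (borel S) -> \bar R}).
Hypotheses (polishS : polish R S) (model : ctmdp adm q).

Let m1 (x : S) : measurable ([set x] : set (borel S)) := borel_set1 polishS x.

Lemma rate_diag x a :
  q x a setT = q x a (~` [set x]) + q x a [set x].
Proof. by rewrite (chargeDI (q x a) measurableT (m1 x)) setTD setTI. Qed.

Lemma rate_diagE x a : adm x a -> q x a [set x] = - q x a (setT `\ x).
Proof.
move=> xa; have := rate_diag x a; rewrite (rate_conservative model xa) setTD.
have fC : q x a (~` [set x]) \is a fin_num.
  by apply: fin_num_measure; exact: measurableC.
by rewrite addeC => h; rewrite -[LHS](addeK _ fC) -h add0e.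
Qed.

(** The set from which the current state is removed varies with the state, so
    that measurability of [Q] is not immediate. The complement of the current
    state is the increasing union of the complements of [B n x], the set of
    points that the first n basic open sets do not separate from [x], and
    [B n x] takes finitely many values as [x] varies. *)
Lemma jump_rate_exists : exists Q : borel S * borel A -> {measure set (borel S) -> \bar R},
  [/\ forall x a D, adm x a -> measurable D -> Q (x, a) D = q x a (D `\ x),
      forall z D, ~ graph adm z -> Q z D = 0
    & forall D, measurable D -> measurable_fun setT (Q ^~ D)].
Proof.
have /choice[Q QE] (z : borel S * borel A) : exists Qz : {measure set (borel S) -> \bar R},
    (graph adm z -> forall D, measurable D -> Qz D = q z.1 z.2 (D `\ z.1)) /\
    (~ graph adm z -> forall D, Qz D = 0).
  have [gz|ngz] := pselect (graph adm z); last by exists mzero; split.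
  pose c := crestr0 (q z.1 z.2) (measurableC (m1 z.1)).
  have c0 E : 0 <= c E.
    rewrite /c /crestr0; case: ifPn => // /[1!inE] mE.
    apply: (rate_ge0 model) => //.
      by apply: measurableI => //; exact: measurableC.
    by move=> [_]; exact.
  exists (measure_of_charge _ c0); split=> [_ D mD|/(_ gz)//].
  by rewrite [LHS](_ : _ = c D)// /c /crestr0 mem_set.
have mgraph := graph_measurable model.
exists Q; split=> [x a D xa mD|z D ngz|D mD].
- by rewrite (QE (x, a)).1.
- by rewrite (QE z).2.
have [U [oU baseU]] := polish_countable_base polishS.
pose V n (x : S) : set (borel S) := if x \in U n then U n else ~` U n.
pose B n (x : S) : set (borel S) := [set y | forall i, (i < n)%N -> V i x y].
have mU n : measurable (U n : set (borel S)) by exact: borel_open.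
have mV n x : measurable (V n x : set (borel S)).
  by rewrite /V; case: ifP => _; [|apply: measurableC].
have BS n x : B n.+1 x = B n x `&` V n x.
  apply/seteqP; split=> [y By|y [By Vy] i].
    by split=> [i ni|]; apply: By => //; exact: ltnW.
  by rewrite ltnS leq_eqVlt => /orP[/eqP->//|]; exact: By.
have B0 x : B 0%N x = setT by apply/seteqP; split.
have mB n x : measurable (B n x : set (borel S)).
  by elim: n => [|n IH]; [rewrite B0|rewrite BS; apply: measurableI].
have bigB x : \bigcap_n B n x = [set x].
  apply/seteqP; split=> [y yB|_ -> n _ i _]; last first.
    by rewrite /V; case: ifPn; rewrite ?inE// => /negP; rewrite inE.
  apply: contrapT => yx.
  have [i [Uix Uiy]] := baseU (~` [set y]) x (polish_open_setC1 polishS y) (fun h => yx (esym h)).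
  have := yB i.+1 I i (ltnSn i); rewrite /V mem_set// => Uy.
  exact: (Uiy _ Uy).
have mg n : forall E : set (borel S), measurable E ->
    measurable_fun (graph adm) (fun z : borel S * borel A => q z.1 z.2 (E `&` B n z.1)).
  elim: n => [E mE|n IH E mE].
    by under eq_fun do rewrite B0 setIT; exact: rate_measurable.
  rewrite (_ : (fun z => _) = fun z : borel S * borel A =>
      if z.1 \in U n then q z.1 z.2 ((E `&` U n) `&` B n z.1)
      else q z.1 z.2 ((E `&` ~` U n) `&` B n z.1)); last first.
    apply/funext => z; rewrite BS /V; case: ifP => _; congr (q _ _ _);
      by rewrite -setIA [B _ _ `&` _]setIC.
  apply: measurable_fun_if => //.
  - apply: measurable_funTS; apply: (@measurable_fun_bool _ _ _ _ true).
    rewrite setTI (_ : _ @^-1` _ = U n `*` setT); last first.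
      by apply/seteqP; split=> z /=; [move/set_mem|case=> /mem_set].
    exact: measurableX.
  - by apply: measurable_funS (IH _ (measurableI _ _ mE (mU n))).
  - by apply: measurable_funS (IH _ (measurableI _ _ mE (measurableC (mU n)))).
have mQg : measurable_fun (graph adm) (Q ^~ D).
  pose g n (z : borel S * borel A) := (q z.1 z.2 D - q z.1 z.2 (D `&` B n z.1))%E.
  apply: (emeasurable_fun_cvg g).
    by move=> n; apply: emeasurable_funB; [exact: rate_measurable|exact: mg].
  move=> z gz.
  have QD n : q z.1 z.2 D - q z.1 z.2 (D `&` B n z.1) = Q z (D `\` B n z.1).
    rewrite -chargeD// ((QE z).1 gz); last exact: measurableD.
    congr (q _ _ _); apply/seteqP; split=> y [Dy Bn]; [split=> //|by case: Dy].
    move=> /= yz; apply: Bn; rewrite yz.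
    by have : [set z.1] z.1 by []; rewrite -bigB => /(_ n I).
  under eq_fun do rewrite /g QD.
  have -> : Q z D = Q z (\bigcup_n (D `\` B n z.1)).
    under eq_bigcupr do rewrite setDE.
    rewrite -setI_bigcupr -setC_bigcap bigB -setDE !((QE z).1 gz)//; last first.
      exact: measurableD.
    by congr (q _ _ _); apply/seteqP; split=> [y [? ?]|y [[? ?] ?]].
  apply: nondecreasing_cvg_mu.
  - by move=> n; exact: measurableD.
  - by apply: bigcupT_measurable => n; exact: measurableD.
  - move=> m n mn; apply/subsetPset; apply: setDS => y By i im.
    exact: By (leq_trans im mn).
rewrite -(setvU (graph adm)); apply/measurable_funU => //; first exact: measurableC.
split=> //; apply: (eq_measurable_fun (cst 0)) => // z.
by rewrite inE => ngz; rewrite (QE z).2.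
Qed.

End jump_rates.

Section drift.
Context {R : realType} {S A : ptopologicalType}.
Variables (adm : S -> set A) (q : S -> A -> {charge set (borel S) -> \bar R}).
Hypotheses (polishS : polish R S) (model : ctmdp adm q).
Variable Q : borel S * borel A -> {measure set (borel S) -> \bar R}.
Hypothesis QE : forall x a D, adm x a -> measurable D ->
  Q (x, a) D = q x a (D `\ x).

Let m1 (x : S) : measurable ([set x] : set (borel S)) := borel_set1 polishS x.

Lemma jump_rateT x a : adm x a -> Q (x, a) setT = - q x a [set x].
Proof. by move=> xa; rewrite QE// (rate_diagE polishS model xa) oppeK. Qed.

Lemma jump_rate_fin x a D : adm x a -> measurable D -> Q (x, a) D \is a fin_num.
Proof.
by move=> xa mD; rewrite QE//; apply: fin_num_measure; exact: measurableD.
Qed.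

Lemma jump_rate_abs x a : adm x a -> `|q x a [set x]| = Q (x, a) setT.
Proof. by move=> xa; rewrite jump_rateT// -abseN gee0_abs// -jump_rateT. Qed.

Lemma jump_rate_le_qstar x a : adm x a -> Q (x, a) setT <= qstar adm q x.
Proof.
by move=> xa; rewrite -jump_rate_abs//; apply: ereal_sup_ubound; exists a.
Qed.

Lemma rateE x a (D : set (borel S)) : adm x a -> measurable D ->
  q x a D = Q (x, a) D - (\1_D x)%:E * Q (x, a) setT.
Proof.
move=> xa mD; rewrite (chargeDI (q x a) mD (m1 x)) -QE//; congr (_ + _).
rewrite (jump_rateT xa) muleN oppeK indicE; have [xD|xD] := pselect (D x).
  by rewrite mem_set// mul1e; congr (q _ _ _); apply/setIidr => _ ->.
rewrite memNset// mul0e -[RHS](charge0 (q x a)); congr (q _ _ _).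
by apply/seteqP; split=> // y [Dy yx]; apply: xD; rewrite -yx.
Qed.

(** The Jordan decomposition of [q x a] is explicit: its positive part is
    [Q (x, a)] and its negative part is at most the exit rate placed at [x]. *)
Lemma integral_jump_rate_le (x : borel S) a (f : borel S -> R) (r : R) : adm x a ->
  measurable_fun setT f -> (forall y, (0 <= f y)%R) ->
  charge_integral (q x a) (fun y => (f y)%:E) <= r%:E ->
  \int[Q (x, a)]_y (f y)%:E <= r%:E + Q (x, a) setT * (f x)%:E.
Proof.
move=> xa mf f0; rewrite /charge_integral.
case: cid => P hP; case: cid => N hN.
have [[mP posP] [mN negN] PNT PN0] := hN.
have mfE : measurable_fun setT (EFin \o f) by exact/measurable_EFinP.
have f0E y : 0 <= (f y)%:E by rewrite lee_fin.
have qx0 : q x a [set x] <= 0 by rewrite -oppe_ge0 -jump_rateT.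
have negE D : measurable D -> q x a ((D `&` N) `\ x) = 0.
  move=> mD; have mDN := measurableI _ _ mD mN.
  apply/eqP; rewrite eq_le; apply/andP; split.
    by apply: negN; [exact: measurableD|move=> y [[]]].
  by rewrite -QE.
have I1in (E : set (borel S)) : E x -> E `&` [set x] = [set x].
  by move=> Ex; apply/setIidr => _ ->.
have I1out (E : set (borel S)) : ~ E x -> E `&` [set x] = set0.
  by move=> Ex; apply/seteqP; split=> // y [Ey yx]; apply: Ex; rewrite -yx.
have posE D : measurable D -> jordan_pos hN D = Q (x, a) D.
  move=> mD; have mDP := measurableI _ _ mD mP.
  rewrite jordan_posE cjordan_posE /crestr0 mem_set// /crestr.
  rewrite QE// (charge_partition (q x a) (measurableD mD (m1 x)) mP mN)//.
  have DE M : (D `\ x) `&` M = (D `&` M) `\ x by rewrite !setDE setIAC.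
  rewrite !DE negE// adde0 (chargeDI (q x a) mDP (m1 x)).
  suff -> : q x a ((D `&` P) `&` [set x]) = 0 by rewrite adde0.
  have [DPx|DPx] := pselect ((D `&` P) x); last by rewrite I1out ?charge0.
  rewrite I1in//; apply/eqP; rewrite eq_le qx0/=; apply: posP => //.
  by move=> _ ->; case: DPx.
have negEd D : measurable D -> jordan_neg hN D <= Q (x, a) setT * \d_x D.
  move=> mD; have mDN := measurableI _ _ mD mN.
  rewrite jordan_negE cjordan_negE /crestr0 mem_set// /crestr.
  rewrite (chargeDI (q x a) mDN (m1 x)) negE// add0e diracE jump_rateT//.
  have [Dx|Dx] := pselect (D x); last first.
    by rewrite memNset// mule0 I1out ?charge0 ?oppe0// => -[].
  rewrite mem_set// mule1 leeN2.
  by have [Nx|Nx] := pselect (N x); [rewrite I1in|rewrite I1out ?charge0// => -[]].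
have lam0 : (0 <= fine (Q (x, a) setT))%R by exact: fine_ge0.
have lamE : (fine (Q (x, a) setT))%:E = Q (x, a) setT.
  by rewrite fineK//; exact: jump_rate_fin.
have intneg : \int[jordan_neg hN]_y (f y)%:E <= Q (x, a) setT * (f x)%:E.
  apply: (@le_trans _ _ (\int[mscale (NngNum lam0) \d_x]_y (f y)%:E)).
    apply: ge0_le_measure_integral => // D mD.
    rewrite [leRHS](_ : _ = (fine (Q (x, a) setT))%:E * \d_x D)// lamE.
    exact: negEd.
  by rewrite ge0_integral_mscale// integral_dirac// diracT mul1e lamE.
have -> : \int[jordan_pos hN]_y (f y)%:E = \int[Q (x, a)]_y (f y)%:E.
  by apply: eq_measure_integral => D mD _; exact: posE.
have fneg : \int[jordan_neg hN]_y (f y)%:E \is a fin_num.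
  rewrite ge0_fin_numE ?integral_ge0//.
  by rewrite (le_lt_trans intneg)// -lamE -EFinM ltry.
rewrite leeBlDr// => /le_trans; apply; exact: leeD2l.
Qed.

End drift.

(** * The law of the next jump *)

Section jump_law.
Context {R : realType} {S A : ptopologicalType}.
Variables (adm : S -> set A) (q : S -> A -> {charge set (borel S) -> \bar R}).
Hypotheses (polishS : polish R S) (model : ctmdp adm q).
Variable Q : borel S * borel A -> {measure set (borel S) -> \bar R}.
Hypothesis QE : forall x a D, adm x a -> measurable D ->
  Q (x, a) D = q x a (D `\ x).
Hypothesis mQ : forall D, measurable D -> measurable_fun setT (Q ^~ D).
Variable pi : Defs.path R S * R -> {measure set (option (borel A)) -> \bar R}.
Hypothesis pi_T : forall et, pi et setT = 1.
Hypothesis pi_adm : forall (e : Defs.path R S) (t : R), (0 <= t)%R ->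
  pi (e, t) (adm_infty adm (xi_left e t)) = 1.
Local Notation Om := (Omega R S).
Local Notation lambda := (@lebesgue_measure R).
Implicit Types (e : Defs.path R S) (k : nat).

Definition current k e : borel S := odflt point (state e k).
Definition action (b : option (borel A)) : borel A := odflt point b.
(** Equivalently, the k-th jump time is finite. *)
Definition alive k : set Om := [set e | state e k != None].

Lemma measurable_current k : measurable_fun setT (current k : Om -> borel S).
Proof.
exact: (measurableT_comp (@measurable_odflt _ (borel S) point) (measurable_state k)).
Qed.

Lemma measurable_action : measurable_fun setT action.
Proof. exact: measurable_odflt. Qed.

Lemma alive_state k e : alive k e -> state e k = Some (current k e).
Proof. by rewrite /alive/= /current; case: (state e k). Qed.

Lemma measurable_adm_Some x : measurable (Some @` adm x : set (option (borel A))).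
Proof. by apply: measurable_image_Some; exact: (adm_measurable model). Qed.

Lemma measurable_jump_rate_action x D : measurable D ->
  measurable_fun setT (fun b => Q (x, action b) D).
Proof.
move=> mD; apply: (measurableT_comp (mQ mD)).
apply/measurable_fun_pairP; split => /=.
  exact: measurable_cst.
exact: measurable_action.
Qed.

(** So nothing is lost in replacing integrals over admissible actions by
    integrals over all of them, where [Q] is total. *)
Lemma pi_adm_ae e t x : (0 <= t)%R -> xi_left e t = Some x ->
  pi (e, t) (~` (Some @` adm x)) = 0.
Proof.
move=> t0 xt; have mx := measurable_adm_Some x.
have := pi_adm e t0; rewrite xt /= => pi1.
have : pi (e, t) setT =
    pi (e, t) (Some @` adm x) + pi (e, t) (~` (Some @` adm x)).
  by rewrite -measureU ?setUv ?setICr//; exact: measurableC.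
rewrite pi_T pi1; move: (pi _ _) => z h.
by rewrite -[z](@addeK _ 1 z)// [z + _]addeC -h subee.
Qed.

Lemma integral_pi_adm e t x (f : option (borel A) -> \bar R) :
  (0 <= t)%R -> xi_left e t = Some x -> measurable_fun setT f ->
  (forall b, 0 <= f b) ->
  \int[pi (e, t)]_(b in Some @` adm x) f b = \int[pi (e, t)]_b f b.
Proof.
move=> t0 xt mf f0; have mx := measurable_adm_Some x.
rewrite -[in RHS](setUv (Some @` adm x)) ge0_integral_setU//; last 3 first.
- exact: measurableC.
- exact: measurable_funTS.
- by rewrite disj_set2E setICr.
rewrite [X in _ + X]null_set_integral ?adde0//.
- exact: measurableC.
- exact: measurable_funTS.
- exact: pi_adm_ae.
Qed.

Lemma intensityE e t x (D : set (borel S)) : (0 <= t)%R -> xi_left e t = Some x ->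
  measurable D ->
  intensity adm q (fun et => pi et) e t D =
    \int[pi (e, t)]_b Q (x, action b) D.
Proof.
move=> t0 xt mD; rewrite /intensity xt -(integral_pi_adm t0 xt)//; last first.
  exact: measurable_jump_rate_action.
apply: eq_integral => b; rewrite inE /= => -[a xa <-].
by rewrite /action /= QE.
Qed.

Lemma intensity_le_qstar e t x (D : set (borel S)) : (0 <= t)%R -> xi_left e t = Some x ->
  measurable D -> intensity adm q (fun et => pi et) e t D <= qstar adm q x.
Proof.
move=> t0 xt mD; have mx := measurable_adm_Some x.
rewrite (intensityE t0 xt mD) -(integral_pi_adm t0 xt)//; last first.
  exact: measurable_jump_rate_action.
have pi1 := pi_adm e t0; rewrite xt /= in pi1.
apply: (@le_trans _ _ (\int[pi (e, t)]_(b in Some @` adm x) cst (qstar adm q x) b)).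
  apply: ge0_le_integral => //.
  - by apply: measurable_funTS; exact: measurable_jump_rate_action.
  - move=> b [a xa <-]; rewrite /cst /action/=.
    apply: le_trans (jump_rate_le_qstar polishS model QE xa).
    by apply: le_measure; rewrite ?inE.
by rewrite integral_cst// pi1 mule1.
Qed.

Variable m : forall k, R.-ker (history R S k * measurableTypeR R)%type ~> borel S.
Hypothesis hrep : intensity_representation adm q (fun et => pi et) m.

(** The representation only determines [m k] along paths that have not jumped
    yet. The stopped path with the same history covers all positive times. *)
Lemma m_le e k v (D : set (borel S)) : alive k e -> (0 < v)%R -> measurable D ->
  m k (hist k e, v) D <= qstar adm q (current k e).
Proof.
move=> ek v0 mD; have [e' [he sk tk tk1]] := stopped_path ek.
have Tk := jump_time_fineK ek; have t0 := jump_time_ge0 e k.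
rewrite -Tk lee_fin in t0.
pose t := (fine (jump_time e k) + v)%R.
have tt : jump_time e' k < t%:E <= jump_time e' k.+1.
  by rewrite tk tk1 -Tk lte_fin ltrDl v0/= leey.
have := @hrep k e' t D mD tt; rewrite he tk {2}/t addrC addKr => <-.
apply: intensity_le_qstar => //; first by rewrite /t addr_ge0// ltW.
by rewrite (xi_leftE tt) sk (alive_state ek).
Qed.

Lemma m_intensity e k t (D : set (borel S)) : measurable D ->
  jump_time e k < t%:E <= jump_time e k.+1 ->
  m k (hist k e, t - fine (jump_time e k))%R D =
    \int[pi (e, t)]_b Q (current k e, action b) D.
Proof.
move=> mD tk; rewrite -hrep//; have /andP[tk1 _] := tk.
have ek : alive k e by rewrite /alive/= -jump_time_lty (lt_trans tk1)// ltry.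
apply: intensityE => //.
  by rewrite -lee_fin ltW// (le_lt_trans (jump_time_ge0 e k)).
by rewrite (xi_leftE tk) (alive_state ek).
Qed.

Definition survival k (z : history R S k * measurableTypeR R) : \bar R :=
  expeR (- \int[lambda]_(v in `]0%R, z.2[) m k (z.1, v) setT).

Definition survival_oo k (h : history R S k) : \bar R :=
  expeR (- \int[lambda]_(v in `]0%R, +oo[) m k (h, v) setT).

Lemma measurable_m k (D : set (borel S)) : measurable D ->
  measurable_fun setT (fun z => m k z D).
Proof. by move=> mD; exact: measurable_kernel. Qed.

Lemma measurable_survival k : measurable_fun setT (@survival k).
Proof.
apply: (measurableT_comp (@measurable_expeR R)).
apply: (measurableT_comp (@oppe_measurable R setT)).
apply: (measurable_fun_integral_oo (f := fun z => m k z setT)) => //.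
exact: measurable_m.
Qed.

Lemma measurable_survival_oo k : measurable_fun setT (@survival_oo k).
Proof.
apply: (measurableT_comp (@measurable_expeR R)).
apply: (measurableT_comp (@oppe_measurable R setT)).
apply: (measurable_fun_integral_oy (f := fun z => m k z setT)) => //.
exact: measurable_m.
Qed.

Lemma survival_ge0 k z : 0 <= @survival k z.
Proof. exact: expeR_ge0. Qed.

Lemma survival_le1 k z : @survival k z <= 1.
Proof.
rewrite /survival -expeR0 lee_expeR oppe_le0; exact: integral_ge0.
Qed.

Variable P : probability Om R.
Hypothesis law_m : forall k (B : set (history R S k)), measurable B ->
  let past := [set e : Defs.path R S | B (hist k e) /\ state e k <> None] in
  (forall (C : set (measurableTypeR R)) (D : set (borel S)),
    measurable C -> C `<=` [set` `]0%R, +oo[%R] -> measurable D ->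
    P (past `&` [set e | (EFin @` C) (sojourn e k) /\
                         (Some @` D) (state e k.+1)]) =
    \int[P]_(e in past) \int[lambda]_(t in C)
      (m k (hist k e, t) D *
       expeR (- \int[lambda]_(v in `]0%R, t[) m k (hist k e, v) setT))) /\
  P (past `&` [set e | sojourn e k = +oo /\ state e k.+1 = None]) =
  \int[P]_(e in past)
    expeR (- \int[lambda]_(v in `]0%R, +oo[) m k (hist k e, v) setT).

Definition jump_in k (D : set (borel S)) : set Om :=
  [set e | (Some @` D) (state e k)].

Lemma measurable_alive k : measurable (alive k).
Proof. exact: measurable_state_neq_None. Qed.

Lemma measurable_jump_in k D : measurable D -> measurable (jump_in k D).
Proof.
by move=> mD; apply: measurable_state_in; exact: measurable_image_Some.
Qed.

Lemma aliveS e k : alive k.+1 e -> alive k e.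
Proof.
rewrite /alive/= -!jump_time_lty; apply: le_lt_trans.
exact: nd_jump_time.
Qed.

Lemma jump_in_alive k D e : jump_in k D e -> alive k e.
Proof. by rewrite /jump_in /alive/= => -[x _ <-]. Qed.

Lemma alive_sojourn e k : alive k.+1 e -> (fine (sojourn e k))%:E = sojourn e k.
Proof.
move=> ek; have := state_sojourn_next (aliveS ek).
rewrite (negbTE ek) => /esym/negbT; rewrite -ltey => s1.
by rewrite fineK// ge0_fin_numE// ltW// sojourn_gt0.
Qed.

Lemma measurable_hist_sojourn k : measurable_fun setT
  (fun e : Om => (hist k e, fine (sojourn e k)) : history R S k * measurableTypeR R).
Proof.
apply/measurable_fun_pairP; split => /=; first exact: measurable_hist.
rewrite [X in measurable_fun _ X](_ : _ = fine \o (fun e : Om => sojourn e k))//.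
by apply: measurableT_comp => //; exact: measurable_sojourn.
Qed.

(** The joint law of history, sojourn time and next state, from rectangles to
    functions. *)
Lemma integral_next_jump k (D : set (borel S))
    (F : history R S k * measurableTypeR R -> \bar R) :
  measurable D -> measurable_fun setT F -> (forall z, 0 <= F z) ->
  \int[P]_e ((\1_(jump_in k.+1 D) e)%:E * F (hist k e, fine (sojourn e k))) =
  \int[P]_e ((\1_(alive k) e)%:E *
    \int[lambda]_(t in `]0%R, +oo[)
      (F (hist k e, t) * (m k (hist k e, t) D * survival (hist k e, t)))).
Proof.
move=> mD mF F0; have mE := measurable_jump_in k.+1 mD.
have [nu1 [nu1E nu1int]] :=
  restricted_law_exists P mE (@measurable_hist_sojourn k).
pose pos : set (history R S k * measurableTypeR R) := setT `*` [set` `]0%R, +oo[%R].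
have mpos : measurable pos by exact: measurableX.
pose dens z := (m k z D * survival z)%E.
have mdens : measurable_fun setT dens.
  by apply: emeasurable_funM; [exact: measurable_m|exact: measurable_survival].
have dens0 z : 0 <= dens z by rewrite mule_ge0// survival_ge0.
pose g z : R := (\1_pos z * fine (dens z))%R.
have mg : measurable_fun setT g.
  apply: measurable_funM; first exact: measurable_indic.
  exact: measurableT_comp.
have g0 z : (0 <= g z)%R by rewrite mulr_ge0// fine_ge0.
have gE e t : alive k e ->
    (g (hist k e, t))%:E = (\1_(`]0%R, +oo[%classic) t)%:E * dens (hist k e, t).
  move=> ek; rewrite /g !indicE; have [t0|t0] := boolP (t \in `]0%R, +oo[%classic).
    rewrite mem_set; last by split=> //=; rewrite inE in t0.
    rewrite mul1r mul1e fineK// ge0_fin_numE//.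
    rewrite inE /= in_itv/= andbT in t0.
    rewrite (le_lt_trans _ (rate_stable model (current k e)))//.
    apply: le_trans (m_le ek t0 mD); rewrite /dens -[leRHS]mule1.
    by rewrite lee_wpmul2l// survival_le1.
  rewrite memNset ?mul0r ?mul0e//= => -[_ /=] t1; move/negP: t0; apply.
  by rewrite inE.
have [nu2 nu2int] := iterated_density_exists P lambda (measurable_alive k)
  (@measurable_hist R S k) mg g0.
have {}nu2int f : measurable_fun setT f -> (forall z, 0 <= f z) ->
    \int[nu2]_z f z = \int[P]_e ((\1_(alive k) e)%:E *
      \int[lambda]_(t in `]0%R, +oo[) (f (hist k e, t) * dens (hist k e, t))).
  move=> mf f0; rewrite (nu2int f f0 mf); apply: eq_integral => e _; rewrite indicE.
  have [ek|ek] := boolP (e \in alive k); last by rewrite !mul0e.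
  rewrite !mul1e [RHS]integral_mkcond; apply: eq_integral => t _ /=.
  rewrite inE in ek; rewrite gE// patchE indicE.
  by case: ifPn => _; rewrite ?mul1e ?mul0e// muleC.
transitivity (\int[nu1]_z F z); first by rewrite nu1int.
transitivity (\int[nu2]_z F z); last by rewrite nu2int.
apply: eq_measure_integral => U mU _.
apply: measure_eq_rectangles => //; last first.
  rewrite nu1E// preimage_setT setIT (le_lt_trans (probability_le1 P mE))//.
  exact: ltry.
move=> B C mB mC.
pose C' : set (measurableTypeR R) := C `&` [set` `]0%R, +oo[%R].
have mC' : measurable C' by exact: measurableI.
have [+ _] := @law_m k B mB; move=> /(_ C' D mC' (@subIsetr _ _ _) mD) law_C.
rewrite nu1E; last exact: measurableX.
have -> : nu2 (B `*` C) = \int[nu2]_z (\1_(B `*` C) z)%:E.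
  by rewrite integral_indic ?setIT//; exact: measurableX.
rewrite nu2int//; last first.
  by apply: emeasurable_indic; exact: measurableX.
have -> : jump_in k.+1 D `&` (fun e => (hist k e, fine (sojourn e k))) @^-1` (B `*` C) =
    [set e | B (hist k e) /\ state e k <> None] `&`
    [set e | (EFin @` C') (sojourn e k) /\ (Some @` D) (state e k.+1)].
  apply/seteqP; split=> [e [De [Be Ce]]|e [[Be _] [[t [Ct t0] te] De]]].
    have ek1 := jump_in_alive De; have ek := aliveS ek1.
    have sE := alive_sojourn ek1.
    split; split=> //; first by apply/eqP; exact: ek.
    exists (fine (sojourn e k)) => //; split=> //=.
    by rewrite in_itv/= andbT -lte_fin sE sojourn_gt0.
  by split=> //; split=> //=; rewrite -te.
apply: (etrans law_C); rewrite integral_mkcond; apply: eq_integral => e _.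
rewrite patchE indicE.
have past_alive : (e \in [set e | B (hist k e) /\ state e k <> None]) =
    (e \in alive k) && (hist k e \in B).
  apply/idP/andP; rewrite !inE /alive/=; first by move=> [? /eqP].
  by move=> [/eqP ? ?].
rewrite past_alive; have [ek|ek] := boolP (e \in alive k); last by rewrite mul0e.
rewrite mul1e /=; have [Be|Be] := boolP (hist k e \in B); last first.
  rewrite integral0_eq// => t _; rewrite indicE memNset ?mul0e// => -[/= + _].
  by move/negP: Be; rewrite inE.
rewrite integral_mkcond [RHS]integral_mkcond; apply: eq_integral => t _.
rewrite !patchE indicE /C' in_setI in_setX Be /=.
by do 2 case: (_ \in _); rewrite ?mul1e ?mul0e.
Qed.

Lemma integral_no_jump k (H : history R S k -> \bar R) :
  measurable_fun setT H -> (forall h, 0 <= H h) ->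
  \int[P]_e ((\1_(alive k `\` alive k.+1) e)%:E * H (hist k e)) =
  \int[P]_e ((\1_(alive k) e)%:E * (survival_oo (hist k e) * H (hist k e))).
Proof.
move=> mH H0.
have mE := measurableD (measurable_alive k) (measurable_alive k.+1).
have [nu [nuE nuint]] := restricted_law_exists P mE (@measurable_hist R S k).
have [muk [_ mukint]] :=
  restricted_law_exists P (measurable_alive k) (@measurable_hist R S k).
pose g (h : history R S k) : R := fine (survival_oo h).
have gE h : (g h)%:E = survival_oo h.
  rewrite /g fineK// ge0_fin_numE ?expeR_ge0// (@le_lt_trans _ _ 1) ?ltry//.
  by rewrite -expeR0 lee_expeR oppe_le0 integral_ge0.
have g0 h : (0 <= g h)%R by rewrite -lee_fin gE expeR_ge0.
have mg : measurable_fun setT g.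
  by apply: measurableT_comp => //; exact: measurable_survival_oo.
rewrite -(nuint H H0 mH) (@integral_density _ _ _ muk nu g mg g0 _ H H0 mH).
  rewrite mukint.
  - by apply: eq_integral => e _; rewrite gE.
  - by move=> h; rewrite mule_ge0// lee_fin.
  - by apply: emeasurable_funM => //; exact/measurable_EFinP.
move=> B mB; have [_ law_oo] := @law_m k B mB.
rewrite nuE//.
have -> : (alive k `\` alive k.+1) `&` (@hist R S k) @^-1` B =
    [set e | B (hist k e) /\ state e k <> None] `&`
    [set e | sojourn e k = +oo /\ state e k.+1 = None].
  apply/seteqP; split=> [e [[ek ek1] Be]|e [[Be ek] [_ ek1]]].
    have e1 : state e k.+1 = None by apply/eqP/negPn/negP.
    split; split=> //; first by apply/eqP; exact: ek.
    by apply/eqP; rewrite -(state_sojourn_next ek) e1.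
  by split=> //; split; rewrite /alive/=; [exact/eqP|rewrite ek1].
apply: (etrans law_oo); rewrite [RHS]integral_mkcond mukint; last 2 first.
- by move=> h; rewrite patchE; case: ifPn => _; rewrite ?lee_fin.
- apply/(measurable_restrictT _ _).1 => //; apply: measurable_funTS.
  exact/measurable_EFinP.
rewrite [LHS]integral_mkcond; apply: eq_integral => e _; rewrite !patchE indicE.
have -> : (e \in [set e | B (hist k e) /\ state e k <> None]) =
    (e \in alive k) && (hist k e \in B).
  apply/idP/andP; rewrite !inE /alive/=; first by move=> [? /eqP].
  by move=> [/eqP ? ?].
case: (e \in alive k); last by rewrite mul0e.
by rewrite mul1e /=; case: ifPn; rewrite ?gE.
Qed.

(** Time is counted from the k-th jump, unlike in [stay]. *)
Definition before_next k e : set R := [set t : R | t%:E < sojourn e k].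

(** A jump after a finite time and no jump at all are treated separately and
    recombined by [integral_survival]; survival functions replace the event that
    the next jump has not occurred. *)
Lemma integral_until_jump k (F : history R S k * measurableTypeR R -> \bar R) :
  measurable_fun setT F -> (forall z, 0 <= F z) ->
  \int[P]_e ((\1_(alive k) e)%:E * \int[lambda]_(t in `]0%R, +oo[)
     ((\1_(before_next k e) t)%:E * F (hist k e, t))) =
  \int[P]_e ((\1_(alive k) e)%:E * \int[lambda]_(t in `]0%R, +oo[)
     (F (hist k e, t) * survival (hist k e, t))).
Proof.
move=> mF F0.
pose G (z : history R S k * measurableTypeR R) :=
  \int[lambda]_(v in `]0%R, z.2[) F (z.1, v).
pose Goo (h : history R S k) := \int[lambda]_(v in `]0%R, +oo[) F (h, v).
have mG : measurable_fun setT G by exact: measurable_fun_integral_oo.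
have mGoo : measurable_fun setT Goo by exact: measurable_fun_integral_oy.
have G0 z : 0 <= G z by exact: integral_ge0.
have Goo0 z : 0 <= Goo z by exact: integral_ge0.
have mF2 h : measurable_fun setT (fun v => F (h, v)) by exact: measurable_fun_pair2.
have sT : jump_in k.+1 setT = alive k.+1.
  apply/seteqP; split=> e; first by move/jump_in_alive.
  by move=> ek; exists (current k.+1 e) => //; rewrite (alive_state ek).
transitivity (\int[P]_e ((\1_(jump_in k.+1 setT) e)%:E * G (hist k e, fine (sojourn e k)) +
    (\1_(alive k `\` alive k.+1) e)%:E * Goo (hist k e))).
  apply: eq_integral => e _; rewrite sT !indicE in_setD.
  have [ek1|ek1] := boolP (e \in alive k.+1).
    have ek : e \in alive k by move: ek1; rewrite !inE; exact: aliveS.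
    rewrite ek !mul1e mul0e adde0 integral_mkcond [RHS]integral_mkcond.
    apply: eq_integral => t _; rewrite !patchE indicE.
    rewrite inE in ek1; have := alive_sojourn ek1; set th := fine _ => thE.
    have -> : (t \in `]0%R, th[%classic) =
        (t \in `]0%R, +oo[%classic) && (t \in before_next k e).
      apply/idP/andP; rewrite !inE /before_next/= !in_itv/= andbT -thE lte_fin.
        by move=> /andP[].
      by move=> [-> ->].
    case: (t \in `]0%R, +oo[%classic) => //=.
    by case: (t \in _); rewrite ?mul1e ?mul0e.
  rewrite mul0e add0e; have [ek|ek] := boolP (e \in alive k); last by rewrite !mul0e.
  rewrite !mul1e; apply: eq_integral => t _; rewrite indicE mem_set ?mul1e//=.
  rewrite inE in ek; have := state_sojourn_next ek.
  have -> : state e k.+1 == None by apply/negPn/negP; move: ek1; rewrite notin_setE.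
  by rewrite /before_next/= => /esym/eqP ->; exact: ltry.
have m1 (E : set Om) : measurable E -> measurable_fun setT (fun e : Om => (\1_E e)%:E : \bar R).
  by move=> mE; exact: emeasurable_indic.
have mD := measurableD (measurable_alive k) (measurable_alive k.+1).
have i0 (E : set Om) e (x : \bar R) : 0 <= x -> 0 <= (\1_E e)%:E * x.
  by move=> x0; rewrite mule_ge0// lee_fin.
rewrite ge0_integralD//=; last 4 first.
- by move=> e _; exact: i0.
- apply: emeasurable_funM; first by apply: m1; exact: measurable_jump_in.
  exact: measurableT_comp mG (@measurable_hist_sojourn k).
- by move=> e _; exact: i0.
- apply: emeasurable_funM; first exact: m1.
  exact: measurableT_comp mGoo (@measurable_hist R S k).
rewrite integral_next_jump// integral_no_jump//.
have mhs k' : measurable_fun setT (fun z : history R S k' * measurableTypeR R =>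
    m k' z setT * survival z).
  by apply: emeasurable_funM; [exact: measurable_m|exact: measurable_survival].
rewrite -ge0_integralD//=; last 4 first.
- move=> e _; apply: i0; apply: integral_ge0 => t _.
  by rewrite mule_ge0// mule_ge0// survival_ge0.
- apply: emeasurable_funM; first by apply: m1; exact: measurable_alive.
  apply: (measurableT_comp (f := fun h => \int[lambda]_(t in `]0%R, +oo[)
    (G (h, t) * (m k (h, t) setT * survival (h, t))))); last exact: measurable_hist.
  apply: (measurable_fun_integral_oy (f := fun z => G z * (m k z setT * survival z))).
    by apply: (emeasurable_funM mG); exact: mhs.
  by move=> z; rewrite mule_ge0// mule_ge0// survival_ge0.
- by move=> e _; apply: i0; rewrite mule_ge0// expeR_ge0.
- apply: emeasurable_funM; first by apply: m1; exact: measurable_alive.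
  apply: (measurableT_comp (f := fun h => survival_oo h * Goo h)); last exact: measurable_hist.
  by apply: emeasurable_funM => //; exact: measurable_survival_oo.
apply: eq_integral => e _; rewrite indicE.
have [ek|ek] := boolP (e \in alive k); last by rewrite !mul0e adde0.
rewrite !mul1e; rewrite inE in ek.
have qfin : qstar adm q (current k e) \is a fin_num.
  rewrite ge0_fin_numE ?rate_stable//.
  exact: le_trans (m_le ek ltr01 measurableT).
have ml : measurable_fun setT (fun v => m k (hist k e, v) setT).
  exact: (measurable_fun_pair2 (hist k e) (@measurable_m k setT measurableT)).
have lC v : (0 < v)%R ->
    m k (hist k e, v) setT <= (fine (qstar adm q (current k e)))%:E.
  by move=> v0; rewrite fineK//; exact: m_le.
exact: (@integral_survival R (fun v => m k (hist k e, v) setT)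
  (fun v => F (hist k e, v)) _ ml (fun v => measure_ge0 _ _) lC (mF2 _) (fun v => F0 _)).
Qed.

(** The compensation formula for the next jump. Both sides equal the integral
    of the intensity against the survival function. *)
Lemma discounted_next_jump k (D : set (borel S)) (H : history R S k -> \bar R)
    (beta : R) : measurable D -> measurable_fun setT H -> (forall h, 0 <= H h) ->
  \int[P]_e ((\1_(jump_in k.+1 D) e)%:E *
     (H (hist k e) * (expR (- (beta * fine (sojourn e k))))%:E)) =
  \int[P]_e ((\1_(alive k) e)%:E * \int[lambda]_(t in `]0%R, +oo[)
     ((\1_(before_next k e) t)%:E *
       (H (hist k e) * (expR (- (beta * t)))%:E * m k (hist k e, t) D))).
Proof.
move=> mD mH H0.
pose F (z : history R S k * measurableTypeR R) :=
  H z.1 * (expR (- (beta * z.2)))%:E.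
have mF : measurable_fun setT F.
  apply: emeasurable_funM; first exact: (measurableT_comp mH measurable_fst).
  apply/measurable_EFinP; apply: measurableT_comp => //; apply: measurableT_comp => //.
  by apply: measurable_funM => //; exact: measurable_snd.
have F0 z : 0 <= F z by rewrite mule_ge0// lee_fin expR_ge0.
rewrite (integral_next_jump mD mF F0).
rewrite (integral_until_jump (F := fun z => F z * m k z D)).
- by apply: eq_integral => e _; congr (_ * _); apply: eq_integral => t _; rewrite muleA.
- by apply: emeasurable_funM => //; exact: measurable_m.
- by move=> z; rewrite mule_ge0.
Qed.

(** * Discounted visits and sojourns under a policy *)

Hypothesis mpi : forall U, measurable U ->
  measurable_fun [set: Om * measurableTypeR R] (pi ^~ U).

Definition stay k e : set R := [set t : R | jump_time e k < t%:E < jump_time e k.+1].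

Definition discount (beta : R) k e : R := expR (- (beta * fine (jump_time e k))).

(** The k-th jump time and the k-th state are functions of the history, so
    that they may enter the conditioning. *)
Definition hist_time k (h : history R S k) : \bar R :=
  \sum_(i < k) (tnth h.2 i).1.

Definition hist_current k : history R S k -> option (borel S) :=
  match k with
  | 0%N => fun h => h.1
  | k'.+1 => fun h => (tnth h.2 ord_max).2
  end.

Lemma hist_timeE k e : hist_time (hist k e) = jump_time e k.
Proof. by apply: eq_bigr => i _; rewrite /hist/= tnth_mktuple. Qed.

Lemma hist_currentE k e : hist_current (hist k e) = state e k.
Proof. by case: k => [|k] //=; rewrite tnth_mktuple. Qed.

Lemma measurable_hist_tnth k (i : 'I_k) :
  measurable_fun setT (fun h : history R S k => tnth h.2 i).
Proof. exact: (measurableT_comp (measurable_tnth i) measurable_snd). Qed.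

Lemma measurable_hist_time k : measurable_fun setT (@hist_time k).
Proof.
apply: (@emeasurable_sum _ _ _ _ _ _ (fun (i : 'I_k) (h : history R S k) => (tnth h.2 i).1)).
by move=> i; exact: (measurableT_comp measurable_fst (@measurable_hist_tnth k i)).
Qed.

Lemma measurable_hist_current k : measurable_fun setT (@hist_current k).
Proof.
case: k => [|k] /=; first exact: measurable_fst.
exact: (measurableT_comp measurable_snd (@measurable_hist_tnth k.+1 ord_max)).
Qed.

Lemma measurable_pi_integral k e (f : borel S * borel A -> \bar R) :
  measurable_fun setT f -> (forall z, 0 <= f z) ->
  measurable_fun setT (fun t : R => \int[pi (e, t)]_b f (current k e, action b)).
Proof.
move=> mf f0; apply: (@measurable_fun_integral_kernel _ _ (measurableTypeR R)
  (option (borel A)) R (fun t => pi (e, t)) _ (fun b => f (current k e, action b))) => //.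
- by move=> U mU; exact: (measurable_fun_pair2 (T1 := Om) e (mpi mU)).
- apply: measurableT_comp => //; apply: measurable_fun_pair => //.
  exact: measurable_action.
Qed.

Lemma measurable_stay k e : measurable (stay k e).
Proof.
rewrite (_ : stay k e = [set t : R | jump_time e k < t%:E] `&`
    [set t : R | t%:E < jump_time e k.+1]).
  by apply: measurableI; apply: emeasurable_set_lt => //; exact: measurable_EFin.
by apply/seteqP; split=> t; rewrite /stay/= => /andP.
Qed.

(** The compensation formula in absolute time, with the intensity written
    through the policy. *)
Lemma jump_balance k (B0 C D : set (borel S)) (beta : R) :
  measurable B0 -> measurable C -> measurable D ->
  \int[P]_e ((\1_(jump_in 0 B0 `&` jump_in k C `&` jump_in k.+1 D) e *
     discount beta k.+1 e)%:E) =
  \int[P]_e ((\1_(jump_in 0 B0 `&` jump_in k C) e)%:E *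
     \int[lambda]_t ((\1_(stay k e) t * expR (- (beta * t)))%:E *
       \int[pi (e, t)]_b Q (current k e, action b) D)).
Proof.
move=> mB0 mC mD.
pose H (h : history R S k) : \bar R :=
  ((\1_(Some @` B0) h.1 * \1_(Some @` C) (hist_current h)) *
   expR (- (beta * fine (hist_time h))))%:E.
have mH : measurable_fun setT H.
  apply/measurable_EFinP; apply: measurable_funM.
    apply: measurable_funM.
      apply: measurableT_comp; last exact: measurable_fst.
      by apply: measurable_indic; exact: measurable_image_Some.
    apply: measurableT_comp; last exact: measurable_hist_current.
    by apply: measurable_indic; exact: measurable_image_Some.
  apply: measurableT_comp => //; apply: measurableT_comp => //.
  apply: measurable_funM => //; apply: measurableT_comp => //.
  exact: measurable_hist_time.
have H0 h : 0 <= H h by rewrite lee_fin mulr_ge0// ?expR_ge0// mulr_ge0.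
have HE e : H (hist k e) = (\1_(jump_in 0 B0 `&` jump_in k C) e * discount beta k e)%:E.
  rewrite /H hist_timeE hist_currentE /discount; congr (_ * _)%:E.
  by rewrite indicI; congr (_ * _)%R; rewrite !indicE; congr (_%:R);
    apply/idP/idP; rewrite !inE.
transitivity (\int[P]_e ((\1_(jump_in k.+1 D) e)%:E *
     (H (hist k e) * (expR (- (beta * fine (sojourn e k))))%:E))).
  apply: eq_integral => e _; rewrite HE -!EFinM; congr EFin.
  have -> : (\1_(jump_in 0 B0 `&` jump_in k C `&` jump_in k.+1 D) e =
      \1_(jump_in 0 B0 `&` jump_in k C) e * \1_(jump_in k.+1 D) e :> R)%R.
    by rewrite indicI.
  rewrite -mulrA mulrCA [(\1_(jump_in k.+1 D) e)%R]indicE.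
  have [ek|ek] := boolP (e \in jump_in k.+1 D); last by rewrite !mul0r.
  rewrite !mul1r -mulrA; congr (_ * _)%R; rewrite inE in ek.
  have ek1 := jump_in_alive ek; have ek0 := aliveS ek1.
  rewrite /discount -expRD; congr expR.
  have -> : fine (jump_time e k.+1) = (fine (jump_time e k) + fine (sojourn e k))%R.
    by rewrite jump_timeS -(jump_time_fineK ek0) -(alive_sojourn ek1).
  by ring.
rewrite (discounted_next_jump beta mD mH H0); apply: eq_integral => e _.
rewrite HE; have [eBC|eBC] := boolP (e \in jump_in 0 B0 `&` jump_in k C); last first.
  rewrite [in RHS]indicE (negbTE eBC) mul0e.
  rewrite integral0_eq ?mule0// => t _.
  by rewrite [(\1_(_ `&` _) e)%R]indicE (negbTE eBC) mul0r !mul0e mule0.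
have ek : alive k e by move: eBC; rewrite inE => -[_ /jump_in_alive].
have -> : (\1_(alive k) e = 1 :> R)%R by rewrite indicE mem_set.
have -> : (\1_(jump_in 0 B0 `&` jump_in k C) e = 1 :> R)%R by rewrite indicE eBC.
rewrite mul1r !mul1e.
pose f (s : R) : \bar R := (\1_(stay k e) s * expR (- (beta * s)))%:E *
  \int[pi (e, s)]_b Q (current k e, action b) D.
have mf : measurable_fun setT f.
  apply: emeasurable_funM; last first.
    exact: (measurable_pi_integral k e (mQ mD) (fun z => measure_ge0 _ _)).
  apply/measurable_EFinP; apply: measurable_funM.
    by apply: measurable_indic; exact: measurable_stay.
  by apply: measurableT_comp => //; apply: measurableT_comp.
have f0 s : 0 <= f s.
  by rewrite mule_ge0 ?integral_ge0// lee_fin mulr_ge0// expR_ge0.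
rewrite -(lebesgue_shift (fine (jump_time e k)) mf f0) integral_mkcond.
have Tk := jump_time_fineK ek.
apply: eq_integral => t _; rewrite patchE.
have stayE : ((t + fine (jump_time e k))%R \in stay k e) =
    (t \in `]0%R, +oo[%classic) && (t \in before_next k e).
  apply/idP/andP; rewrite !inE /stay /before_next /= in_itv/= andbT jump_timeS -Tk
    lte_fin ltrDr EFinD [(t%:E + _)%E]addeC lteD2lE//.
    by move=> /andP.
  by move=> [-> ->].
have stay1 : (\1_(stay k e) (t + fine (jump_time e k)) =
    ((t \in `]0%R, +oo[%classic) && (t \in before_next k e))%:R :> R)%R.
  by rewrite indicE stayE.
rewrite /f stay1; case: ifPn => t0 /=; last by rewrite mul0r mul0e.
rewrite indicE; have [t1|t1] := boolP (t \in before_next k e); last first.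
  by rewrite mul0e mul0r mul0e.
rewrite mul1e mul1r -m_intensity//; last first.
  have : (t + fine (jump_time e k))%R \in stay k e by rewrite stayE t0 t1.
  by rewrite inE /stay/= => /andP[-> /ltW].
rewrite addrK -EFinM; congr (_%:E * _).
by rewrite /discount -expRD; congr expR; ring.
Qed.

Lemma jump_in_T k : jump_in k setT = alive k.
Proof.
apply/seteqP; split=> e; first by move/jump_in_alive.
by move=> ek; exists (current k e) => //; rewrite (alive_state ek).
Qed.

Lemma jump_inE k D e : jump_in k D e <-> alive k e /\ D (current k e).
Proof.
split=> [De|[ek De]]; last by exists (current k e) => //; rewrite (alive_state ek).
have ek := jump_in_alive De; split=> //.
by case: De => x Dx; rewrite (alive_state ek) => -[<-].
Qed.

Lemma stay_alive k e t : stay k e t -> alive k e.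
Proof.
by rewrite /stay /alive/= -jump_time_lty => /andP[/lt_trans + _]; apply; exact: ltry.
Qed.

Lemma measurable_discount beta k : measurable_fun setT (discount beta k : Om -> R).
Proof.
apply: measurableT_comp => //; apply: measurableT_comp => //.
apply: measurable_funM => //; apply: measurableT_comp => //.
exact: measurable_jump_time.
Qed.

Lemma discount_ge0 beta k e : (0 <= discount beta k e)%R.
Proof. exact: expR_ge0. Qed.

(** Discounted visits: the law of the k-th state, on the event that the
    initial state is in [B0]. *)
Lemma visit_measure_exists (B0 : set (borel S)) (beta : R) k : measurable B0 ->
  exists N : {measure set (borel S) -> \bar R},
    forall f, (forall x, 0 <= f x) -> measurable_fun setT f ->
      \int[N]_x f x = \int[P]_e
        ((\1_(jump_in 0 B0 `&` alive k) e * discount beta k e)%:E * f (current k e)).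
Proof.
move=> mB0.
have mE : measurable (jump_in 0 B0 `&` alive k).
  by apply: measurableI; [exact: measurable_jump_in|exact: measurable_alive].
have mg : measurable_fun setT
    (fun e : Om => \1_(jump_in 0 B0 `&` alive k) e * discount beta k e)%R.
  by apply: measurable_funM; [exact: measurable_indic|exact: measurable_discount].
exact: (weighted_law_exists P (fun e => mulr_ge0 (ler0n _ _) (discount_ge0 beta k e)) mg
  (@measurable_current k)).
Qed.

Lemma measurable_pi_integral2 k (f : borel S * borel A -> \bar R) :
  measurable_fun setT f -> (forall z, 0 <= f z) ->
  measurable_fun setT (fun z : Om * measurableTypeR R =>
    \int[pi z]_b f (current k z.1, action b)).
Proof.
move=> mf f0.
apply: (@measurable_fun_integral_probability _ _ (Om * measurableTypeR R)%type _ _ pi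
  mpi pi_T (fun zb => f (current k zb.1.1, action zb.2))) => //.
apply: (measurableT_comp mf); apply: measurable_fun_pair.
  apply: (measurableT_comp (@measurable_current k)).
  exact: (measurableT_comp measurable_fst measurable_fst).
exact: (measurableT_comp measurable_action measurable_snd).
Qed.

Lemma measurable_stay2 k :
  measurable [set z : Om * measurableTypeR R | stay k z.1 z.2].
Proof.
rewrite (_ : mkset _ = [set z : Om * measurableTypeR R | jump_time z.1 k < z.2%:E] `&`
    [set z | z.2%:E < jump_time z.1 k.+1]); last first.
  by apply/seteqP; split=> t; rewrite /stay/= => /andP.
have mT j := @measurable_jump_time2 R S j.
have m2 := @measurable_time2 R S.
by apply: measurableI; exact: emeasurable_set_lt.
Qed.

(** Discounted sojourns: the law of the k-th state and of the action applied
    during its sojourn. *)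
Lemma stay_measure_exists (B0 : set (borel S)) (beta : R) k : measurable B0 ->
  exists M : {measure set (borel S * borel A) -> \bar R},
    forall f, (forall z, 0 <= f z) -> measurable_fun setT f ->
      \int[M]_z f z = \int[P]_e ((\1_(jump_in 0 B0) e)%:E *
        \int[lambda]_t ((\1_(stay k e) t * expR (- (beta * t)))%:E *
          \int[pi (e, t)]_b f (current k e, action b))).
Proof.
move=> mB0.
pose g (z : Om * measurableTypeR R) : R :=
  (\1_(jump_in 0 B0) z.1 * (\1_(stay k z.1) z.2 * expR (- (beta * z.2))))%R.
have g0 z : (0 <= g z)%R by rewrite mulr_ge0// mulr_ge0// expR_ge0.
have mg : measurable_fun setT g.
  apply: measurable_funM.
    apply: measurableT_comp; last exact: measurable_fst.
    by apply: measurable_indic; exact: measurable_jump_in.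
  apply: measurable_funM.
    rewrite (_ : (fun z => _) = \1_[set z : Om * measurableTypeR R | stay k z.1 z.2]).
      by apply: measurable_indic; exact: measurable_stay2.
    by apply/funext => z; rewrite !indicE; congr (_%:R); apply/idP/idP; rewrite !inE.
  apply: measurableT_comp => //; apply: measurableT_comp => //.
  by apply: measurable_funM => //; exact: measurable_snd.
pose h (zb : (Om * measurableTypeR R) * option (borel A)) := (current k zb.1.1, action zb.2).
have mh : measurable_fun setT h.
  apply: measurable_fun_pair.
    apply: (measurableT_comp (@measurable_current k)).
    exact: (measurableT_comp measurable_fst measurable_fst).
  exact: (measurableT_comp measurable_action measurable_snd).
have [M Mint] := @mixed_law_exists _ _ _ (Om * measurableTypeR R)%type _ _ _
  (P \x lambda) g pi h g0 mg mpi pi_T mh.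
exists M => f f0 mf; rewrite Mint//.
have mgf : measurable_fun setT (fun z => (g z)%:E * \int[pi z]_b f (h (z, b))).
  apply: emeasurable_funM; first exact/measurable_EFinP.
  exact: measurable_pi_integral2.
have gf0 z : 0 <= (g z)%:E * \int[pi z]_b f (h (z, b)).
  by rewrite mule_ge0 ?integral_ge0// lee_fin.
rewrite (fubini_tonelli1 _ mgf gf0); apply: eq_integral => e _.
rewrite /fubini_F indicE; have [e0|e0] := boolP (e \in jump_in 0 B0).
  rewrite mul1e; apply: eq_integral => t _.
  by rewrite /g indicE e0 mul1r.
rewrite mul0e integral0_eq// => t _.
by rewrite /g indicE (negbTE e0) mul0r mul0e.
Qed.

(** The indicator of [alive k.+1] covers a sojourn that never ends, as the
    discount factor vanishes at infinity. *)
Lemma integral_stay_exp beta k e : (0 < beta)%R -> alive k e ->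
  \int[lambda]_t (\1_(stay k e) t * (beta * expR (- (beta * t))))%:E =
  (discount beta k e - \1_(alive k.+1) e * discount beta k.+1 e)%:E.
Proof.
move=> b0 ek; have Tk := jump_time_fineK ek.
have T0 : (0 <= fine (jump_time e k))%R by rewrite fine_ge0// jump_time_ge0.
rewrite [LHS](_ : _ = \int[lambda]_(t in stay k e) (beta * expR (- (beta * t)))%:E); last first.
  rewrite [RHS]integral_mkcond; apply: eq_integral => t _.
  by rewrite patchE indicE; case: ifPn => _; rewrite ?mul1r ?mul0r.
rewrite indicE; have [ek1|ek1] := boolP (e \in alive k.+1).
  rewrite inE in ek1; have Tk1 := jump_time_fineK ek1.
  rewrite (_ : stay k e = `](fine (jump_time e k)), (fine (jump_time e k.+1))[%classic).
    rewrite integral_exp_oo ?mul1r// -lee_fin Tk Tk1; exact: nd_jump_time.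
  apply/seteqP; split=> t; rewrite /stay/= in_itv/= -Tk -Tk1 !lte_fin//.
have Tk1 : jump_time e k.+1 = +oo.
  by apply/eqP; rewrite -state_None; apply/negPn/negP; move: ek1; rewrite notin_setE.
rewrite mul0r subr0 (_ : stay k e = `](fine (jump_time e k)), +oo[%classic).
  exact: integral_exp_oy.
by apply/seteqP; split=> t; rewrite /stay/= in_itv/= -Tk Tk1 lte_fin ltry.
Qed.

Lemma stay_current k e t : stay k e t ->
  (0 <= t)%R /\ xi_left e t = Some (current k e).
Proof.
move=> st; have ek := stay_alive st; have /andP[t1 t2] := st.
split; first by rewrite -lee_fin ltW// (le_lt_trans (jump_time_ge0 e k)).
by rewrite (@xi_leftE _ _ e k) ?(alive_state ek)// t1 ltW.
Qed.

(** The first relation is [jump_balance] for jumps from anywhere into [D]. The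
    second one adds [integral_stay_exp] on visits to [D] and [jump_balance] for
    jumps from [D] to anywhere. *)
Lemma occupation_recursion (B0 : set (borel S)) (beta : R) :
  measurable B0 -> (0 < beta)%R ->
  exists N : nat -> {measure set (borel S) -> \bar R},
  exists M : nat -> {measure set (borel S * borel A) -> \bar R},
  [/\ forall k f, (forall x, 0 <= f x) -> measurable_fun setT f ->
        \int[N k]_x f x = \int[P]_e
          ((\1_(jump_in 0 B0 `&` alive k) e * discount beta k e)%:E * f (current k e)),
      forall k f, (forall z, 0 <= f z) -> measurable_fun setT f ->
        \int[M k]_z f z = \int[P]_e ((\1_(jump_in 0 B0) e)%:E *
          \int[lambda]_t ((\1_(stay k e) t * expR (- (beta * t)))%:E *
            \int[pi (e, t)]_b f (current k e, action b))),
      forall k, M k (~` graph adm) = 0,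
      forall k D, measurable D -> N k.+1 D = \int[M k]_z Q z D
    & forall k D, measurable D -> N k D = beta%:E * M k (D `*` setT) +
        \int[M k]_z ((\1_D z.1)%:E * Q z setT)].
Proof.
move=> mB0 b0.
have /choice[N NE] := fun k => @visit_measure_exists B0 beta k mB0.
have /choice[M ME] := fun k => @stay_measure_exists B0 beta k mB0.
exists N, M; split=> //.
- move=> k; have mg := measurableC (graph_measurable model).
  rewrite (measure_integral_indic (M k) mg) ME//; last first.
    exact: emeasurable_indic.
  apply: integral0_eq => e _; rewrite integral0_eq ?mule0// => t _.
  rewrite indicE; have [st|st] := boolP (t \in stay k e); last by rewrite mul0r mul0e.
  rewrite inE in st; have [t0 xt] := stay_current st.
  rewrite -(integral_pi_adm t0 xt) ?integral0_eq ?mule0//; last first.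
    apply/measurable_EFinP; apply: measurableT_comp; first exact: measurable_indic.
    by apply: measurable_fun_pair => //; exact: measurable_action.
  by move=> _ [a xa <-]; rewrite indicE memNset//= /action/= => /(_ xa).
- move=> k D mD; rewrite (measure_integral_indic (N k.+1) mD) NE//; last first.
    exact: emeasurable_indic.
  rewrite ME//; last exact: mQ.
  transitivity (\int[P]_e ((\1_(jump_in 0 B0 `&` jump_in k setT `&` jump_in k.+1 D) e *
     discount beta k.+1 e)%:E)).
    apply: eq_integral => e _; rewrite -EFinM mulrAC; congr (_ * _)%:E.
    rewrite !indicE -natrM mulnb; congr (_%:R); congr nat_of_bool.
    apply/andP/idP; rewrite !inE.
      move=> [[h0 ek1] Dk]; split; last exact/jump_inE.
      by split=> //; rewrite jump_in_T; exact: aliveS.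
    by move=> [[h0 _] /jump_inE[ek1 Dk]].
  rewrite (@jump_balance k B0 setT D beta mB0 measurableT mD).
  apply: eq_integral => e _; rewrite jump_in_T; have [ek|ek] := boolP (e \in alive k).
    by rewrite !indicE in_setI ek andbT.
  rewrite [in LHS]indicE in_setI (negbTE ek) andbF mul0e.
  rewrite integral0_eq ?mule0// => t _; rewrite indicE memNset ?mul0r ?mul0e//.
  by move/stay_alive; move/negP: ek; rewrite inE.
- move=> k D mD.
  have mQD : measurable_fun setT (fun z : borel S * borel A => (\1_D z.1)%:E * Q z setT).
    apply: emeasurable_funM; last exact: mQ.
    by apply/measurable_EFinP; apply: measurableT_comp.
  have mDT : measurable (D `*` setT : set (borel S * borel A)) by exact: measurableX.
  have mD1 : measurable_fun setT
      (fun z : borel S * borel A => (\1_(D `*` setT) z)%:E : \bar R).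
    exact: emeasurable_indic.
  have -> : beta%:E * M k (D `*` setT) =
      \int[M k]_z (beta%:E * (\1_(D `*` setT) z)%:E).
    by rewrite ge0_integralZl_EFin//; [rewrite -measure_integral_indic|exact: ltW].
  rewrite (ME k _ _ mQD); last by move=> z; rewrite mule_ge0// lee_fin.
  rewrite (ME k (fun z => beta%:E * (\1_(D `*` setT) z)%:E)); last 2 first.
  - by move=> z; rewrite mule_ge0// lee_fin ltW.
  - exact: measurable_funeM.
  have IQ : \int[P]_e ((\1_(jump_in 0 B0) e)%:E *
      \int[lambda]_t ((\1_(stay k e) t * expR (- (beta * t)))%:E *
        \int[pi (e, t)]_b ((\1_D (current k e, action b).1)%:E * Q (current k e, action b) setT))) =
      \int[P]_e ((\1_(jump_in 0 B0 `&` jump_in k D `&` jump_in k.+1 setT) e *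
     discount beta k.+1 e)%:E).
    rewrite (@jump_balance k B0 D setT beta mB0 mD measurableT).
    apply: eq_integral => e _ /=.
    have [De|De] := pselect (D (current k e)).
      under eq_integral do under eq_integral do rewrite indicE mem_set// mul1e.
      have [ek|ek] := boolP (e \in alive k).
        congr (_%:E * _); rewrite !indicE; congr (_%:R); congr nat_of_bool.
        apply/idP/idP; rewrite !inE; last by case.
        by rewrite inE in ek; split=> //; exact/jump_inE.
      rewrite [\int[lambda]_t _]integral0_eq ?mule0// => t _.
      rewrite indicE memNset ?mul0r ?mul0e//.
      by move/stay_alive; move/negP: ek; rewrite inE.
    rewrite integral0_eq; last first.
      move=> t _; rewrite [\int[_]_b _]integral0_eq ?mule0// => b _.
      by rewrite indicE memNset// mul0e.
    by rewrite mule0 indicE memNset ?mul0e// => -[_ /jump_inE[]].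
  rewrite IQ.
  have mpos d (T : measurableType d) (g : T -> R) : measurable_fun setT g ->
    measurable_fun setT (fun x => (g x)%:E) by move=> ?; exact/measurable_EFinP.
  rewrite (measure_integral_indic (N k) mD) NE//; last exact/mpos/measurable_indic.
  have IM : \int[P]_e ((\1_(jump_in 0 B0) e)%:E *
      \int[lambda]_t ((\1_(stay k e) t * expR (- (beta * t)))%:E *
        \int[pi (e, t)]_b (beta%:E * (\1_(D `*` setT) (current k e, action b))%:E))) =
      \int[P]_e (\1_(jump_in 0 B0 `&` jump_in k D) e *
        (discount beta k e - \1_(alive k.+1) e * discount beta k.+1 e))%:E.
    apply: eq_integral => e _.
    have [De|De] := pselect (jump_in k D e).
      have /jump_inE[ek Dk] := De.
      have -> : (\1_(jump_in 0 B0 `&` jump_in k D) e = \1_(jump_in 0 B0) e :> R)%R.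
        by rewrite !indicE in_setI [X in _ && X]mem_set ?andbT.
      rewrite EFinM -(integral_stay_exp b0 ek); congr (_ * _).
      apply: eq_integral => t _.
      under eq_integral do rewrite indicE mem_set// mule1.
      by rewrite integral_cst// pi_T mule1 -EFinM -mulrA; congr (_ * _)%:E; rewrite mulrC.
    rewrite integral0_eq; last first.
      move=> t _; have [st|st] := pselect (stay k e t); last first.
        by rewrite indicE memNset// mul0r mul0e.
      rewrite [\int[_]_b _]integral0_eq ?mule0// => b _.
      rewrite indicE memNset ?mule0//= => -[Dk _]; apply: De; apply/jump_inE.
      by split=> //; exact: stay_alive st.
    by rewrite mule0 indicE memNset ?mul0r// => -[].
  have mI (E : set Om) : measurable E -> measurable_fun setT (\1_E : Om -> R).
    by move=> mE; exact: measurable_indic.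
  have m0D := measurableI _ _ (measurable_jump_in 0 mB0) (measurable_jump_in k mD).
  have dle e : alive k e ->
      (0 <= discount beta k e - \1_(alive k.+1) e * discount beta k.+1 e)%R.
    move=> ek; rewrite -lee_fin -(integral_stay_exp b0 ek).
    by apply: integral_ge0 => t _; rewrite lee_fin !mulr_ge0// ?expR_ge0// ltW.
  rewrite IM -ge0_integralD//; last 4 first.
  - move=> e _; rewrite lee_fin indicE; have [eD|eD] := boolP (e \in _); last by rewrite mul0r.
    by rewrite mul1r dle//; move: eD; rewrite inE => -[_ /jump_in_alive].
  - apply/measurable_EFinP; apply: measurable_funM; first exact: mI.
    apply: measurable_funB; first exact: measurable_discount.
    by apply: measurable_funM; [by apply: mI; exact: measurable_alive|exact: measurable_discount].
  - by move=> e _; rewrite lee_fin mulr_ge0// discount_ge0.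
  - apply/measurable_EFinP; apply: measurable_funM; last exact: measurable_discount.
    by apply: mI; apply: measurableI => //; exact: measurable_jump_in.
  apply: eq_integral => e _; rewrite -EFinM -EFinD; congr EFin.
  have -> : (\1_(jump_in 0 B0 `&` jump_in k D `&` jump_in k.+1 setT) e =
      \1_(jump_in 0 B0 `&` jump_in k D) e * \1_(alive k.+1) e :> R)%R.
    by rewrite jump_in_T indicI.
  rewrite -mulrA -mulrDr subrK mulrAC; congr (_ * _)%R.
  rewrite !indicE -natrM mulnb; congr (_%:R); congr nat_of_bool.
  apply/andP/idP; rewrite !inE.
    by move=> [[h0 ek] Dk]; split=> //; exact/jump_inE.
  by move=> [h0 /jump_inE[ek Dk]].
Qed.

(** * The occupation measure as a sum over sojourns *)

Let sojourning k (D : set (borel S)) : set (Om * measurableTypeR R) :=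
  [set z | jump_time z.1 k <= z.2%:E < jump_time z.1 k.+1 /\ jump_in k D z.1].

Let msojourning k D : measurable D -> measurable (sojourning k D).
Proof.
move=> mD.
have mJ j := @measurable_jump_time2 R S j.
have m2 := @measurable_time2 R S.
rewrite (_ : sojourning k D = ([set z | jump_time z.1 k <= z.2%:E] `&`
   [set z | z.2%:E < jump_time z.1 k.+1]) `&` (fst @^-1` jump_in k D)); last first.
  apply/seteqP; split=> z /=.
    by move=> [/andP[a b] c].
  by move=> [[a b] c]; split=> //; apply/andP.
apply: measurableI.
  by apply: measurableI; [exact: emeasurable_set_le|exact: emeasurable_set_lt].
rewrite -[X in measurable X]setTI; apply: measurable_fst => //.
exact: measurable_jump_in.
Qed.

Let occ k D G (z : Om * measurableTypeR R) : \bar R :=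
  (\1_(sojourning k D) z)%:E * pi z (Some @` G).

Let occ_ge0 k D G z : 0 <= occ k D G z.
Proof. by rewrite mule_ge0// lee_fin. Qed.

Let mocc k D G : measurable D -> measurable G -> measurable_fun setT (occ k D G).
Proof.
move=> mD mG; apply: emeasurable_funM.
  by apply: emeasurable_indic; exact: msojourning.
by apply: mpi; exact: measurable_image_Some.
Qed.

(** At any time exactly one sojourn is under way, or the path has exploded. *)
Let occ_series D G e (t : R) : (0 <= t)%R ->
  (\1_(Some @` D) (xi e t))%:E * pi (e, t) (Some @` G) =
  \sum_(0 <= k <oo) occ k D G (e, t).
Proof.
move=> t0.
have [[k tk]|/forallNP none] := pselect (exists k, jump_time e k <= t%:E < jump_time e k.+1).
  rewrite (@nneseriesD1 _ (fun k => occ k D G (e, t)) k)//.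
  rewrite eseries0 ?adde0; last first.
    move=> j _ /= jk; rewrite /occ indicE (_ : _ \in _ = false) ?mul0e//.
    apply/negP; rewrite inE => -[/= tj _].
    by move/eqP: jk; apply; exact: jump_interval_uniq_co tj tk.
  rewrite (xiE tk) /occ !indicE; congr (_%:R%:E * _); congr nat_of_bool.
  apply/idP/idP; rewrite !inE; first by split.
  by case.
rewrite xi_None// => [|k]; last exact/negP/none.
rewrite indicE memNset ?mul0e; last by case.
rewrite eseries0// => k _ _; rewrite /occ indicE memNset ?mul0e//.
by move=> [/= tk _]; exact: none tk.
Qed.

(** [action] maps the point at infinity to an arbitrary action, but that point
    carries no mass while the process is in [S]. *)
Let pi_action e t k G : measurable G -> stay k e t ->
  pi (e, t) (action @^-1` G) = pi (e, t) (Some @` G).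
Proof.
move=> mG st; have [t0 xt] := stay_current st.
have mSG := measurable_image_Some mG.
have maG : measurable (action @^-1` G).
  by rewrite -[X in measurable X]setTI; apply: measurable_action.
have N0 : pi (e, t) [set None] = 0.
  apply/eqP; rewrite eq_le measure_ge0 andbT -(pi_adm_ae t0 xt).
  apply: le_measure; rewrite ?inE.
  - exact: measurable_set_None.
  - by apply: measurableC; exact: measurable_adm_Some.
  - by move=> _ -> [].
apply/eqP; rewrite eq_le; apply/andP; split.
  apply: (@le_trans _ _ (pi (e, t) (Some @` G `|` [set None]))).
    apply: le_measure; rewrite ?inE//.
      by apply: measurableU => //; exact: measurable_set_None.
    by move=> [a|] /= Ga; [left; exists a|right].
  apply: (le_trans (measureU2 _ mSG (@measurable_set_None _ _))).
  by rewrite [X in _ + X]N0 adde0.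
by apply: le_measure; rewrite ?inE// => _ [a Ga <-].
Qed.

(** The sojourn includes its left end point and [stay] does not; a point is a
    null set. *)
Let occ_stay k D G e (alpha : R) : measurable D -> measurable G ->
  \int[lambda]_t ((\1_`[0%R, +oo[ t * expR (- (alpha * t)))%:E * occ k D G (e, t)) =
  \int[lambda]_t ((\1_(stay k e) t * expR (- (alpha * t)))%:E *
     \int[pi (e, t)]_b (\1_(D `*` G) (current k e, action b))%:E).
Proof.
move=> mD mG.
have mexp : measurable_fun setT (fun t : measurableTypeR R => expR (- (alpha * t))%R).
  by apply: measurableT_comp => //; apply: measurableT_comp => //; exact: measurable_funM.
have mDG : measurable_fun setT (fun z : borel S * borel A => (\1_(D `*` G) z)%:E : \bar R).
  by apply: emeasurable_indic; exact: measurableX.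
apply: ge0_ae_eq_integral => //.
- apply: emeasurable_funM.
    by apply/measurable_EFinP; apply: measurable_funM.
  by apply: (measurableT_comp (mocc k mD mG)); exact: measurable_pair1.
- apply: emeasurable_funM.
    apply/measurable_EFinP; apply: measurable_funM => //.
    by apply: measurable_indic; exact: measurable_stay.
  exact: (measurable_pi_integral k e mDG).
- by move=> t _; rewrite mule_ge0// lee_fin mulr_ge0// expR_ge0.
- move=> t _; apply: mule_ge0; first by rewrite lee_fin mulr_ge0// expR_ge0.
  by apply: integral_ge0 => b _; rewrite lee_fin.
have : lambda [set fine (jump_time e k)] = 0 by rewrite lebesgue_measure_set1.
move=> l0; exists [set fine (jump_time e k)]; split=> //.
move=> t /=; apply: contra_notP => tk _.
have stE : (jump_time e k <= t%:E < jump_time e k.+1) <-> stay k e t.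
  split=> [/andP[a b]|/andP[a b]]; last by apply/andP; split=> //; exact: ltW.
  apply/andP; split=> //; rewrite lt_neqAle a andbT; apply/eqP => h.
  by apply: tk; rewrite h.
have [st|st] := pselect (stay k e t); last first.
  rewrite [\1_(stay k e) t]indicE memNset// mul0r mul0e.
  rewrite /occ [\1_(sojourning k D) _]indicE memNset ?mul0e ?mule0//.
  by move=> [/stE].
have [t0 xt] := stay_current st.
rewrite !indicE (mem_set st) mem_set ?mul1r; last by rewrite /= in_itv/= t0.
congr (_ * _); have ek := stay_alive st.
rewrite /occ; have [De|De] := pselect (D (current k e)).
  rewrite [\1_(sojourning k D) _]indicE mem_set ?mul1e; last first.
    by split; [exact/stE|exact/jump_inE].
  rewrite -(pi_action mG st) measure_integral_indic; last first.
    by rewrite -[X in measurable X]setTI; apply: measurable_action.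
  apply: eq_integral => b _; rewrite !indicE; congr (_%:R%:E); congr nat_of_bool.
  by apply/idP/idP; rewrite !inE /=; [split|case].
rewrite [\1_(sojourning k D) _]indicE memNset ?mul0e; last by move=> [_ /jump_inE[]].
by rewrite integral0_eq// => b _; rewrite indicE memNset// => -[].
Qed.

Let occupation_term k D G (alpha : R) : measurable D -> measurable G ->
  \int[lambda]_(t in `[0%R, +oo[) ((expR (- (alpha * t)))%:E * \int[P]_e occ k D G (e, t)) =
  \int[P]_e \int[lambda]_t ((\1_(stay k e) t * expR (- (alpha * t)))%:E *
     \int[pi (e, t)]_b (\1_(D `*` G) (current k e, action b))%:E).
Proof.
move=> mD mG.
pose f (z : Om * measurableTypeR R) : \bar R :=
  (\1_`[0%R, +oo[ z.2 * expR (- (alpha * z.2)))%:E * occ k D G z.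
have mf : measurable_fun setT f.
  apply: emeasurable_funM; last exact: mocc.
  apply/measurable_EFinP; apply: measurable_funM.
    by apply: (measurableT_comp (measurable_indic _)) => //; exact: measurable_snd.
  apply: measurableT_comp => //; apply: measurableT_comp => //.
  by apply: measurable_funM => //; exact: measurable_snd.
have f0 z : 0 <= f z by rewrite mule_ge0// lee_fin mulr_ge0// expR_ge0.
have moccP t : measurable_fun setT (fun e : Om => occ k D G (e, t)).
  by apply: (measurableT_comp (mocc k mD mG)); exact: measurable_pair2.
transitivity (\int[lambda]_t \int[P]_e f (e, t)); last first.
  rewrite -(@fubini_tonelli _ _ _ _ _ P lambda f mf f0); apply: eq_integral => e _.
  exact: occ_stay.
rewrite integral_mkcond; apply: eq_integral => t _.
rewrite patchE /f /= ge0_integralZl_EFin//.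
by rewrite indicE; case: (_ \in _); rewrite ?mul1r// mul0r mul0e.
Qed.

(** The time integral of the occupation measure is cut at the jump times, and
    expectation and time integral are exchanged on each piece. *)
Lemma occupation_series (alpha : R) (M : nat -> {measure set (borel S * borel A) -> \bar R}) :
  (forall k f, (forall z, 0 <= f z) -> measurable_fun setT f ->
     \int[M k]_z f z = \int[P]_e ((\1_(jump_in 0 setT) e)%:E *
       \int[lambda]_t ((\1_(stay k e) t * expR (- (alpha * t)))%:E *
         \int[pi (e, t)]_b f (current k e, action b)))) ->
  forall D G, measurable D -> measurable G ->
  mseries M 0 (D `*` G) =
    \int[lambda]_(t in `[0%R, +oo[) ((expR (- (alpha * t)))%:E *
       \int[P]_e ((\1_(Some @` D) (xi e t))%:E * pi (e, t) (Some @` G))).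
Proof.
move=> ME D G mD mG.
have moccP k t : measurable_fun setT (fun e : Om => occ k D G (e, t)).
  by apply: (measurableT_comp (mocc k mD mG)); exact: measurable_pair2.
have i0 k t : 0 <= \int[P]_e occ k D G (e, t) by apply: integral_ge0 => e _.
transitivity (\int[lambda]_(t in `[0%R, +oo[)
    \sum_(0 <= k <oo) ((expR (- (alpha * t)))%:E * \int[P]_e occ k D G (e, t))).
  rewrite integral_nneseries//; last 2 first.
  - move=> k; apply: measurable_funTS; apply: emeasurable_funM.
      by apply/measurable_EFinP; apply: measurableT_comp => //; apply: measurableT_comp.
    by have := @measurable_fun_fubini_tonelli_G _ _ _ _ _ P (occ k D G)
      (mocc k mD mG) (occ_ge0 k D G).
  - by move=> k t _; rewrite mule_ge0// lee_fin expR_ge0.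
  rewrite /mseries; apply: eq_eseriesr => k _.
  rewrite occupation_term// measure_integral_indic; last exact: measurableX.
  rewrite ME//; last first.
    by apply: emeasurable_indic; exact: measurableX.
  apply: eq_integral => e _; rewrite indicE mem_set ?mul1e//.
  by rewrite jump_in_T; exact: state0_neq_None.
apply: eq_integral => t; rewrite inE /= in_itv/= andbT => t0.
rewrite nneseriesZl//; congr (_ * _); rewrite -integral_nneseries//.
by apply: eq_integral => e _; rewrite occ_series.
Qed.

(** * Nonexplosion *)

Section nonexplosion_discounted.
Variables (w : S -> R) (c : R).
Hypotheses (mw : measurable_fun setT (w : borel S -> R)) (w_ge1 : forall x, (1 <= w x)%R).
Hypothesis drift : forall z, graph adm z ->
  \int[Q z]_x (w x)%:E <= (c * w z.1)%:E + Q z setT * (w z.1)%:E.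
Hypothesis bounded : forall r : R, exists C : R, forall z, graph adm z ->
  (w z.1 <= r)%R -> Q z setT <= C%:E.
Hypothesis Q_fin : forall z, Q z setT \is a fin_num.

Let low (r : R) : set (borel S) := [set x | (w x <= r)%R].

Let mlow r : measurable (low r).
Proof.
have mwE : measurable_fun setT (fun x : borel S => (w x)%:E) by exact/measurable_EFinP.
exact: emeasurable_set_le mwE (measurable_cst r%:E).
Qed.

Let high_small (delta : R) : (0 < delta)%R ->
  exists j : nat, P (jump_in 0 (~` low j%:R)) < delta%:E.
Proof.
move=> delta0; pose F (j : nat) := jump_in 0 (~` low j%:R).
have mF j : measurable (F j) by apply: measurable_jump_in; exact: measurableC.
have F0 : \bigcap_j F j = set0.
  apply/seteqP; split=> // e Fe.
  pose j := (Num.truncn (w (current 0 e))).+1.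
  by have /jump_inE[_] := Fe j I; apply; rewrite /low/= ltW// truncnS_gt.
have mcap : measurable (\bigcap_j F j) by rewrite F0.
have Ffin : P (F 0%N) < +oo by rewrite (le_lt_trans (probability_le1 P (mF 0%N)))// ltry.
have ni : nonincreasing_seq F.
  move=> i j ij; apply/subsetPset => e /jump_inE[e0 h].
  apply/jump_inE; split=> // h'; apply: h; apply: (le_trans h').
  by rewrite ler_nat.
have := nonincreasing_cvg_mu Ffin mF mcap ni; rewrite F0 measure0 => h.
have /fine_cvgP[hfin hcvg] := h.
have /cvgrPdist_lt /(_ delta delta0) := hcvg.
move=> hnear; near \oo => j; exists j.
have : P (F j) \is a fin_num by near: j.
move=> fj; rewrite -(fineK fj) lte_fin.
have : (`|0 - fine (P (F j))| < delta)%R by near: j.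
by rewrite sub0r normrN ger0_norm// fine_ge0.
Unshelve. all: end_near. Qed.

(** The drift condition bounds the growth of [w] at the rate [c], and so it
    controls discount rates above [c] only. A power of the discount factor
    [y = discount alpha k e] is a discount factor for a multiple of [alpha], and
    [y <= eps + y ^+ p / eps ^+ p]. *)
Lemma visits_vanish (alpha delta : R) : (0 < alpha)%R -> (0 < delta)%R ->
  exists k, \int[P]_e (\1_(alive k) e * discount alpha k e)%:E < delta%:E.
Proof.
move=> alpha0 delta0.
have [j Pj] := high_small (divr_gt0 delta0 (ltr0n R 2)).
pose p := (Num.truncn (Num.max c 0 / alpha)%R).+1.
pose beta := (p%:R * alpha)%R.
have beta0 : (0 < beta)%R by rewrite mulr_gt0// ltr0n.
have cbeta : (c <= beta)%R.
  apply: (@le_trans _ _ (Num.max c 0)%R); first by rewrite le_max lexx.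
  by rewrite -ler_pdivrMr// ltW// truncnS_gt.
have [N [M [NE ME MK next split]]] := occupation_recursion (mlow j%:R) beta0.
pose eps := (delta / 4)%R.
have eps0 : (0 < eps)%R by rewrite divr_gt0.
have w_N0 : \int[N 0%N]_x (w x)%:E < +oo.
  rewrite NE; last 2 first.
  - by move=> x; rewrite lee_fin (le_trans _ (w_ge1 x)).
  - exact/measurable_EFinP.
  apply: (@le_lt_trans _ _ (\int[P]_e (cst j%:R%:E e))).
    apply: ge0_le_integral => //.
    - by move=> e _; rewrite mule_ge0// lee_fin ?mulr_ge0// ?discount_ge0// (le_trans _ (w_ge1 _)).
    - apply: emeasurable_funM; apply/measurable_EFinP; last first.
        by apply: (measurableT_comp mw); exact: measurable_current.
      apply: measurable_funM; last exact: measurable_discount.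
      by apply: measurable_indic; apply: measurableI;
        [exact: measurable_jump_in|exact: measurable_alive].
    - move=> e _; rewrite /cst -EFinM lee_fin indicE.
      have [/set_mem[/jump_inE[_ we] _]|_] := boolP (e \in _); last by rewrite !mul0r.
      by rewrite mul1r /discount jump_time0 mulr0 oppr0 expR0 mul1r.
  rewrite integral_cst//.
  by rewrite [X in _ * X](@probability_setT _ _ _ P) mule1 ltry.
have delta4 : (0 < eps ^+ p * eps)%R by rewrite mulr_gt0// exprn_gt0.
have [k Nk] := weighted_visits_vanish (graph_measurable model) beta0 mQ Q_fin MK next split mw w_ge1
  cbeta drift bounded w_N0 delta4.
have mlowk : measurable (jump_in 0 (low j%:R) `&` alive k).
  by apply: measurableI; [exact: measurable_jump_in|exact: measurable_alive].
have mhigh : measurable (jump_in 0 (~` low j%:R)).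
  by apply: measurable_jump_in; exact: measurableC.
have mdisc b : measurable_fun setT
    (fun e : Om => \1_(jump_in 0 (low j%:R) `&` alive k) e * discount b k e)%R.
  by apply: measurable_funM; [exact: measurable_indic|exact: measurable_discount].
have NkT : N k setT =
    \int[P]_e (\1_(jump_in 0 (low j%:R) `&` alive k) e * discount beta k e)%:E.
  rewrite -[LHS]mul1e -integral_cst// NE//.
  by apply: eq_integral => e _; rewrite mule1.
(* Either the initial state is high, or the discount factor is at most [eps],
   or its p-th power is at least [eps ^+ p]. *)
have bound e : (\1_(alive k) e * discount alpha k e <=
    \1_(jump_in 0 (~` low j%:R)) e + eps +
    (eps ^+ p)^-1 * (\1_(jump_in 0 (low j%:R) `&` alive k) e * discount beta k e))%R.
  have discE : discount beta k e = (discount alpha k e ^+ p)%R.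
    by rewrite /discount -expRM_natl mulrN mulrA.
  have disc1 : (discount alpha k e <= 1)%R.
    by rewrite -[leRHS]expR0 ler_expR oppr_le0 mulr_ge0 ?fine_ge0 ?jump_time_ge0// ltW.
  have disc0 := discount_ge0 alpha k e.
  have pos : (0 <= (eps ^+ p)^-1 * (\1_(jump_in 0 (low j%:R) `&` alive k) e *
      discount beta k e))%R.
    by rewrite mulr_ge0 ?invr_ge0 ?exprn_ge0 ?mulr_ge0 ?discount_ge0// ltW.
  have eps0' := ltW eps0.
  have [ek|ek] := boolP (e \in alive k); last first.
    by rewrite [\1_(alive k) e]indicE (negbTE ek) mul0r addr_ge0// addr_ge0.
  rewrite [\1_(alive k) e]indicE ek mul1r.
  have [eh|eh] := boolP (e \in jump_in 0 (~` low j%:R)).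
    rewrite [\1_(jump_in 0 (~` _)) e]indicE eh.
    by apply: (le_trans disc1); rewrite -addrA lerDl addr_ge0.
  rewrite [\1_(jump_in 0 (~` _)) e]indicE (negbTE eh) add0r.
  have el : e \in jump_in 0 (low j%:R) `&` alive k.
    rewrite inE; split; last by rewrite inE in ek.
    have e0 : alive 0 e by exact: state0_neq_None.
    apply/jump_inE; split=> //; apply: contrapT => h.
    by move/negP: eh; apply; rewrite inE; apply/jump_inE.
  rewrite indicE el mul1r discE.
  have [le|lt] := leP (discount alpha k e) eps.
    by apply: (le_trans le); rewrite lerDl mulr_ge0// ?invr_ge0 exprn_ge0.
  apply: (le_trans disc1); rewrite ler_wpDl//.
  rewrite mulrC ler_pdivlMr ?exprn_gt0// mul1r.
  by apply: lerXn2r => //; rewrite ?nnegrE// ltW.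
exists k; apply: (@le_lt_trans _ _ (P (jump_in 0 (~` low j%:R)) + eps%:E +
   ((eps ^+ p)^-1)%:E * N k setT)).
  rewrite NkT -ge0_integralZl_EFin//; last 3 first.
  - by move=> e _; rewrite lee_fin mulr_ge0 ?discount_ge0.
  - exact/measurable_EFinP.
  - by rewrite invr_ge0 exprn_ge0// ltW.
  have -> : P (jump_in 0 (~` low j%:R)) + eps%:E =
      \int[P]_e (\1_(jump_in 0 (~` low j%:R)) e + eps)%:E.
    under [RHS]eq_integral do rewrite EFinD.
    rewrite ge0_integralD//; last 2 first.
    - exact: emeasurable_indic.
    - by move=> e _; rewrite lee_fin ltW.
    by rewrite integral_indic// setIT integral_cst// [X in _ * X](@probability_setT _ _ _ P) mule1.
  rewrite -ge0_integralD//; last 4 first.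
  - by move=> e _; rewrite lee_fin addr_ge0// ltW.
  - apply/measurable_EFinP; apply: measurable_funD; last exact: measurable_cst.
    exact: measurable_indic.
  - move=> e _; apply: mule_ge0; rewrite lee_fin.
      by rewrite invr_ge0 exprn_ge0// ltW.
    by rewrite mulr_ge0 ?discount_ge0.
  - by apply: measurable_funeM; exact/measurable_EFinP.
  apply: ge0_le_integral => //.
  - by move=> e _; rewrite lee_fin mulr_ge0 ?discount_ge0.
  - apply/measurable_EFinP; apply: measurable_funM; last exact: measurable_discount.
    by apply: measurable_indic; exact: measurable_alive.
  - apply: emeasurable_funD; last by apply: measurable_funeM; exact/measurable_EFinP.
    apply/measurable_EFinP; apply: measurable_funD; last exact: measurable_cst.
    exact: measurable_indic.
  - by move=> e _; rewrite -EFinM -EFinD lee_fin.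
have -> : delta%:E = (delta / 2)%:E + eps%:E + eps%:E.
  by rewrite -!EFinD; congr (_%:E); rewrite /eps; lra.
apply: lteD; first by apply: lte_leD => //; exact: fin_numE.
by rewrite muleC lte_pdivrMr ?exprn_gt0// -EFinM mulrC.
Qed.

(** All that the balance equation and its converse need to know about the
    process; [N] and [M] are the discounted visits and sojourns. *)
Definition occupation_decomposition (alpha : R) (gamma : probability (borel S) R)
    (N : nat -> {measure set (borel S) -> \bar R})
    (M : nat -> {measure set (borel S * borel A) -> \bar R}) : Prop :=
  [/\ (forall k f, (forall z, 0 <= f z) -> measurable_fun setT f ->
        \int[M k]_z f z = \int[P]_e
          \int[lambda]_t ((\1_(stay k e) t * expR (- (alpha * t)))%:E *
            \int[pi (e, t)]_b f (current k e, action b))) /\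
      (forall k, M k (~` graph adm) = 0),
      forall k D, measurable D -> N k.+1 D = \int[M k]_z Q z D,
      forall k D, measurable D -> N k D = alpha%:E * M k (D `*` setT) +
        \int[M k]_z ((\1_D z.1)%:E * Q z setT),
      N ^~ setT @ \oo --> 0 /\ (forall D, measurable D -> N 0%N D = gamma D)
    & exists2 eta : probability (borel S * borel A)%type R,
        forall E, eta E = alpha%:E * mseries M 0 E &
        is_occupation_measure adm (fun et => pi et) alpha P eta].

(** Nonexplosion enters through the limit of [N], and thereby through the total
    mass of the sojourns, which makes the occupation measure a probability. *)
Lemma occupation_decomposition_exists (alpha : R) (gamma : probability (borel S) R) :
  (0 < alpha)%R -> (forall D, measurable D -> P (jump_in 0 D) = gamma D) ->
  exists N M, occupation_decomposition alpha gamma N M.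
Proof.
move=> alpha0 P0.
have [N [M [NE ME MK next split]]] := occupation_recursion (@measurableT _ (borel S)) alpha0.
have alive0 : jump_in 0 setT = setT.
  by rewrite jump_in_T; apply/seteqP; split=> // e _; exact: state0_neq_None.
have NT k : N k setT = \int[P]_e (\1_(alive k) e * discount alpha k e)%:E.
  rewrite -[LHS]mul1e -integral_cst// NE//; apply: eq_integral => e _.
  by rewrite alive0 setTI mule1.
have Nni := visits_nonincreasing alpha0 next split.
have N_cvg0 : N ^~ setT @ \oo --> 0.
  have nd : {homo (fun k => N k setT) : m n / (m <= n)%N >-> n <= m}.
    by apply/nonincreasing_seqP.
  have := ereal_nonincreasing_cvgn nd; rewrite (_ : ereal_inf _ = 0)//.
  apply/eqP; rewrite eq_le; apply/andP; split; last first.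
    by apply: le_ereal_inf_tmp => _ [k _ <-].
  apply/lee_addgt0Pr => d d0; rewrite add0e.
  have [k kd] := visits_vanish alpha0 d0.
  by apply: (@le_trans _ _ (N k setT)); [apply: ereal_inf_lbound; exists k|rewrite NT ltW].
have N0 D : measurable D -> N 0%N D = gamma D.
  move=> mD; rewrite -P0// measure_integral_indic// NE//; last first.
    exact: emeasurable_indic.
  rewrite [RHS]measure_integral_indic; last exact: measurable_jump_in.
  apply: eq_integral => e _; rewrite alive0 setTI /discount jump_time0 mulr0 oppr0 expR0 mulr1.
  have e0 : alive 0 e by exact: state0_neq_None.
  rewrite [\1_(alive 0) e]indicE mem_set// mul1e !indicE; congr (_%:R%:E); congr nat_of_bool.
  apply/idP/idP; rewrite !inE; first by move=> De; apply/jump_inE.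
  by move=> /jump_inE[].
have mass := total_stay_mass alpha0 next split N_cvg0.
pose c0 := NngNum (ltW alpha0).
pose eta0 := mscale c0 (mseries M 0).
have eta0T : eta0 setT = 1.
  rewrite /eta0 /mscale/=; apply: etrans mass _; rewrite N0//; exact: probability_setT.
pose eta : probability (borel S * borel A)%type R :=
  HB.pack eta0 (Measure_isProbability.Build _ _ _ eta0 eta0T).
exists N, M; split=> //.
  split=> // k f f0 mf; rewrite ME//; apply: eq_integral => e _.
  by rewrite alive0 indicT mul1e.
have etaE E : eta E = alpha%:E * mseries M 0 E by [].
exists eta => //; split; last first.
  by move=> D G mD mG; rewrite etaE (occupation_series ME).
have h : mseries M 0 (~` graph adm) = 0.
  by rewrite /mseries; apply: eseries0 => k _ _; exact: MK.
by rewrite etaE h mule0.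
Qed.

End nonexplosion_discounted.

End jump_law.

(** * Conditional laws of the action given the state *)

Section stationary.
Context {R : realType} {S A : ptopologicalType}.
Variables (adm : S -> set A) (phi : R.-pker (borel S) ~> (borel A)).
Hypothesis phi_adm : is_stationary adm phi.
Local Notation Om := (Omega R S).

(** A stationary policy is a measurable function of the state just before the
    present, and [measurable_xi_left] makes it jointly measurable. *)
Lemma stationary_measure_exists :
  exists pi : Defs.path R S * R -> {measure set (option (borel A)) -> \bar R},
  [/\ (fun et => pi et : set (option (borel A)) -> \bar R) = stationary_policy phi,
      forall et, pi et setT = 1,
      forall (e : Defs.path R S) (t : R), (0 <= t)%R ->
        pi (e, t) (adm_infty adm (xi_left e t)) = 1
    & forall U, measurable U ->
        measurable_fun setT (fun z : Om * measurableTypeR R => pi z U)].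
Proof.
have mSome : measurable_fun setT (Some : borel A -> option (borel A)).
  by move=> _ B mB; rewrite setTI.
have /choice[pi piE] (et : Defs.path R S * R) :
    exists p : {measure set (option (borel A)) -> \bar R},
      forall G, p G = stationary_policy phi et G.
  rewrite /stationary_policy; case: (xi_left _ _) => [x|].
    by unshelve eexists (pushforward (phi x) Some : {measure set _ -> \bar R}).
  by exists [the measure _ _ of \d_None].
exists pi; split.
- by apply/funext => et; apply/funext => G; exact: piE.
- move=> et; rewrite piE /stationary_policy; case: (xi_left _ _) => [x|].
    by rewrite preimage_setT prob_kernel.
  by rewrite diracT.
- move=> e t _; rewrite piE /stationary_policy /=; case: (xi_left _ _) => [x|] /=.
    rewrite (_ : Some @^-1` _ = adm x) ?phi_adm//.
    by apply/seteqP; split=> a; [case=> b ba [<-]|exists a].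
  by rewrite diracE mem_set.
move=> U mU.
pose g (y : option (borel S)) : \bar R :=
  if y is Some x then phi x (Some @^-1` U) else \d_None U.
have mg : measurable_fun setT g.
  move=> _ B mB; rewrite setTI; apply: measurable_option.
  have := measurable_kernel phi _ (mU : measurable (Some @^-1` U)) measurableT _ mB.
  by rewrite setTI.
rewrite (_ : (fun z => _) = fun z : Om * measurableTypeR R => g (xi_left z.1 z.2)).
  exact: (measurableT_comp mg measurable_xi_left).
by apply/funext => z; rewrite piE.
Qed.

End stationary.

Section conditional_laws.
Context {R : realType} {S A : ptopologicalType}.
Variables (phi : R.-pker (borel S) ~> (borel A)).
Local Notation Om := (Omega R S).
Local Notation lambda := (@lebesgue_measure R).

Let mphi G : measurable G -> measurable_fun setT (phi ^~ G).
Proof. exact: measurable_kernel. Qed.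

Let mcond (f : borel S * borel A -> \bar R) : measurable_fun setT f -> (forall z, 0 <= f z) ->
  measurable_fun setT (fun x => \int[phi x]_a f (x, a)).
Proof.
apply: (@measurable_fun_integral_probability _ _ _ _ _ (fun x => phi x) mphi).
by move=> x; exact: prob_kernel.
Qed.

(** During a sojourn the action has the law [phi] at the current state,
    whatever the time. *)
Lemma stay_disintegrated (P : probability Om R) (alpha : R)
    (pi : Defs.path R S * R -> {measure set (option (borel A)) -> \bar R}) k
    (M : {measure set (borel S * borel A) -> \bar R}) :
  (fun et => pi et : set (option (borel A)) -> \bar R) = stationary_policy phi ->
  (forall f, (forall z, 0 <= f z) -> measurable_fun setT f ->
    \int[M]_z f z = \int[P]_e \int[lambda]_t
      ((\1_(stay k e) t * expR (- (alpha * t)))%:E *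
        \int[pi (e, t)]_b f (current k e, action b))) ->
  disintegrated_by (fun x => phi x) M.
Proof.
move=> piE ME f f0 mf; rewrite ME// ME; last 2 first.
- by move=> z; exact: integral_ge0.
- by have := measurableT_comp (mcond mf f0) (@measurable_fst _ _ (borel S) (borel A)).
apply: eq_integral => e _; apply: eq_integral => t _.
have [st|st] := pselect (stay k e t); last by rewrite indicE memNset// mul0r !mul0e.
have [t0 xt] := stay_current st.
congr (_ * _).
have pixt G : pi (e, t) G = phi (current k e) (Some @^-1` G).
  have := congr1 (fun p => p (e, t) G) piE.
  by rewrite /stationary_policy /= xt.
have mSome : measurable_fun setT (Some : borel A -> option (borel A)).
  by move=> _ B mB; rewrite setTI.
have red g : (forall z, 0 <= g z) -> measurable_fun setT g ->
    \int[pi (e, t)]_b g (current k e, action b) =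
    \int[phi (current k e)]_a g (current k e, a).
  move=> g0 mg.
  have ma : measurable_fun setT (fun b : option (borel A) => g (current k e, action b)).
    apply: (measurableT_comp mg); apply: measurable_fun_pair => //.
    exact: measurable_action.
  rewrite -(@eq_measure_integral _ _ _ _ (pi (e, t)) (pushforward (phi (current k e)) Some))//.
  by rewrite (ge0_integral_pushforward mSome).
rewrite red// (red (fun z => \int[phi z.1]_a f (z.1, a)))//=.
- by rewrite integral_cst//= prob_kernel mule1.
- by move=> z; exact: integral_ge0.
- by have := measurableT_comp (mcond mf f0) (@measurable_fst _ _ (borel S) (borel A)).
Qed.

(** From rectangles to functions, by comparing [eta] with the mixture of the
    laws [phi x] over its marginal. *)
Lemma disintegrates_disintegrated (eta : probability (borel S * borel A)%type R) :
  (forall (D : set (borel S)) (G : set (borel A)), measurable D -> measurable G ->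
    eta (D `*` G) = \int[marginal eta]_(x in D) phi x G) <->
  disintegrated_by (fun x => phi x) eta.
Proof.
have marg (D : set (borel S)) (G : set (borel A)) : measurable D -> measurable G ->
    \int[marginal eta]_(x in D) phi x G = \int[eta]_z ((\1_D z.1)%:E * phi z.1 G).
  move=> mD mG; rewrite integral_mkcond /marginal ge0_integral_pushforward//; last 2 first.
  - apply/(measurable_restrictT _ mD); apply: measurable_funTS; by apply: mphi.
  - by move=> x _; rewrite patchE; case: ifP.
  apply: eq_integral => z _ /=; rewrite patchE indicE.
  by case: ifP => _; rewrite ?mul1e ?mul0e.
have key x (D : set (borel S)) (G : set (borel A)) : measurable D -> measurable G ->
    \int[phi x]_a (\1_(D `*` G) (x, a))%:E = (\1_D x)%:E * phi x G.
  move=> mD mG; transitivity (\int[phi x]_a ((\1_D x)%:E * (\1_G a)%:E)).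
    apply: eq_integral => a _; rewrite -EFinM -[in RHS]natrM !indicE mulnb; congr (_%:R%:E).
    by congr nat_of_bool; apply/idP/andP; rewrite !inE /=.
  rewrite ge0_integralZl_EFin//; last exact: emeasurable_indic.
  by rewrite integral_indic// setIT.
have mphi1 U : measurable U -> measurable_fun setT (fun z : borel S * borel A => phi z.1 U).
  by move=> mU; apply: (measurableT_comp (mphi mU)); exact: measurable_fst.
have mpair : measurable_fun setT (fun za : (borel S * borel A) * borel A => (za.1.1, za.2)).
  apply: measurable_fun_pair; last exact: measurable_snd.
  exact: (measurableT_comp measurable_fst measurable_fst).
split=> [dis|c D G mD mG]; last first.
  have mDG := measurableX mD mG.
  rewrite marg// measure_integral_indic// (c (fun z => (\1_(D `*` G) z)%:E))//;
    last exact: emeasurable_indic.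
  by apply: eq_integral => z _; rewrite key.
have [eta2 eta2f] := @mixed_law_exists _ _ _ _ _ _ R eta (cst 1%R) (fun z => phi z.1)
  (fun za => (za.1.1, za.2)) (fun _ => ler01) (measurable_cst _) mphi1
  (fun z => prob_kernel z.1) mpair.
have eq2 E : measurable E -> eta E = eta2 E.
  apply: measure_eq_rectangles; last by rewrite [X in X < _](@probability_setT _ _ _ eta) ltry.
  move=> D G mD mG; apply: (etrans (dis D G mD mG)).
  have mDG := measurableX mD mG.
  rewrite marg// measure_integral_indic// eta2f//; last exact: emeasurable_indic.
  by apply: eq_integral => z _; rewrite mul1e key.
move=> f f0 mf.
rewrite (@eq_measure_integral _ _ _ _ eta2 eta)//; last by move=> E mE _; exact: eq2.
by rewrite eta2f//; apply: eq_integral => z _; rewrite mul1e.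
Qed.

End conditional_laws.

(** For each measurable set the two kernels agree off a null set. Finite
    intersections of basic open sets form a countable family that is stable under
    intersection and generates the sigma-algebra, and so one null set suffices. *)
Lemma kernels_ae_equal (R : realType) (S A : ptopologicalType)
    (polishA : polish R A) (phi phi' : R.-pker (borel S) ~> (borel A))
    (nu : {measure set (borel S) -> \bar R}) :
  nu setT < +oo ->
  (forall (D : set (borel S)) (G : set (borel A)), measurable D -> measurable G ->
    \int[nu]_(x in D) phi' x G = \int[nu]_(x in D) phi x G) ->
  {ae nu, forall x, forall G, measurable G -> phi' x G = phi x G}.
Proof.
move=> nufin h.
have [U [oU Ubase]] := polish_countable_base polishA.
pose V (s : seq nat) : set (borel A) := \big[setI/setT]_(i <- s) U i.
have mV s : measurable (V s).
  rewrite /V; elim: s => [|i s IH]; first by rewrite big_nil.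
  by rewrite big_cons; apply: measurableI => //; exact: borel_open.
pose Vn (n : nat) := V (odflt [::] (unpickle n)).
have genV : (measurable : set (set (borel A))) = <<s range V >>.
  apply/seteqP; split; apply: smallest_sub.
  - exact: smallest_sigma_algebra.
  - move=> O oO.
    have -> : O = \bigcup_(i in [set i | U i `<=` O]) U i.
      apply/seteqP; split=> [x Ox|x [i /= UO Ux]]; last exact: UO.
      by have [i [Ux UO]] := Ubase _ _ oO Ox; exists i.
    apply: (@bigcup_measurable _ (g_sigma_algebraType (range V))) => i _.
    apply: sub_sigma_algebra; exists [:: i] => //.
    by rewrite /V big_cons big_nil setIT.
  - exact: sigma_algebra_measurable.
  - by move=> _ [s _ <-]; exact: mV.
have eqV n : {ae nu, forall x, phi' x (Vn n) = phi x (Vn n)}.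
  have mk (psi : R.-pker (borel S) ~> (borel A)) : measurable_fun setT (psi ^~ (Vn n)).
    by apply: measurable_kernel; exact: mV.
  have i1 : nu.-integrable setT (fun x => phi' x (Vn n)).
    apply/integrableP; split; first exact: mk.
    apply: (@le_lt_trans _ _ (\int[nu]_x cst 1 x)).
      apply: ge0_le_integral => //.
      - by apply: measurableT_comp => //; exact: mk.
      - move=> x _; rewrite gee0_abs//; apply: le_trans (sprob_kernel_le1 phi' x).
        by apply: le_measure; rewrite ?inE//; exact: mV.
    by rewrite integral_cst// mul1e.
  have := integral_ae_eq measurableT i1 (mk phi) (fun E _ mE => h E _ mE (mV _)).
  by apply: filterS => x; apply.
have := ae_foralln eqV; apply: filterS => x eqx G mG.
apply: (measure_unique (range V) (fun _ => setT) genV) => //.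
- move=> _ _ [s _ <-] [t _ <-]; exists (s ++ t) => //.
  by rewrite /V big_cat.
- by move=> _; exists [::] => //; rewrite /V big_nil.
- by rewrite bigcup_const.
- by move=> _ [s _ <-]; have := eqx (pickle s); rewrite /Vn pickleK.
- by move=> _; rewrite prob_kernel ltry.
Qed.

(** * The balance equation *)

Lemma continuous_borel (R : realType) (T : ptopologicalType) (f : T -> R) :
  continuous f -> measurable_fun setT (f : borel T -> R).
Proof.
move=> cf; apply: (measurability _ (RGenOInfty.measurableE R)).
move=> _ [_ [a ->] <-]; rewrite setTI; apply: borel_open.
by apply: open_comp => // x _; exact: cf.
Qed.

(** Additivity of the integral with an integrable subtrahend only; the integral
    of [g] may be infinite. *)
Lemma ge0_integral_sub d (T : measurableType d) (R : realType)
    (mu : {measure set T -> \bar R}) (D : set T) (g h : T -> R) :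
  measurable D -> measurable_fun D g -> measurable_fun D h ->
  (forall x, D x -> (0 <= g x)%R) -> (forall x, D x -> (0 <= h x)%R) ->
  \int[mu]_(x in D) (h x)%:E < +oo ->
  \int[mu]_(x in D) (g x - h x)%:E =
  \int[mu]_(x in D) (g x)%:E - \int[mu]_(x in D) (h x)%:E.
Proof.
move=> mD mg mh g0 h0 hfin.
have ih : mu.-integrable D (EFin \o h).
  apply/integrableP; split; first exact/measurable_EFinP.
  apply: le_lt_trans hfin; apply: ge0_le_integral => //.
  - by apply/measurable_EFinP; apply: measurableT_comp.
  - exact/measurable_EFinP.
  - by move=> x Dx; rewrite /= lee_fin ger0_norm// h0.
have [gfin|ginf] := ltP (\int[mu]_(x in D) (g x)%:E) +oo.
  have ig : mu.-integrable D (EFin \o g).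
    apply/integrableP; split; first exact/measurable_EFinP.
    apply: le_lt_trans gfin; apply: ge0_le_integral => //.
    - by apply/measurable_EFinP; apply: measurableT_comp.
    - exact/measurable_EFinP.
    - by move=> x Dx; rewrite /= lee_fin ger0_norm// g0.
  by rewrite -integralB_EFin//; apply: eq_integral => x _; rewrite EFinB.
have gE : \int[mu]_(x in D) (g x)%:E = +oo by apply/eqP; rewrite -leye_eq.
have hf : \int[mu]_(x in D) (h x)%:E \is a fin_num.
  by rewrite ge0_fin_numE// integral_ge0// => x Dx; rewrite lee_fin h0.
rewrite gE addye; last by rewrite -fin_numN in hf; case: (- _) hf.
pose f x := (g x - h x)%R.
have mf : measurable_fun D (EFin \o f).
  by apply/measurable_EFinP; exact: measurable_funB.
have neg : \int[mu]_(x in D) (fun x => (f x)%:E)^\- x < +oo.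
  apply: le_lt_trans hfin; apply: ge0_le_integral => //.
  - exact: measurable_funeneg.
  - exact/measurable_EFinP.
  - move=> x Dx; rewrite funenegE -EFinN ge_max !lee_fin h0// andbT.
    by rewrite /f opprB lerBlDr lerDl g0.
have pos : \int[mu]_(x in D) (fun x => (f x)%:E)^\+ x = +oo.
  have : \int[mu]_(x in D) (g x)%:E <=
      \int[mu]_(x in D) ((fun x => (f x)%:E)^\+ x + (h x)%:E).
    apply: ge0_le_integral => //.
    - exact/measurable_EFinP.
    - apply: emeasurable_funD; last exact/measurable_EFinP.
      exact: measurable_funepos.
    - move=> x Dx; rewrite -leeBlDr// funeposE -EFinB.
      by rewrite le_max lexx.
  rewrite ge0_integralD//; last 2 first.
  - exact: measurable_funepos.
  - exact/measurable_EFinP.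
  rewrite gE leye_eq => /eqP h1.
  by move: h1 hf; case: (\int[mu]_(x in D) (h x)%:E) => //; case: (integral _ _ _).
rewrite integralE pos addye//.
have : 0 <= \int[mu]_(x in D) (fun x => (f x)%:E)^\- x by exact: integral_ge0.
by move: neg; case: (integral _ _ _).
Qed.

Section lyapunov.
Context {R : realType} {S A : ptopologicalType}.
Variables (adm : S -> set A) (q : S -> A -> {charge set (borel S) -> \bar R}).
Hypotheses (polishS : polish R S) (model : ctmdp adm q).
Variable Q : borel S * borel A -> {measure set (borel S) -> \bar R}.
Hypothesis QE : forall x a D, adm x a -> measurable D ->
  Q (x, a) D = q x a (D `\ x).
Hypothesis Q0 : forall z D, ~ graph adm z -> Q z D = 0.
Hypothesis mQ : forall D, measurable D -> measurable_fun setT (Q ^~ D).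

Lemma jump_rate_finT z D : measurable D -> Q z D \is a fin_num.
Proof.
move=> mD; have [gz|gz] := pselect (graph adm z); last by rewrite Q0.
by case: z gz => x a gz; apply: (jump_rate_fin polishS QE).
Qed.

(** On a set [D] of states with bounded exit rates the outflow is finite and may
    be subtracted. *)
Lemma balance_jump_rate (eta : {measure set (borel S * borel A) -> \bar R})
    (D : set (borel S)) (C : R) (x y : \bar R) :
  eta setT < +oo -> eta (~` graph adm) = 0 -> measurable D ->
  (forall z, graph adm z -> D z.1 -> Q z setT <= C%:E) -> 0 <= y ->
  (x + \int[eta]_z ((\1_D z.1)%:E * Q z setT) = y + \int[eta]_z Q z D) <->
  (x = y + \int[eta]_(z in graph adm) q z.1 z.2 D).
Proof.
move=> etafin eta0 mD DC y0.
have mG := graph_measurable model.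
pose g z := fine (Q z D).
pose h z := (\1_D z.1 * fine (Q z setT))%R.
have gE z : (g z)%:E = Q z D by rewrite fineK// jump_rate_finT.
have hE z : (h z)%:E = (\1_D z.1)%:E * Q z setT.
  by rewrite EFinM fineK// jump_rate_finT.
have mg : measurable_fun setT g by apply: measurableT_comp => //; exact: mQ.
have mh : measurable_fun setT h.
  apply: measurable_funM; last by apply: measurableT_comp => //; exact: mQ.
  by apply: measurableT_comp; [exact: measurable_indic|exact: measurable_fst].
have g0 z : (0 <= g z)%R by rewrite fine_ge0.
have h0 z : (0 <= h z)%R by rewrite mulr_ge0// fine_ge0.
have restrict (f : borel S * borel A -> R) : (forall z, (0 <= f z)%R) ->
    measurable_fun setT f -> \int[eta]_z (f z)%:E = \int[eta]_(z in graph adm) (f z)%:E.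
  move=> f0 mf; rewrite (@ge0_negligible_integral _ _ _ eta setT (~` graph adm))//.
  - by rewrite setTD setCK.
  - exact: measurableC.
  - exact/measurable_EFinP.
  - by move=> z _; rewrite lee_fin.
have hfin : \int[eta]_(z in graph adm) (h z)%:E < +oo.
  apply: (@le_lt_trans _ _ (\int[eta]_(z in graph adm) (`|C|%:E))).
    apply: ge0_le_integral => //.
    - by move=> z _; rewrite lee_fin.
    - by apply/measurable_EFinP; exact: measurable_funTS.
    - move=> z gz; rewrite hE indicE; have [zD|zD] := boolP (z.1 \in D);
        last by rewrite mul0e lee_fin.
      rewrite mul1e (le_trans (DC _ gz _)) ?lee_fin ?ler_norm//.
      by rewrite inE in zD.
  rewrite integral_cst//.
  have : eta (graph adm) < +oo by rewrite (le_lt_trans _ etafin)// le_measure// inE.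
  by apply: lte_mul_pinfty; rewrite ?lee_fin.
have hfn : \int[eta]_(z in graph adm) (h z)%:E \is a fin_num.
  by rewrite ge0_fin_numE// integral_ge0// => z _; rewrite lee_fin.
have -> : \int[eta]_(z in graph adm) q z.1 z.2 D =
    \int[eta]_(z in graph adm) (g z - h z)%:E.
  apply: eq_integral => -[s a]; rewrite inE => gz /=.
  by rewrite (rateE polishS model QE gz mD) EFinB gE hE.
rewrite ge0_integral_sub//; last 2 first.
- exact: measurable_funTS.
- exact: measurable_funTS.
have -> : \int[eta]_z ((\1_D z.1)%:E * Q z setT) = \int[eta]_(z in graph adm) (h z)%:E.
  by rewrite -(restrict h)//; apply: eq_integral => z _; rewrite hE.
have -> : \int[eta]_z Q z D = \int[eta]_(z in graph adm) (g z)%:E.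
  by rewrite -(restrict g)//; apply: eq_integral => z _; rewrite gE.
move: (\int[eta]_(z in _) (g z)%:E) (\int[eta]_(z in _) (h z)%:E) hfn => G H hfn.
rewrite addeA; split => [<-|->]; first by rewrite addeK.
by rewrite subeK.
Qed.

Variables (w : S -> R) (rho b : R) (S_ : nat -> set S).
Hypotheses (w_cont : continuous w) (w_ge1 : forall x, (1 <= w x)%R).
Hypothesis b_ge0 : (0 <= b)%R.
Hypothesis drift : forall x a, adm x a ->
  charge_integral (q x a) (fun y => (w y)%:E) <= (rho * w x + b)%:E.
Hypothesis w_infty :
  (fun k => ereal_inf [set (w x)%:E | x in ~` S_ k]) @ \oo --> +oo.
Hypothesis S_bounded : forall k,
  ereal_sup [set `|q z.1 z.2 [set z.1]| | z in
              [set z | adm z.1 z.2 /\ S_ k z.1]] < +oo.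

(** The constant [b] is absorbed into the factor of [w], as [w >= 1]. *)
Lemma jump_drift z : graph adm z ->
  \int[Q z]_x (w x)%:E <= ((rho + b) * w z.1)%:E + Q z setT * (w z.1)%:E.
Proof.
case: z => x a xa /=.
apply: (le_trans (integral_jump_rate_le polishS model QE xa
  (continuous_borel w_cont) _ (drift xa))).
  by move=> y; rewrite (le_trans _ (w_ge1 y)).
rewrite leeD2r// lee_fin mulrDl lerD2l ler_peMr//.
Qed.

(** A sublevel set of [w] is contained in some [S_ k]. *)
Lemma jump_rate_bounded (r : R) : exists C : R, forall z, graph adm z ->
  (w z.1 <= r)%R -> Q z setT <= C%:E.
Proof.
have [k kr] : exists k, r%:E < ereal_inf [set (w x)%:E | x in ~` S_ k].
  have /cvgeyPgt/(_ r) := w_infty => h.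
  by near \oo => k; exists k; near: k.
have sub x : (w x <= r)%R -> S_ k x.
  move=> wx; apply: contrapT => Sx.
  have : ereal_inf [set (w x)%:E | x in ~` S_ k] <= (w x)%:E.
    by apply: ereal_inf_lbound; exists x.
  by move=> /(lt_le_trans kr); rewrite lte_fin ltNge wx.
have := S_bounded k; set s := ereal_sup _ => sfin.
exists (fine (maxe s 0)) => -[x a] xa /= wx; rewrite fineK; last first.
  by rewrite ge0_fin_numE ?le_max ?lexx ?orbT// gt_max sfin ltry.
rewrite -(jump_rate_abs polishS model QE xa) le_max; apply/orP; left.
by apply: ereal_sup_ubound; exists (x, a) => //=; split=> //; exact: sub.
Unshelve. all: end_near. Qed.

Variables (alpha : R) (gamma : probability (borel S) R).
Hypothesis alpha_gt0 : (0 < alpha)%R.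
Local Notation Om := (Omega R S).

Lemma policy_occupation
    (pi : Defs.path R S * R -> {measure set (option (borel A)) -> \bar R})
    (P : probability Om R) :
  (forall et, pi et setT = 1) ->
  (forall (e : Defs.path R S) (t : R), (0 <= t)%R ->
    pi (e, t) (adm_infty adm (xi_left e t)) = 1) ->
  (forall U, measurable U ->
    measurable_fun [set: Om * measurableTypeR R] (pi ^~ U)) ->
  path_law adm q (fun et => pi et) gamma P ->
  exists N M, occupation_decomposition adm Q pi P alpha gamma N M.
Proof.
move=> pi_T pi_adm mpi [P0 [m hrep law_m]].
exact: (occupation_decomposition_exists polishS model QE mQ pi_T pi_adm hrep law_m
  mpi (continuous_borel w_cont) w_ge1 jump_drift jump_rate_bounded
  (fun z => jump_rate_finT z measurableT) alpha_gt0 P0).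
Qed.

Let marginalE (eta : probability (borel S * borel A)%type R) D :
  marginal eta D = eta (D `*` setT).
Proof.
by rewrite /marginal /pushforward; congr (eta _); apply/seteqP; split=> z //= [].
Qed.

Let integral_scaled (c : R) (nu mu : {measure set (borel S * borel A) -> \bar R}) f :
  (0 <= c)%R -> (forall E, measurable E -> nu E = c%:E * mu E) ->
  (forall z, 0 <= f z) -> measurable_fun setT f ->
  \int[nu]_z f z = c%:E * \int[mu]_z f z.
Proof.
move=> c0 nuE f0 mf.
rewrite (@eq_measure_integral _ _ _ _ (mscale (NngNum c0) mu) nu)//.
  by rewrite ge0_integral_mscale.
by move=> E mE _; exact: nuE.
Qed.

Lemma series_disintegrated (phi : R.-pker (borel S) ~> (borel A))
    (M : nat -> {measure set (borel S * borel A) -> \bar R})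
    (eta : {measure set (borel S * borel A) -> \bar R}) :
  (forall k, disintegrated_by (fun x => phi x) (M k)) ->
  (forall E, measurable E -> eta E = alpha%:E * mseries M 0 E) ->
  disintegrated_by (fun x => phi x) eta.
Proof.
move=> Mc etaE f f0 mf.
have mF : measurable_fun setT (fun z : borel S * borel A => \int[phi z.1]_a f (z.1, a)).
  have h := measurable_fun_integral_probability (fun G mG => measurable_kernel phi G mG)
    (fun x => prob_kernel x) mf f0.
  by have := measurableT_comp h (@measurable_fst _ _ (borel S) (borel A)).
have F0 (z : borel S * borel A) : 0 <= \int[phi z.1]_a f (z.1, a) by exact: integral_ge0.
rewrite !(integral_scaled (ltW alpha_gt0) etaE)//; congr (_ * _).
rewrite (ge0_integral_measure_series _ measurableT (fun z _ => f0 z) mf).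
rewrite (ge0_integral_measure_series _ measurableT (fun z _ => F0 z) mF).
by apply: eq_eseriesr => k _; exact: Mc.
Qed.

Let mjump D : measurable D ->
  measurable_fun setT (fun z : borel S * borel A => (\1_D z.1)%:E * Q z setT).
Proof.
move=> mD; apply: emeasurable_funM; last exact: mQ.
by apply/measurable_EFinP; apply: measurableT_comp; [exact: measurable_indic|exact: measurable_fst].
Qed.

Let jump_ge0 D z : 0 <= (\1_D z.1)%:E * Q z setT.
Proof. by rewrite mule_ge0// lee_fin. Qed.

Section decomposed.
Variables (pi : Defs.path R S * R -> {measure set (option (borel A)) -> \bar R})
  (P : probability Om R).
Variables (N : nat -> {measure set (borel S) -> \bar R})
    (M : nat -> {measure set (borel S * borel A) -> \bar R}).
Hypothesis dec : occupation_decomposition adm Q pi P alpha gamma N M.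
Variable eta : probability (borel S * borel A)%type R.
Hypothesis eta_graph : eta (~` graph adm) = 0.

Let eta_fin : eta setT < +oo.
Proof. by rewrite [X in X < _](@probability_setT _ _ _ eta) ltry. Qed.

Let gamma_ge0 D : 0 <= alpha%:E * gamma D.
Proof. by rewrite mule_ge0// lee_fin ltW. Qed.

Lemma occupation_balance : (forall E, measurable E -> eta E = alpha%:E * mseries M 0 E) ->
  balance_equation adm q alpha gamma eta.
Proof.
case: dec => [[_ MK] next split [N_cvg0 N0] _] etaE D mD Dsup.
pose C := fine (maxe (ereal_sup [set qstar adm q x | x in D]) 0).
have DC z : graph adm z -> D z.1 -> Q z setT <= C%:E.
  case: z => x a xa Dx; rewrite /C fineK; last first.
    by rewrite ge0_fin_numE ?le_max ?lexx ?orbT// gt_max Dsup ltry.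
  apply: (le_trans (jump_rate_le_qstar polishS model QE xa)); rewrite le_max; apply/orP; left.
  by apply: ereal_sup_ubound; exists x.
apply/(@balance_jump_rate eta D C _ _ eta_fin eta_graph mD DC (gamma_ge0 D)).
rewrite marginalE etaE; last exact: measurableX.
rewrite !(integral_scaled (ltW alpha_gt0) etaE)//; [|exact: mQ|exact: mjump].
rewrite -!ge0_muleDr//; last 3 first.
- exact: integral_ge0.
- by rewrite mule_ge0// lee_fin ltW.
- by apply: integral_ge0 => z _; exact: jump_ge0.
by rewrite (total_flow alpha_gt0 mQ next split N_cvg0 mD) N0.
Qed.

(** The sublevel sets of [w] have bounded rates, so that the balance equation
    holds on their subsets, and they exhaust the state space. *)
Lemma balanced_is_occupation (phi : R.-pker (borel S) ~> (borel A)) :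
  (forall k, disintegrated_by (fun x => phi x) (M k)) ->
  disintegrated_by (fun x => phi x) eta ->
  balance_equation adm q alpha gamma eta ->
  forall E, measurable E -> eta E = alpha%:E * mseries M 0 E.
Proof.
case: dec => [[_ MK] next split [N_cvg0 N0] _] Mc etac bal.
have ia0 : (0 <= alpha^-1)%R by rewrite invr_ge0 ltW.
pose theta : {measure set (borel S * borel A) -> \bar R} := mscale (NngNum ia0) eta.
have thetaE E : theta E = (alpha^-1)%:E * eta E by [].
have aK (x : \bar R) : alpha%:E * ((alpha^-1)%:E * x) = x.
  by rewrite muleA -EFinM divff ?gt_eqF// mul1e.
have Ka (x : \bar R) : (alpha^-1)%:E * (alpha%:E * x) = x.
  by rewrite muleA -EFinM mulVf ?gt_eqF// mul1e.
have tint f := integral_scaled (f := f) ia0 (fun E _ => thetaE E).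
have thetac : disintegrated_by (fun x => phi x) theta.
  move=> f f0 mf; rewrite !tint//.
  - by rewrite etac.
  - by move=> z; exact: integral_ge0.
  - have h := measurable_fun_integral_probability
      (fun G mG => measurable_kernel phi G mG) (fun x => prob_kernel x) mf f0.
    by have := measurableT_comp h (@measurable_fst _ _ (borel S) (borel A)).
have partial_flow (r : R) (D : set (borel S)) : measurable D -> D `<=` [set x | (w x <= r)%R] ->
    alpha%:E * theta (D `*` setT) + \int[theta]_z ((\1_D z.1)%:E * Q z setT) =
    N 0%N D + \int[theta]_z Q z D.
  move=> mD Dw; have [C HC] := jump_rate_bounded r.
  have DC z : graph adm z -> D z.1 -> Q z setT <= C%:E.
    by move=> gz Dz; apply: HC => //; exact: Dw.
  have Dsup : ereal_sup [set qstar adm q x | x in D] < +oo.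
    apply: (@le_lt_trans _ _ C%:E); last exact: ltry.
    apply: ge_ereal_sup => _ [x Dx <-]; apply: ge_ereal_sup => _ [a xa <-].
    by rewrite (jump_rate_abs polishS model QE xa) (DC (x, a)).
  have /(@balance_jump_rate eta D C _ _ eta_fin eta_graph mD DC (gamma_ge0 D)) h :=
    bal D mD Dsup.
  rewrite thetaE aK !tint//; [|exact: mQ|exact: mjump].
  have distr (x y : \bar R) : 0 <= x -> 0 <= y ->
      (alpha^-1)%:E * (alpha%:E * x + y) = x + (alpha^-1)%:E * y.
    move=> x0 y0; rewrite ge0_muleDr ?Ka//.
    by apply: mule_ge0 => //; rewrite lee_fin ltW.
  rewrite N0// -distr//; last by apply: integral_ge0 => z _; exact: jump_ge0.
  rewrite -distr//; last exact: integral_ge0.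
  by congr (_ * _); rewrite -marginalE.
have lam_fin x : \int[phi x]_a Q (x, a) setT < +oo.
  pose c := maxe (qstar adm q x) 0.
  have cfin : c < +oo by rewrite gt_max (rate_stable model) ltry.
  apply: le_lt_trans cfin; apply: (@le_trans _ _ (\int[phi x]_a cst c a)).
    apply: ge0_le_integral => //.
    - by apply: (measurableT_comp (mQ measurableT)); exact: measurable_pair1.
    - move=> a _; have [xa|xa] := pselect (adm x a).
        by rewrite le_max (jump_rate_le_qstar polishS model QE xa).
      by rewrite Q0// le_max lexx orbT.
  by rewrite integral_cst//= prob_kernel mule1.
move=> E mE; rewrite -(flow_solution_unique alpha_gt0 mQ
  (fun z => jump_rate_finT z measurableT) next split
  (fun G mG => measurable_kernel phi G mG) (fun x => prob_kernel x)
  (continuous_borel w_cont) lam_fin Mc thetac partial_flow)//.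
- by rewrite thetaE aK.
- by rewrite N0// [X in X < _](@probability_setT _ _ _ gamma) ltry.
- by rewrite thetaE aK N0// [LHS](@probability_setT _ _ _ eta) [RHS](@probability_setT _ _ _ gamma).
Qed.

End decomposed.

End lyapunov.

(** * The theorem *)

Theorem theorem3p5 (R : realType) (S A : ptopologicalType)
    (polishS : polish R S) (polishA : polish R A)
    (adm : S -> set A) (q : S -> A -> {charge set (borel S) -> \bar R})
    (model : ctmdp adm q)
    (alpha : R) (alpha_gt0 : (0 < alpha)%R)
    (gamma : probability (borel S) R)
    (w : S -> R) (w_cont : continuous w) (w_ge1 : forall x, (1 <= w x)%R)
    (rho b : R) (rho_ge0 : (0 <= rho)%R) (b_ge0 : (0 <= b)%R)
    (S_ : nat -> set S) (S_nondecreasing : forall k, S_ k `<=` S_ k.+1)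
    (drift : forall x a, adm x a ->
       charge_integral (q x a) (fun y => (w y)%:E) <= (rho * w x + b)%:E)
    (w_infty :
       (fun k => ereal_inf [set (w x)%:E | x in ~` S_ k]) @ \oo --> +oo)
    (S_cover : \bigcup_k S_ k = setT)
    (S_bounded : forall k,
       ereal_sup [set `|q z.1 z.2 [set z.1]| | z in
                   [set z | adm z.1 z.2 /\ S_ k z.1]] < +oo) :
  [/\ forall pi : R.-pker (predictable R S) ~> option (borel A),
        is_policy adm pi ->
        forall P : probability (Omega R S) R,
        path_law adm q (fun et => pi et) gamma P ->
        (exists eta, is_occupation_measure adm (fun et => pi et) alpha P eta) /\
        (forall eta, is_occupation_measure adm (fun et => pi et) alpha P eta ->
           balance_equation adm q alpha gamma eta),
      forall eta : probability (borel S * borel A)%type R,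
        eta (~` graph adm) = 0 ->
        balance_equation adm q alpha gamma eta ->
        forall phi, disintegrates adm eta phi ->
        \int[marginal eta]_x
          `|\int[phi x]_(a in adm x) q x a [set x]| < +oo ->
        forall P : probability (Omega R S) R,
        path_law adm q (stationary_policy phi) gamma P ->
        is_occupation_measure adm (stationary_policy phi) alpha P eta
    & (rho < alpha)%R ->
      \int[gamma]_x (w x)%:E < +oo ->
      (exists2 L : R, (0 < L)%R & forall x, qstar adm q x <= (L * w x)%:E) ->
      forall phi, is_stationary adm phi ->
      forall P : probability (Omega R S) R,
      path_law adm q (stationary_policy phi) gamma P ->
      forall eta, is_occupation_measure adm (stationary_policy phi) alpha P eta ->
      forall phi', disintegrates adm eta phi' ->
      {ae marginal eta, forall x, forall G, measurable G -> phi' x G = phi x G}].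
Proof.
have [Q [QE Q0 mQ]] := jump_rate_exists polishS model.
have etaE eta N M pi P : occupation_decomposition adm Q pi P alpha gamma N M ->
    is_occupation_measure adm (fun et => pi et) alpha P eta ->
    forall E, measurable E -> eta E = alpha%:E * mseries M 0 E.
  move=> [_ _ _ _ [eta0 eta0E occ0]] occ E mE.
  by rewrite (occupation_measure_unique occ occ0 mE) eta0E.
have dec := policy_occupation polishS model QE Q0 mQ w_cont w_ge1 b_ge0 drift
  w_infty S_bounded alpha_gt0.
have stat phi : is_stationary adm phi -> forall P : probability (Omega R S) R,
    path_law adm q (stationary_policy phi) gamma P ->
    exists (pi : Defs.path R S * R -> {measure set (option (borel A)) -> \bar R}) N M,
    [/\ (fun et => pi et : set (option (borel A)) -> \bar R) = stationary_policy phi,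
      occupation_decomposition adm Q pi P alpha gamma N M &
      forall k, disintegrated_by (fun x => phi x) (M k)].
  move=> phi_adm P law.
  have [pi [piE pi_T pi_adm mpi]] := stationary_measure_exists phi_adm.
  have [|N [M NM]] := dec gamma pi P pi_T pi_adm mpi; first by rewrite piE.
  exists pi, N, M; split=> // k; have [[ME _] _ _ _ _] := NM.
  exact: stay_disintegrated piE (ME k).
split.
- move=> pi pi_policy P law.
  have mpi U : measurable U ->
      measurable_fun [set: Omega R S * measurableTypeR R] (fun z => pi z U).
    move=> mU _ B mB; rewrite setTI; apply: sub_predictable.
    by have := measurable_kernel pi U mU measurableT B mB; rewrite setTI.
  have [|N [M NM]] := dec gamma (fun et => pi et) P _ pi_policy mpi law.
    by move=> et; exact: prob_kernel.
  split; first by have [_ _ _ _ [eta _ occ]] := NM; exists eta.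
  move=> eta occ.
  apply: (occupation_balance polishS model QE Q0 mQ alpha_gt0 NM _ (etaE _ _ _ _ _ NM occ)).
  by case: occ.
- move=> eta eta_graph bal phi [phi_adm dis] _ P law.
  have [pi [N [M [piE NM Mc]]]] := stat phi phi_adm P law.
  have etac := (disintegrates_disintegrated phi eta).1 dis.
  have eqE := balanced_is_occupation polishS model QE Q0 mQ w_cont w_infty S_bounded
    alpha_gt0 NM eta_graph Mc etac bal.
  have [_ _ _ _ [eta0 eta0E [_ occ0]]] := NM.
  split=> // D G mD mG; rewrite -piE -(occ0 D G mD mG) eta0E eqE//.
  exact: measurableX.
- move=> _ _ _ phi phi_adm P law eta occ phi' [phi'_adm dis'].
  have [pi [N [M [piE NM Mc]]]] := stat phi phi_adm P law.
  rewrite -piE in occ.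
  have eqE := etaE _ _ _ _ _ NM occ.
  have etac := series_disintegrated alpha_gt0 Mc eqE.
  have dis := (disintegrates_disintegrated phi eta).2 etac.
  apply: (kernels_ae_equal polishA) => [|D G mD mG].
    by rewrite [X in X < _](@probability_setT _ _ _ eta) ltry.
  exact: etrans (esym (dis' D G mD mG)) (dis D G mD mG).
Qed.
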